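(* Gap rigidity fails for the pair $(\Delta^2,\Delta\times\{0\})$, where $\Delta\subset\mathbb C$ is the unit disk and $\Delta\times\{0\}\subset\Delta^2$ is the standard totally geodesic embedding. That is: for every $\epsilon>0$ there exist a torsion-free discrete group $\Gamma$ of biholomorphic automorphisms of $\Delta^2$ and a compact complex curve $S\subset X=\Delta^2/\Gamma$ which is $\epsilon$-geodesic and modeled on $(\Delta^2,\Delta\times\{0\})$, but which is not totally geodesic.
   Context: Let $\Omega$ be a bounded symmetric domain equipped with a canonical (invariant Kähler–Einstein) metric, here $\Delta^2$ with the product of Poincaré metrics, and let $i:D\hookrightarrow\Omega$ be a totally geodesic holomorphic embedding of a bounded symmetric domain $D$. For $X=\Omega/\Gamma$, $\Gamma$ a torsion-free discrete group of automorphisms, a compact complex submanifold $S\subset X$ is called $\epsilon$-geodesic if the norm of its second fundamental form in $X$ is uniformly bounded by $\epsilon$. For $\epsilon$ small such an $S$ locally resembles exactly one model $(\Omega,D;i)$ (up to $\mathrm{Aut}(\Omega)$); $S$ is said to be modeled on $(\Omega,D;i)$ if, for every point of a lift $\widetilde S\subset\Omega$ of $S$, after moving that point to a base point by an automorphism of $\Omega$, the piece of $\widetilde S$ in a fixed geodesic ball is close (as complex-analytic subvarieties) to the corresponding piece of $i(D)$. Gap rigidity holds for $(\Omega,D;i)$ if there is $\epsilon>0$ such that for every such $X$, every $\epsilon$-geodesic compact complex submanifold $S\subset X$ modeled on $(\Omega,D;i)$ is totally geodesic. *)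

(* Defs.v *)
From HB Require Import structures.
From mathcomp Require Import all_boot all_order all_algebra.
From mathcomp Require Import all_classical all_reals all_analysis.
From mathcomp Require Import complex.
Set Implicit Arguments. Unset Strict Implicit. Unset Printing Implicit Defensive.
Import Order.TTheory GRing.Theory Num.Theory.
Import numFieldNormedType.Exports.
Local Open Scope classical_set_scope.
Local Open Scope ring_scope.
Local Open Scope complex_scope.

Section BidiskDefs.
Variable R : realType.
Local Notation C := (R[i]).

Definition nc (z : C) : R := ComplexField.Normc.normc z.
Definition cconj (z : C) : C := conjc z.

Definition bidisk (p : C * C) : Prop := nc p.1 < 1 /\ nc p.2 < 1.

Definition mob (a u : C) (z : C) : C := u * (z - a) / (1 - cconj a * z).

(** All biholomorphic automorphisms of Delta^2 (Cartan): products of disk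
    automorphisms, possibly composed with the swap of coordinates. *)
Definition aut_formula (s : bool) (a1 u1 a2 u2 : C) (p : C * C) : C * C :=
  if s then (mob a1 u1 p.2, mob a2 u2 p.1) else (mob a1 u1 p.1, mob a2 u2 p.2).

Definition is_aut (g : C * C -> C * C) : Prop :=
  exists (s : bool) (a1 u1 a2 u2 : C),
    [/\ nc a1 < 1, nc a2 < 1, nc u1 = 1, nc u2 = 1 &
        forall p, bidisk p -> g p = aut_formula s a1 u1 a2 u2 p].

Definition eqD (g h : C * C -> C * C) : Prop := forall p, bidisk p -> g p = h p.

Definition aut_group (G : set (C * C -> C * C)) : Prop :=
  [/\ (forall g, G g -> is_aut g),
      G id,
      (forall g h, G g -> G h -> G (g \o h)) &
      (forall g, G g -> exists h, [/\ G h, eqD (h \o g) id & eqD (g \o h) id])].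

Definition torsion_free (G : set (C * C -> C * C)) : Prop :=
  forall g (n : nat), G g -> (0 < n)%N -> eqD (iter n g) id -> eqD g id.

(** discrete in Aut(Delta^2) (compact-open topology): the identity is isolated,
    i.e. some basic neighbourhood {g | sup_K |g - id| < d} of id, with K a
    closed polydisk of radius r < 1, contains no other element of G. *)
Definition discrete_group (G : set (C * C -> C * C)) : Prop :=
  exists r d : R, [/\ 0 < r, r < 1, 0 < d &
    forall g, G g ->
      (forall p, nc p.1 <= r -> nc p.2 <= r ->
         nc ((g p).1 - p.1) < d /\ nc ((g p).2 - p.2) < d) ->
      eqD g id].

Definition holo_on (c : C) (rho : R) (f : C -> C) : Prop :=
  forall w, nc (w - c) < rho ->
    derivable (f : C^o -> C^o) w 1 /\
    derivable ((fun v => 'D_1 (f : C^o -> C^o) v) : C^o -> C^o) w 1.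

Definition d1 (f : C -> C) (w : C) : C := 'D_1 (f : C^o -> C^o) w.
Definition d2 (f : C -> C) (w : C) : C :=
  'D_1 ((fun v => 'D_1 (f : C^o -> C^o) v) : C^o -> C^o) w.

(** A closed complex submanifold of dimension 1 of Delta^2: closed in Delta^2
    and locally (in a polydisk around each of its points) the graph of a
    holomorphic function over one of the two coordinate axes. *)
Definition cplx_curve (S : set (C * C)) : Prop :=
  [/\ (forall p, S p -> bidisk p),
      (forall p, bidisk p ->
         (forall e : R, 0 < e -> exists q, S q /\ nc (q.1 - p.1) < e /\ nc (q.2 - p.2) < e) ->
         S p) &
      (forall p, S p -> exists (eta : R) (f : C -> C) (b : bool),
         0 < eta /\
         if b then
           holo_on p.1 eta f /\
           forall q : C * C, nc (q.1 - p.1) < eta -> nc (q.2 - p.2) < eta ->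
             (S q <-> q.2 = f q.1)
         else
           holo_on p.2 eta f /\
           forall q : C * C, nc (q.1 - p.1) < eta -> nc (q.2 - p.2) < eta ->
             (S q <-> q.1 = f q.2))].

(** S is the (Gamma-invariant) preimage in Delta^2 of a nonempty compact
    complex curve of X = Delta^2 / Gamma. *)
Definition compact_curve_lift (G : set (C * C -> C * C)) (S : set (C * C)) : Prop :=
  [/\ cplx_curve S,
      (exists p, S p),
      (forall g p, G g -> S p -> S (g p)) &
      (exists r : R, r < 1 /\
         forall p, S p -> exists g q, [/\ G g, S q, nc q.1 <= r, nc q.2 <= r & p = g q])].

Definition curve_param (S : set (C * C)) (rho : R) (f1 f2 : C -> C) : Prop :=
  [/\ 0 < rho, holo_on 0 rho f1, holo_on 0 rho f2 &
      forall w, nc w < rho -> S (f1 w, f2 w) /\ (d1 f1 w, d1 f2 w) != (0, 0)].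

(** Product of Poincare metrics h_i = (1 - |z_i|^2)^-2 |dz_i|^2 on Delta^2. *)
Definition hmet (z : C) : C := ((1 - nc z ^+ 2) ^- 2)%:C.
(** Christoffel symbol Gamma^z_zz = d_z log h *)
Definition chr (z : C) : C := ((2 : R) / (1 - nc z ^+ 2))%:C * cconj z.
Definition hinner (z X Y : C * C) : C :=
  hmet z.1 * X.1 * cconj Y.1 + hmet z.2 * X.2 * cconj Y.2.

(** squared norm |sigma|^2 of the second fundamental form of the curve
    parametrized by (f1, f2) at the parameter w:
    T = phi'(w), A = nabla_T T, N = normal part of A,
    |sigma|^2 = |N|^2 / |T|^4. *)
Definition sff_sq (f1 f2 : C -> C) (w : C) : R :=
  let z := (f1 w, f2 w) in
  let T := (d1 f1 w, d1 f2 w) in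
  let A := (d2 f1 w + chr z.1 * (T.1 ^+ 2), d2 f2 w + chr z.2 * (T.2 ^+ 2)) in
  let c := hinner z A T / hinner z T T in
  let N := (A.1 - c * T.1, A.2 - c * T.2) in
  complex.Re (hinner z N N) / (complex.Re (hinner z T T)) ^+ 2.

Definition eps_geodesic (eps : R) (S : set (C * C)) : Prop :=
  forall rho f1 f2 w, curve_param S rho f1 f2 -> nc w < rho ->
    sff_sq f1 f2 w <= eps ^+ 2.

Definition totally_geodesic (S : set (C * C)) : Prop :=
  forall rho f1 f2 w, curve_param S rho f1 f2 -> nc w < rho -> sff_sq f1 f2 w = 0.

(** Poincare distance from 0 for the metric |dz|^2/(1-|z|^2)^2 *)
Definition pdist0 (t : R) : R := ln ((1 + t) / (1 - t)) / 2.
Definition geo_ball (p : C * C) : Prop :=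
  bidisk p /\ pdist0 (nc p.1) ^+ 2 + pdist0 (nc p.2) ^+ 2 < 1.

(** S is modeled on (Delta^2, Delta x {0}) with closeness threshold d: for every
    point p of S there is an automorphism g with g p = 0 such that, in the fixed
    geodesic ball, g(S) and Delta x {0} are d-close (Hausdorff sense). *)
Definition modeled_horizontal (d : R) (S : set (C * C)) : Prop :=
  forall p, S p -> exists g, [/\ is_aut g, g p = (0, 0),
     (forall q, S q -> geo_ball (g q) -> nc (g q).2 < d) &
     (forall x : C, geo_ball (x, 0) ->
        exists q, [/\ S q, nc ((g q).1 - x) < d & nc (g q).2 < d])].

End BidiskDefs.

(* Main.v *)
(* Let L = Z[i] and let F : Delta -> C be the universal branched covering of the plane with
   branching of order two over every point of L.  It exists because it is the limit of finite
   towers of two-sheeted branched coverings, normal by a Landau-type bound: |G'(0)| <= 48 for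
   every holomorphic G on Delta that takes each value in L with even multiplicities only.
   If F / n takes a value in L then F does too, so F / n again takes each value in L with even
   multiplicities, and it lifts to a holomorphic f : Delta -> Delta with F o f = F / n.
   The map f is equivariant for the lifts of the translations by n L.  The lifts of the
   translations by a sublattice of finite index form a cocompact group, in which a sign
   character cuts out a torsion-free subgroup of index at most two; it acts on the graph S of f
   with compact quotient.

   The derivative of F is bounded in the Poincare metric, hence f contracts as n grows:
   recentred at (z, f z), it tends to 0 on compact sets, uniformly in z.  This makes S close to
   Delta x {0} and, by Cauchy estimates, its second fundamental form small.  Where F takes the
   value 1, which is not in n L, F is critical and f is therefore critical with f'' <> 0, so S
   is not totally geodesic there. *)

Require Import Defs.
From HB Require Import structures.
From mathcomp Require Import all_boot all_order all_algebra.
From mathcomp Require Import all_classical all_reals all_analysis.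
From mathcomp Require Import complex.
From mathcomp Require Import ring lra zify.
Set Implicit Arguments. Unset Strict Implicit. Unset Printing Implicit Defensive.
Import Order.TTheory GRing.Theory Num.Theory.
Import numFieldNormedType.Exports.
Local Open Scope classical_set_scope.
Local Open Scope ring_scope.

Arguments nc : simpl never.

(** * The complex plane: modulus, topology, derivative *)

Section ComplexModulus.
Variable R : realType.
Local Notation C := (R[i]).
Implicit Types (x y z w : C) (r : R).

Lemma nc_sqr z : nc z ^+ 2 = complex.Re z ^+ 2 + complex.Im z ^+ 2.
Proof. by case: z => a b; rewrite /nc /= sqr_sqrtr // addr_ge0 ?sqr_ge0. Qed.

Lemma nc_ge0 z : 0 <= nc z.
Proof. by case: z => a b; rewrite /nc /= sqrtr_ge0. Qed.

Lemma nc0 : nc (0 : C) = 0.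
Proof. exact: ComplexField.Normc.normc0. Qed.

Lemma nc1 : nc (1 : C) = 1.
Proof. exact: ComplexField.Normc.normc1. Qed.

Lemma ncM x y : nc (x * y) = nc x * nc y.
Proof. exact: ComplexField.Normc.normcM. Qed.

Lemma ncV x : nc x^-1 = (nc x)^-1.
Proof. exact: ComplexField.Normc.normcV. Qed.

Lemma nc_div x y : nc (x / y) = nc x / nc y.
Proof. by rewrite ncM ncV. Qed.

Lemma ncN x : nc (- x) = nc x.
Proof. exact: normcN. Qed.

Lemma ncD x y : nc (x + y) <= nc x + nc y.
Proof. exact: le_normcD. Qed.

Lemma ncB x y : nc (x - y) <= nc x + nc y.
Proof. by rewrite -(ncN y) ncD. Qed.

Lemma nc_distC x y : nc (x - y) = nc (y - x).
Proof. by rewrite -ncN opprB. Qed.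

Lemma ncX x n : nc (x ^+ n) = nc x ^+ n.
Proof. by elim: n => [|n IH]; rewrite ?expr0 ?nc1 // !exprS ncM IH. Qed.

Lemma nc_eq0 x : (nc x == 0) = (x == 0).
Proof.
apply/idP/idP => [/eqP|/eqP ->]; last by rewrite nc0.
by move/ComplexField.Normc.eq0_normc => ->.
Qed.

Lemma nc_gt0 x : (0 < nc x) = (x != 0).
Proof. by rewrite lt_def nc_eq0 nc_ge0 andbT. Qed.

Lemma nc_real r : nc (r%:C%C : C) = `|r|.
Proof. by rewrite /nc /= expr0n /= addr0 sqrtr_sqr. Qed.

Lemma nc_nat n : nc (n%:R : C) = n%:R.
Proof.
have -> : (n%:R : C) = (n%:R : R)%:C%C by rewrite rmorph_nat.
by rewrite nc_real ger0_norm // ler0n.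
Qed.

Lemma nc_conj x : nc (cconj x) = nc x.
Proof. by case: x => a b; rewrite /nc /cconj /= sqrrN. Qed.

Lemma mul_cconj x : x * cconj x = (nc x ^+ 2)%:C%C.
Proof.
rewrite nc_sqr; case: x => a b; apply/eqP; rewrite eq_complex /cconj /=.
by apply/andP; split; apply/eqP; ring.
Qed.

Lemma ncB_ge x y : nc x - nc y <= nc (x - y).
Proof. by rewrite lerBlDr -{1}(subrK y x) ncD. Qed.

Lemma nc_triangle x y z : nc (x - z) <= nc (x - y) + nc (y - z).
Proof. by rewrite -{1}(subrK y x) -addrA ncD. Qed.

Lemma nc_distB x y : `|nc x - nc y| <= nc (x - y).
Proof. by rewrite ler_norml ncB_ge andbT lerNl opprB nc_distC ncB_ge. Qed.

Lemma normcE z : `|z| = (nc z)%:C%C.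
Proof. by []. Qed.

Lemma Re_le_nc x : `|complex.Re x| <= nc x.
Proof.
rewrite -(@ler_pXn2r _ 2) ?nnegrE ?nc_ge0 // nc_sqr real_normK ?num_real //.
by rewrite lerDl sqr_ge0.
Qed.

Lemma Im_le_nc x : `|complex.Im x| <= nc x.
Proof.
rewrite -(@ler_pXn2r _ 2) ?nnegrE ?nc_ge0 // nc_sqr real_normK ?num_real //.
by rewrite lerDr sqr_ge0.
Qed.

Lemma nc_le_ReIm x : nc x <= `|complex.Re x| + `|complex.Im x|.
Proof.
rewrite -(@ler_pXn2r _ 2) ?nnegrE ?nc_ge0 ?addr_ge0 // nc_sqr.
rewrite sqrrD !real_normK ?num_real // -addrA lerD2l lerDr.
by rewrite mulrn_wge0 // mulr_ge0.
Qed.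

Lemma ReM x y :
  complex.Re (x * y) = complex.Re x * complex.Re y - complex.Im x * complex.Im y.
Proof. by case: x; case: y. Qed.

Lemma ReD x y : complex.Re (x + y) = complex.Re x + complex.Re y.
Proof. by case: x; case: y. Qed.

Lemma ReN x : complex.Re (- x) = - complex.Re x.
Proof. by case: x. Qed.

Lemma ImM x y :
  complex.Im (x * y) = complex.Re x * complex.Im y + complex.Im x * complex.Re y.
Proof. by case: x; case: y. Qed.

Lemma ImD x y : complex.Im (x + y) = complex.Im x + complex.Im y.
Proof. by case: x; case: y. Qed.

Lemma ImN x : complex.Im (- x) = - complex.Im x.
Proof. by case: x. Qed.

Lemma eq_of_nc_small x y : (forall e : R, 0 < e -> nc (x - y) <= e) -> x = y.
Proof.
move=> small; apply/eqP; rewrite -subr_eq0 -nc_eq0 eq_le nc_ge0 andbT.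
by apply/ler_addgt0Pl => e e0; rewrite addr0 small.
Qed.

End ComplexModulus.

Section ComplexTopology.
Variable R : realType.
Local Notation C := (R[i]).
Implicit Types (c z w : C) (r e : R) (U V K A : set C).

Definition disc c r : set C := [set z | nc (z - c) < r].

Definition closed_disc c r : set C := [set z | nc (z - c) <= r].

Definition copen U := forall z, U z -> exists2 r : R, 0 < r & disc z r `<=` U.

Lemma gt0_complex_real (e : C) : 0 < e -> exists2 r : R, 0 < r & e = r%:C%C.
Proof. by case: e => r s; rewrite ltcE /= => /andP[/eqP -> r0]; exists r. Qed.

Lemma real_complex_lt r r' : r < r' -> (r%:C%C : C) < r'%:C%C.
Proof. by rewrite ltcR. Qed.

Lemma ball_disc c r : ball (c : C^o) r%:C%C = disc c r.
Proof.
by apply/seteqP; split=> z; rewrite /ball /disc /= -(@ltcR R) nc_distC.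
Qed.

Lemma nbhs_disc c A : nbhs (c : C^o) A <-> exists2 r : R, 0 < r & disc c r `<=` A.
Proof.
rewrite -nbhs_ballE; split=> [[e /gt0_complex_real[r r0 ->]]|[r r0]]; rewrite -?ball_disc.
  by rewrite ball_disc; exists r.
by exists r%:C%C; first exact: (@real_complex_lt 0).
Qed.

Lemma copenE U : copen U <-> open (U : set C^o).
Proof. by rewrite openE; split=> oU z Uz; apply/nbhs_disc; exact: oU. Qed.

Lemma copenI U V : copen U -> copen V -> copen (U `&` V).
Proof. by move=> /copenE oU /copenE oV; apply/copenE; exact: openI. Qed.

Lemma disc_open c r : copen (disc c r).
Proof.
move=> z; rewrite /disc /= => zr; exists (r - nc (z - c)); first lra.
by move=> w; rewrite /disc /=; have := nc_triangle w z c; lra.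
Qed.

Lemma disc_center c r : 0 < r -> disc c r c.
Proof. by rewrite /disc /= subrr nc0. Qed.

Lemma disc_mono c r r' : r <= r' -> disc c r `<=` disc c r'.
Proof. by move=> rr z /lt_le_trans; exact. Qed.

Lemma disc0E r z : disc 0 r z = (nc z < r) :> Prop.
Proof. by rewrite /disc /= subr0. Qed.

Definition rcontinuous (v : C -> R) z := forall e, 0 < e ->
  exists2 d : R, 0 < d & forall w, disc z d w -> `|v w - v z| < e.

Definition ccontinuous (f : C -> C) z := forall e, 0 < e ->
  exists2 d : R, 0 < d & forall w, disc z d w -> nc (f w - f z) < e.

Lemma rcontinuousE (v : C -> R) z :
  rcontinuous v z <-> {for (z : C^o), continuous (v : C^o -> R^o)}.
Proof.
rewrite /prop_for /continuous_at (cvgrPdist_lt (FF := nbhs_filter (z : C^o))).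
split=> vz e /vz.
  by move=> [d d0 vd]; apply/nbhs_disc; exists d => // w /vd /=; rewrite distrC.
by move=> /nbhs_disc[d d0 vd]; exists d => // w /vd /=; rewrite distrC.
Qed.

Lemma ccontinuousE (f : C -> C) z :
  ccontinuous f z <-> {for (z : C^o), continuous (f : C^o -> C^o)}.
Proof.
rewrite /prop_for /continuous_at (cvgrPdist_lt (FF := nbhs_filter (z : C^o))).
split=> fz e.
  move=> /gt0_complex_real[r /fz[d d0 fd] ->]; apply/nbhs_disc; exists d => // w /fd.
  by rewrite nc_distC; exact: real_complex_lt.
move=> /(@real_complex_lt 0)/fz/nbhs_disc[d d0 fd]; exists d => // w /fd.
by rewrite nc_distC -(@ltcR R).
Qed.

Lemma rcontinuousN (v : C -> R) z : rcontinuous v z -> rcontinuous (fun w => - v w) z.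
Proof. by move=> /rcontinuousE cv; apply/rcontinuousE; exact: (@continuousN R R^o C^o v z cv). Qed.

Lemma rcontinuousD (u v : C -> R) z :
  rcontinuous u z -> rcontinuous v z -> rcontinuous (fun w => u w + v w) z.
Proof.
move=> /rcontinuousE cu /rcontinuousE cv; apply/rcontinuousE.
exact: (@continuousD R R^o C^o u v z cu cv).
Qed.

Lemma rcontinuousM (u v : C -> R) z :
  rcontinuous u z -> rcontinuous v z -> rcontinuous (fun w => u w * v w) z.
Proof.
move=> /rcontinuousE cu /rcontinuousE cv; apply/rcontinuousE.
exact: (@continuousM R C^o u v z cu cv).
Qed.

Lemma rcontinuous_cst (a : R) z : rcontinuous (fun=> a) z.
Proof. by move=> e e0; exists 1 => // w _; rewrite subrr normr0. Qed.

Lemma rcontinuous_nc (f : C -> C) z : ccontinuous f z -> rcontinuous (fun w => nc (f w)) z.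
Proof.
move=> fz e /fz[d d0 fd]; exists d => // w /fd.
by apply: le_lt_trans; exact: nc_distB.
Qed.

Lemma ccontinuous_cst c z : ccontinuous (fun=> c) z.
Proof. by move=> e e0; exists 1 => // w _; rewrite subrr nc0. Qed.

Lemma ccontinuous_id z : ccontinuous id z.
Proof. by move=> e e0; exists e. Qed.

Lemma ccontinuousB (f g : C -> C) z :
  ccontinuous f z -> ccontinuous g z -> ccontinuous (fun w => f w - g w) z.
Proof.
move=> /ccontinuousE cf /ccontinuousE cg; apply/ccontinuousE.
exact: (@continuousB C C^o C^o f g z cf cg).
Qed.

Lemma ccontinuousV (f : C -> C) z :
  f z != 0 -> ccontinuous f z -> ccontinuous (fun w => (f w)^-1) z.
Proof.
by move=> f0 /ccontinuousE cf; apply/ccontinuousE; exact: (@continuousV C C^o f z f0 cf).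
Qed.

Lemma closed_disc_closed c r : closed (closed_disc c r : set C^o).
Proof.
rewrite -openC openE => z /negP; rewrite -ltNge => rz; apply/nbhs_disc.
exists (nc (z - c) - r) => [|w wz]; first lra.
apply/negP; rewrite -ltNge; rewrite /disc /= in wz.
by have := nc_triangle z w c; rewrite (nc_distC z w); lra.
Qed.

Lemma closed_disc_compact c r : compact (closed_disc c r : set C^o).
Proof.
pose box : set (R^o * R^o) := `[complex.Re c - r, complex.Re c + r] `*`
            `[complex.Im c - r, complex.Im c + r].
pose toC (p : R^o * R^o) : C^o := Complex p.1 p.2.
have toC_continuous : continuous toC.
  move=> p; apply/(cvgrPdist_lt (FF := nbhs_filter p)) => _ /gt0_complex_real[e e0 ->].
  have e2 : 0 < e / 2 by lra.
  have /cvgrPdist_lt/(_ _ e2) p1 : (fst : R^o * R^o -> R^o) q @[q --> p] --> p.1 by exact: cvg_fst.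
  have /cvgrPdist_lt/(_ _ e2) p2 : (snd : R^o * R^o -> R^o) q @[q --> p] --> p.2 by exact: cvg_snd.
  apply: filterS2 p1 p2 => q q1 q2.
  suff : nc (Complex p.1 p.2 - Complex q.1 q.2) < e by exact: real_complex_lt.
  by apply: le_lt_trans (nc_le_ReIm _) _; rewrite ReD ReN ImD ImN /=; lra.
apply: (@subclosed_compact _ _ (toC @` box)); first exact: closed_disc_closed.
  apply: continuous_compact; first exact: continuous_subspaceT.
  by apply: compact_setX; exact: segment_compact.
move=> z zc; exists (complex.Re z, complex.Im z); last by case: (z).
have := le_trans (Re_le_nc _) zc; have := le_trans (Im_le_nc _) zc.
rewrite ReD ImD ReN ImN !ler_norml => /andP[i1 i2] /andP[r1 r2].
by split; rewrite /= in_itv /=; apply/andP; split; lra.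
Qed.

Lemma compact_max K (v : C -> R) : K !=set0 -> compact (K : set C^o) ->
  (forall z, K z -> rcontinuous v z) -> exists2 z, K z & forall w, K w -> v w <= v z.
Proof.
move=> K0 cK vc; have [|z zK zmax] := @compact_EVT_max C^o R v K K0 cK.
  by apply: continuous_in_subspaceT => z; rewrite inE => /vc/rcontinuousE.
by exists z => [|w Kw]; [rewrite inE in zK|apply: zmax; rewrite inE].
Qed.

Lemma compact_min K (v : C -> R) : K !=set0 -> compact (K : set C^o) ->
  (forall z, K z -> rcontinuous v z) -> exists2 z, K z & forall w, K w -> v z <= v w.
Proof.
move=> K0 cK vc; have [|z Kz zmax] := @compact_max K (fun z => - v z) K0 cK.
  by move=> z /vc; exact: rcontinuousN.
by exists z => // w /zmax; rewrite lerN2.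
Qed.

End ComplexTopology.

(* Locked so that unification never compares the underlying limits. *)
HB.lock Definition cderive (R : realType) (f : R[i] -> R[i]) (z : R[i]) : R[i] := d1 f z.

HB.lock Definition is_cderive (R : realType) (f : R[i] -> R[i]) (z l : R[i]) : Prop :=
  forall e : R, 0 < e -> exists2 d : R, 0 < d &
    forall w, disc z d w -> nc (f w - f z - l * (w - z)) <= e * nc (w - z).

Section ComplexDerivative.
Variable R : realType.
Local Notation C := (R[i]).
Implicit Types (f g : C -> C) (c z w l m : C).

Lemma is_cderiveP f z l : is_cderive f z l <-> forall e : R, 0 < e ->
  exists2 d : R, 0 < d & forall w, disc z d w ->
    nc (f w - f z - l * (w - z)) <= e * nc (w - z).
Proof. by rewrite is_cderive.unlock. Qed.

Lemma is_cderiveE f z l : is_cderive f z l <-> is_derive (z : C^o) (1 : C^o) (f : C^o -> C^o) l.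
Proof.
pose q h := h^-1 * (f (h + z) - f z).
have quotient w : w != z ->
    nc (f w - f z - l * (w - z)) = nc (q (w - z) - l) * nc (w - z).
  by move=> wz; rewrite -ncM /q subrK; congr nc; field; rewrite subr_eq0.
split=> [/is_cderiveP small|df]; last first.
  apply/is_cderiveP => e e0.
  have [/cvgrPdist_lt/(_ _ (real_complex_lt e0)) /nbhs_disc[d d0 near_q] dE] := df.
  exists d => // w wd; have [->|wz] := eqVneq w z; first by rewrite !subrr mulr0 subr0 nc0 mulr0.
  rewrite quotient // ler_wpM2r ?nc_ge0 // ltW //; have := near_q (w - z).
  rewrite disc0E => /(_ wd); rewrite subr_eq0 => /(_ wz).
  rewrite -[(w - z) *: 1]/((w - z) * 1) mulr1.
  by rewrite -dE nc_distC -(@ltcR R).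
have lim_q : (h^-1 *: ((f \o shift z) (h *: (1 : C^o)) - f z : C^o))
    @[h --> (0 : (C : numFieldType))^'] --> (l : C^o).
  apply/cvgrPdist_lt => _ /gt0_complex_real[e e0 ->].
  have [d d0 small_d] := small (e / 2) ltac:(lra).
  apply/nbhs_disc; exists d => // h; rewrite disc0E => hd h0.
  rewrite -[h *: 1]/(h * 1) mulr1; apply: real_complex_lt.
  have hz : h + z != z by rewrite -subr_eq0 addrK.
  have := small_d (h + z); rewrite quotient // /disc /= addrK => /(_ hd).
  by rewrite ler_pM2r ?nc_gt0 // [X in X <= _]nc_distC -/(q h) => /le_lt_trans; apply; lra.
by apply: DeriveDef; [apply/cvg_ex; exists l|exact: (cvg_lim (@norm_hausdorff _ _) lim_q)].
Qed.

Lemma d1_cderive f : d1 f = cderive f.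
Proof. by rewrite cderive.unlock. Qed.

Lemma derivable_cderive f z :
  derivable (f : C^o -> C^o) (z : C^o) 1 <-> is_cderive f z (cderive f z).
Proof.
rewrite -d1_cderive; split=> [Df|/is_cderiveE[] //].
by apply/is_cderiveE; exact: DeriveDef.
Qed.

Lemma cderiveE f z l : is_cderive f z l -> cderive f z = l.
Proof. by rewrite -d1_cderive => /is_cderiveE[_]. Qed.

Lemma is_cderive_uniq f z l m : is_cderive f z l -> is_cderive f z m -> l = m.
Proof. by move=> /cderiveE <- /cderiveE. Qed.

Lemma is_cderive_eq f z l m : is_cderive f z l -> l = m -> is_cderive f z m.
Proof. by move=> df <-. Qed.

Lemma is_cderive_cst c z : is_cderive (fun=> c) z 0.
Proof. by apply/is_cderiveE; exact: is_derive_cst. Qed.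

Lemma is_cderive_id z : is_cderive id z 1.
Proof. by apply/is_cderiveE; exact: is_derive_id. Qed.

Lemma is_cderiveD f g z l m :
  is_cderive f z l -> is_cderive g z m -> is_cderive (fun w => f w + g w) z (l + m).
Proof.
by move=> /is_cderiveE df /is_cderiveE dg; apply/is_cderiveE; exact: (is_deriveD df dg).
Qed.

Lemma is_cderiveB f g z l m :
  is_cderive f z l -> is_cderive g z m -> is_cderive (fun w => f w - g w) z (l - m).
Proof.
by move=> /is_cderiveE df /is_cderiveE dg; apply/is_cderiveE; exact: (is_deriveB df dg).
Qed.

Lemma is_cderiveBc f c z l : is_cderive f z l -> is_cderive (fun w => f w - c) z l.
Proof. by move=> df; have := is_cderiveB df (is_cderive_cst c z); rewrite subr0. Qed.

Lemma is_cderiveM f g z l m : is_cderive f z l -> is_cderive g z m ->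
  is_cderive (fun w => f w * g w) z (l * g z + f z * m).
Proof.
move=> /is_cderiveE df /is_cderiveE dg; apply/is_cderiveE.
by rewrite addrC [l * _]mulrC; exact: (@is_deriveM C C^o f g z 1 l m df dg).
Qed.

Lemma is_cderiveZ c f z l : is_cderive f z l -> is_cderive (fun w => c * f w) z (c * l).
Proof.
by move=> /is_cderiveE df; apply/is_cderiveE; exact: (@is_deriveZ C C^o C^o f c z 1 l df).
Qed.

Lemma is_cderive_mulc c z : is_cderive (fun w => c * w) z c.
Proof. by have := is_cderiveZ c (is_cderive_id z); rewrite mulr1. Qed.

Lemma is_cderiveX f n z l : is_cderive f z l ->
  is_cderive (fun w => f w ^+ n) z (n%:R * f z ^+ n.-1 * l).
Proof.
move=> /is_cderiveE df; apply/is_cderiveE.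
by have := @is_deriveX C C^o f n z 1 l df; rewrite exprfctE.
Qed.

Lemma is_cderiveV f z l : f z != 0 -> is_cderive f z l ->
  is_cderive (fun w => (f w)^-1) z (- (f z) ^- 2 * l).
Proof.
move=> f0 /is_cderiveE[Df <-]; apply/is_cderiveE; apply: DeriveDef.
  exact: (@derivableV C C^o f z 1 f0 Df).
exact: (@deriveV C C^o f z 1 f0 Df).
Qed.

Lemma is_cderive_sum n (h : 'I_n -> C -> C) z (l : 'I_n -> C) :
  (forall i, is_cderive (h i) z (l i)) ->
  is_cderive (fun w => \sum_(i < n) h i w) z (\sum_(i < n) l i).
Proof.
move=> dh; apply/is_cderiveE.
have := @is_derive_sum C C^o C^o n h z 1 l (fun i => (is_cderiveE _ _ _).1 (dh i)).
by congr is_derive; apply/funext => w; rewrite fct_sumE.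
Qed.

Lemma is_cderive_near f g z l (d : R) : 0 < d -> (forall w, disc z d w -> f w = g w) ->
  is_cderive f z l -> is_cderive g z l.
Proof.
move=> d0 fg /is_cderiveE df; apply/is_cderiveE.
by apply: near_eq_is_derive df; apply/nbhs_disc; exists d.
Qed.

Lemma is_cderive_continuous f z l : is_cderive f z l -> ccontinuous f z.
Proof.
by move=> /is_cderiveE[/derivable1_diffP/differentiable_continuous cf _]; apply/ccontinuousE.
Qed.

Lemma increment_near f z l (M e : R) : nc l <= M -> 0 < e -> is_cderive f z l ->
  exists2 d : R, 0 < d & forall w, disc z d w -> nc (f w - f z) <= (M + e) * nc (w - z).
Proof.
move=> lM e0 /is_cderiveP/(_ _ e0)[d d0 small]; exists d => // w /small.
have := ncD (f w - f z - l * (w - z)) (l * (w - z)); rewrite subrK ncM mulrDl.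
by have := ler_wpM2r (nc_ge0 (w - z)) lM; lra.
Qed.

Lemma is_cderive_comp f g z l m : is_cderive f z l -> is_cderive g (f z) m ->
  is_cderive (fun w => g (f w)) z (m * l).
Proof.
move=> df dg; apply/is_cderiveP => e e0.
have l1 : 0 < nc l + 1 by have := nc_ge0 l; lra.
have m1 : 0 < nc m + 1 by have := nc_ge0 m; lra.
have [r r0 small_g] := (is_cderiveP _ _ _).1 dg (e / 2 / (nc l + 1)) ltac:(by rewrite !divr_gt0).
have [s s0 small_f] := (is_cderiveP _ _ _).1 df (e / 2 / (nc m + 1)) ltac:(by rewrite !divr_gt0).
have [t t0 inc_f] := increment_near (lexx (nc l)) ltr01 df.
have [d d0 fr] := is_cderive_continuous df r0.
exists (Num.min d (Num.min s t)) => [|w]; first by rewrite !lt_min d0 s0.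
rewrite /disc /= !lt_min => /and3P[/fr/small_g gw /small_f fw /inc_f iw].
have -> : g (f w) - g (f z) - m * l * (w - z) =
  (g (f w) - g (f z) - m * (f w - f z)) + m * (f w - f z - l * (w - z)) by ring.
apply: le_trans (ncD _ _) _; rewrite ncM.
have hg : e / 2 / (nc l + 1) * nc (f w - f z) <= e / 2 * nc (w - z).
  rewrite -mulrA ler_pM2l ?divr_gt0 // mulrC ler_pdivrMr // mulrC; exact: iw.
have hf : nc m * nc (f w - f z - l * (w - z)) <= e / 2 * nc (w - z).
  apply: (@le_trans _ _ ((nc m + 1) * (e / 2 / (nc m + 1) * nc (w - z)))).
    by apply: ler_pM; rewrite ?nc_ge0 // lerDl.
  by rewrite mulrA [_ * (e / 2 / _)]mulrC divfK ?gt_eqF.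
lra.
Qed.

End ComplexDerivative.

(** * Holomorphic functions *)

Section MeanValue.
Variable R : realType.
Local Notation C := (R[i]).
Implicit Types (f : C -> C) (x y z w c : C) (t r M : R) (U V : set C).

Lemma cousin (P : R -> R -> Prop) (a b : R) : a <= b ->
  (forall s m t : R, s <= m -> m <= t -> P s m -> P m t -> P s t) ->
  (forall u, a <= u -> u <= b -> exists2 d, 0 < d & forall s t,
     u - d < s -> s <= u -> u <= t -> t < u + d -> a <= s -> t <= b -> P s t) ->
  P a b.
Proof.
move=> ab Padd Ploc.
pose A := [set t | [/\ a <= t, t <= b & P a t]].
have Aa : A a.
  by split=> //; have [d d0 h] := Ploc a (lexx _) ab; apply: h => //; lra.
have supA : has_sup A by split; [exists a|exists b => t []].
have ubA t : A t -> t <= sup A by move=> At; apply: (ub_le_sup _ At); exact: supA.2.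
have a_sup : a <= sup A by exact: ubA.
have sup_b : sup A <= b by apply: ge_sup; [exists a|move=> t []].
have [d d0 Pnear] := Ploc _ a_sup sup_b.
have [t [at_ tb Pat] sup_t] := sup_adherent d0 supA.
have t_sup : t <= sup A by apply: ubA.
pose t' := Num.min b (sup A + d / 2).
have sup_t' : sup A <= t' by rewrite le_min sup_b /=; lra.
have t'_lt : t' < sup A + d by rewrite gt_min; apply/orP; right; lra.
have Pt' : P a t'.
  apply: (Padd _ t) => //; first exact: (le_trans t_sup).
  by apply: Pnear => //; rewrite ge_min lexx.
have : A t' by split=> //; [exact: (le_trans a_sup)|rewrite ge_min lexx].
move/ubA => t'_sup.
suff -> : b = t' by [].
rewrite /t' in t'_sup *; case: (leP b (sup A + d / 2)) t'_sup => //; lra.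
Qed.

Definition seg x y t : C := x + t%:C%C * (y - x).

Lemma seg0 x y : seg x y 0 = x.
Proof. by rewrite /seg mul0r addr0. Qed.

Lemma seg1 x y : seg x y 1 = y.
Proof. by rewrite /seg mul1r addrC subrK. Qed.

Lemma nc_segB x y s t : nc (seg x y t - seg x y s) = `|t - s| * nc (y - x).
Proof.
have -> : seg x y t - seg x y s = (t - s)%:C%C * (y - x).
  by rewrite /seg rmorphB /=; ring.
by rewrite ncM nc_real.
Qed.

Lemma nc_seg_le x y t r : 0 <= t -> t <= 1 -> nc x <= r -> nc y <= r -> nc (seg x y t) <= r.
Proof.
move=> t0 t1 xr yr.
have -> : seg x y t = (1 - t)%:C%C * x + t%:C%C * y by rewrite /seg rmorphB /= ; ring.
apply: (le_trans (ncD _ _)); rewrite !ncM !nc_real !ger0_norm //; last lra.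
have : (1 - t) * nc x <= (1 - t) * r by apply: ler_wpM2l => //; lra.
have : t * nc y <= t * r by apply: ler_wpM2l.
lra.
Qed.

Lemma segBc x y t c : seg x y t - c = seg (x - c) (y - c) t.
Proof. by rewrite /seg; ring. Qed.

Definition is_convex U := forall x y t, U x -> U y -> 0 <= t -> t <= 1 -> U (seg x y t).

Lemma closed_disc_convex c r : is_convex (closed_disc c r).
Proof. by move=> x y t xr yr t0 t1; rewrite /closed_disc /= segBc; exact: nc_seg_le. Qed.

Lemma disc_convex c r : is_convex (disc c r).
Proof.
move=> x y t xr yr t0 t1.
apply: (@le_lt_trans _ _ (Num.max (nc (x - c)) (nc (y - c)))); last by rewrite gt_max xr yr.
by rewrite segBc; apply: nc_seg_le => //; rewrite le_max lexx ?orbT.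
Qed.

Lemma convexI U V : is_convex U -> is_convex V -> is_convex (U `&` V).
Proof. by move=> cU cV x y t [Ux Vx] [Uy Vy] t0 t1; split; [exact: cU|exact: cV]. Qed.

Lemma seg_ball x y (u d : R) : 0 < d -> exists2 d' : R, 0 < d' &
  forall t, `|t - u| < d' -> disc (seg x y u) d (seg x y t).
Proof.
move=> d0; have L0 := nc_ge0 (y - x); have L1 : 0 < nc (y - x) + 1 by lra.
exists (d / (nc (y - x) + 1)); first by rewrite divr_gt0.
move=> t; rewrite ltr_pdivlMr // /disc /= nc_segB; apply: le_lt_trans.
by apply: ler_wpM2l => //; lra.
Qed.

(* Any clopen condition on the points of a convex set has this form. *)
Lemma convex_propagation U (A : set C) : is_convex U ->
  (forall z, U z -> exists2 d : R, 0 < d &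
     forall x y, U x -> U y -> disc z d x -> disc z d y -> A x -> A y) ->
  forall x y, U x -> U y -> A x -> A y.
Proof.
move=> cU Aloc x y Ux Uy.
rewrite -{1}(seg0 x y) -{2}(seg1 x y).
apply: (@cousin (fun s t => A (seg x y s) -> A (seg x y t))) => //.
  by move=> s c t _ _ Asc Act /Asc/Act.
move=> u u0 u1; have [d d0 Au] := Aloc _ (cU x y u Ux Uy u0 u1).
have [d' d'0 near_u] := seg_ball x y u d0; exists d' => // s t us su ut tu s0 t1.
apply: Au; try (by apply: cU => //; lra); apply: near_u; rewrite ltr_norml; lra.
Qed.

Lemma mean_value U f (f' : C -> C) M x y : is_convex U ->
  (forall w, U w -> is_cderive f w (f' w)) -> (forall w, U w -> nc (f' w) <= M) ->
  U x -> U y -> nc (f y - f x) <= M * nc (y - x).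
Proof.
move=> cU df bf Ux Uy; apply/ler_addgt0Pl => e0 e00.
set L := nc (y - x); have L0 : 0 <= L by exact: nc_ge0.
pose e := e0 / (L + 1); have e_gt0 : 0 < e by rewrite divr_gt0 //; lra.
suff : nc (f (seg x y 1) - f (seg x y 0)) <= (M + e) * L * (1 - 0).
  rewrite seg0 seg1 => fxy; apply: (le_trans fxy).
  rewrite subr0 mulr1 mulrDl addrC lerD2r /e mulrAC ler_pdivrMr; last lra.
  by rewrite ler_pM2l //; lra.
apply: (@cousin (fun s t => nc (f (seg x y t) - f (seg x y s)) <= (M + e) * L * (t - s))) => //.
  move=> s c t sc ct.
  have := nc_triangle (f (seg x y t)) (f (seg x y c)) (f (seg x y s)); lra.
move=> u u0 u1; have Uu := cU x y u Ux Uy u0 u1.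
have [d d0 inc] := increment_near (bf _ Uu) e_gt0 (df _ Uu).
have [d' d'0 near_u] := seg_ball x y u d0; exists d' => // s t us su ut tu _ _.
have inc_t := inc _ (near_u t ltac:(by rewrite ltr_norml; lra)).
have inc_s := inc _ (near_u s ltac:(by rewrite ltr_norml; lra)).
rewrite nc_segB -/L ger0_norm ?subr_ge0 // in inc_t.
rewrite nc_segB -/L ler0_norm ?subr_le0 // nc_distC in inc_s.
by have := nc_triangle (f (seg x y t)) (f (seg x y u)) (f (seg x y s)); lra.
Qed.

Lemma almost_linear U f (f' : C -> C) (a : C) (K : R) x y : is_convex U ->
  (forall w, U w -> is_cderive f w (f' w)) -> (forall w, U w -> nc (f' w - a) <= K) ->
  U x -> U y -> nc (f y - f x - a * (y - x)) <= K * nc (y - x).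
Proof.
move=> cU df bf Ux Uy.
have -> : f y - f x - a * (y - x) = (f y - a * y) - (f x - a * x) by ring.
apply: (@mean_value U (fun w => f w - a * w) (fun w => f' w - a)) => // w Uw.
by apply: is_cderiveB; [exact: df|exact: is_cderive_mulc].
Qed.

End MeanValue.

Section Holomorphic.
Variable R : realType.
Local Notation C := (R[i]).
Implicit Types (f g : C -> C) (x y z w c : C) (U V : set C).

(* Asking for complex derivatives of every order from the start makes Cauchy's integral
   formula unnecessary. *)
Fixpoint cderivable_n n U f : Prop :=
  if n is m.+1 then (forall z, U z -> is_cderive f z (cderive f z)) /\ cderivable_n m U (cderive f)
  else True.

Definition holomorphic U f := forall n, cderivable_n n U f.

Lemma cderiveP f z l : is_cderive f z l -> is_cderive f z (cderive f z).
Proof. by move=> df; rewrite (cderiveE df). Qed.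

Lemma cderivable_n_eq n U f g : copen U -> (forall z, U z -> f z = g z) ->
  cderivable_n n U f -> cderivable_n n U g.
Proof.
move=> oU; elim: n f g => // n IH f g fg [df Hf].
have dg z : U z -> is_cderive g z (cderive f z).
  move=> Uz; have [r r0 rU] := oU _ Uz.
  by apply: (is_cderive_near r0 _ (df z Uz)) => w /rU /fg.
by split=> [z /dg/cderiveP //|]; apply: IH Hf => z /dg/cderiveE.
Qed.

Lemma cderivable_nS n U f : cderivable_n n.+1 U f -> cderivable_n n U f.
Proof. by elim: n f => // n IH f [df /IH ?]. Qed.

Lemma cderivable_n_intro n U f f' : copen U -> (forall z, U z -> is_cderive f z (f' z)) ->
  cderivable_n n U f' -> cderivable_n n.+1 U f.
Proof.
move=> oU df Hf'; split; first by move=> z /df /cderiveP.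
by apply: cderivable_n_eq Hf' => // z /df /cderiveE ->.
Qed.

Lemma cderivable_n_cst n U c : copen U -> cderivable_n n U (fun=> c).
Proof.
move=> oU; elim: n c => // n IH c.
by apply: (@cderivable_n_intro _ _ _ (fun=> 0)) => // z _; exact: is_cderive_cst.
Qed.

Lemma cderivable_n_id n U : copen U -> cderivable_n n U id.
Proof.
case: n => // n oU; apply: (@cderivable_n_intro _ _ _ (fun=> 1)) => //.
  by move=> z _; exact: is_cderive_id.
exact: cderivable_n_cst.
Qed.

Lemma cderivable_nD n U f g : copen U -> cderivable_n n U f -> cderivable_n n U g ->
  cderivable_n n U (fun z => f z + g z).
Proof.
move=> oU; elim: n f g => // n IH f g [df Hf] [dg Hg].
apply: (@cderivable_n_intro _ _ _ (fun z => cderive f z + cderive g z)) => //; last exact: IH.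
by move=> z Uz; apply: is_cderiveD; [exact: df|exact: dg].
Qed.

Lemma cderivable_nM n U f g : copen U -> cderivable_n n U f -> cderivable_n n U g ->
  cderivable_n n U (fun z => f z * g z).
Proof.
move=> oU; elim: n f g => // n IH f g Hf Hg.
apply: (@cderivable_n_intro _ _ _ (fun z => cderive f z * g z + f z * cderive g z)) => //.
  by move=> z Uz; apply: is_cderiveM; [exact: Hf.1|exact: Hg.1].
apply: cderivable_nD => //; apply: IH; try exact: cderivable_nS.
  exact: Hf.2.
exact: Hg.2.
Qed.

Lemma cderivable_nV n U f : copen U -> (forall z, U z -> f z != 0) -> cderivable_n n U f ->
  cderivable_n n U (fun z => (f z)^-1).
Proof.
move=> oU f0; elim: n => // n IH Hf; have Hi := IH (cderivable_nS Hf).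
apply: (@cderivable_n_intro _ _ _ (fun z => (-1) * ((f z)^-1 * (f z)^-1) * cderive f z)) => //.
  move=> z Uz; have := is_cderiveV (f0 z Uz) (Hf.1 z Uz).
  by rewrite -exprVn expr2 mulN1r.
apply: cderivable_nM => //; last exact: Hf.2.
by apply: cderivable_nM => //; [exact: cderivable_n_cst|exact: cderivable_nM].
Qed.

Lemma cderivable_n_comp n U V f g : copen U -> copen V -> (forall z, U z -> V (f z)) ->
  cderivable_n n U f -> cderivable_n n V g -> cderivable_n n U (fun z => g (f z)).
Proof.
move=> oU oV UV; elim: n f g UV => // n IH f g UV Hf Hg.
apply: (@cderivable_n_intro _ _ _ (fun z => cderive g (f z) * cderive f z)) => //.
  by move=> z Uz; apply: is_cderive_comp; [exact: Hf.1|apply: Hg.1; exact: UV].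
by apply: cderivable_nM => //; [apply: IH => //; [exact: cderivable_nS|exact: Hg.2]|exact: Hf.2].
Qed.

Lemma holomorphic_eq U f g : copen U -> (forall z, U z -> f z = g z) ->
  holomorphic U f -> holomorphic U g.
Proof. by move=> oU fg Hf n; exact: (cderivable_n_eq oU fg). Qed.

Lemma holomorphic_local U f : (forall z, U z -> exists V, V z /\ holomorphic V f) ->
  holomorphic U f.
Proof.
suff loc n g : (forall z, U z -> exists V, V z /\ cderivable_n n V g) -> cderivable_n n U g.
  by move=> Hf n; apply: loc => z /Hf[V [Vz HV]]; exists V.
elim: n g => // n IH g H; split; first by move=> z /H[V [Vz [/(_ z Vz)]]].
by apply: IH => z /H[V [Vz [_ ?]]]; exists V.
Qed.

Lemma holomorphic_sub U V f : V `<=` U -> holomorphic U f -> holomorphic V f.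
Proof. by move=> VU Hf; apply: holomorphic_local => z /VU Uz; exists U. Qed.

Lemma holomorphic_is_cderive U f z : holomorphic U f -> U z -> is_cderive f z (cderive f z).
Proof. by move=> /(_ 1%N)[df _] /df. Qed.

Lemma holomorphic_cderive U f : holomorphic U f -> holomorphic U (cderive f).
Proof. by move=> Hf n; have [] := Hf n.+1. Qed.

Lemma holomorphic_continuous U f z : holomorphic U f -> U z -> ccontinuous f z.
Proof. by move=> Hf Uz; exact: (is_cderive_continuous (holomorphic_is_cderive Hf Uz)). Qed.

Lemma holomorphic_cst U c : copen U -> holomorphic U (fun=> c).
Proof. by move=> oU n; exact: cderivable_n_cst. Qed.

Lemma holomorphic_id U : copen U -> holomorphic U id.
Proof. by move=> oU n; exact: cderivable_n_id. Qed.

Lemma holomorphicD U f g : copen U -> holomorphic U f -> holomorphic U g ->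
  holomorphic U (fun z => f z + g z).
Proof. by move=> oU Hf Hg n; exact: cderivable_nD. Qed.

Lemma holomorphicM U f g : copen U -> holomorphic U f -> holomorphic U g ->
  holomorphic U (fun z => f z * g z).
Proof. by move=> oU Hf Hg n; exact: cderivable_nM. Qed.

Lemma holomorphicZ U c f : copen U -> holomorphic U f -> holomorphic U (fun z => c * f z).
Proof. by move=> oU Hf; apply: holomorphicM => //; exact: holomorphic_cst. Qed.

Lemma holomorphicN U f : copen U -> holomorphic U f -> holomorphic U (fun z => - f z).
Proof.
by move=> oU Hf; apply: (@holomorphic_eq _ (fun z => (-1) * f z)) => // [z _|];
  [rewrite mulN1r|exact: holomorphicZ].
Qed.

Lemma holomorphicB U f g : copen U -> holomorphic U f -> holomorphic U g ->
  holomorphic U (fun z => f z - g z).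
Proof. by move=> oU Hf Hg; apply: holomorphicD => //; exact: holomorphicN. Qed.

Lemma holomorphicBc U f c : copen U -> holomorphic U f -> holomorphic U (fun z => f z - c).
Proof. by move=> oU Hf; apply: holomorphicB => //; exact: holomorphic_cst. Qed.

Lemma holomorphicX U f m : copen U -> holomorphic U f -> holomorphic U (fun z => f z ^+ m).
Proof.
move=> oU Hf; elim: m => [|m IH]; first exact: holomorphic_cst.
apply: (@holomorphic_eq _ (fun z => f z * f z ^+ m)) => // [z _|]; first by rewrite exprS.
exact: holomorphicM.
Qed.

Lemma holomorphicV U f : copen U -> (forall z, U z -> f z != 0) -> holomorphic U f ->
  holomorphic U (fun z => (f z)^-1).
Proof. by move=> oU f0 Hf n; exact: cderivable_nV. Qed.

Lemma holomorphic_div U f g : copen U -> (forall z, U z -> g z != 0) -> holomorphic U f ->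
  holomorphic U g -> holomorphic U (fun z => f z / g z).
Proof. by move=> oU g0 Hf Hg; apply: holomorphicM => //; exact: holomorphicV. Qed.

Lemma holomorphic_comp U V f g : copen U -> copen V -> (forall z, U z -> V (f z)) ->
  holomorphic U f -> holomorphic V g -> holomorphic U (fun z => g (f z)).
Proof. by move=> oU oV UV Hf Hg n; exact: (cderivable_n_comp oU oV). Qed.

Lemma holomorphic_affine U a b : copen U -> holomorphic U (fun z => a + b * z).
Proof.
move=> oU; apply: holomorphicD => //; first exact: holomorphic_cst.
by apply: holomorphicZ => //; exact: holomorphic_id.
Qed.

End Holomorphic.

(** * Taylor expansions and the maximum principle *)

Section Taylor.
Variable R : realType.
Local Notation C := (R[i]).
Implicit Types (f : C -> C) (z w : C) (n : nat) (r e d : R).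

Definition taylor_poly n f z w : C :=
  \sum_(k < n) iter k (@cderive R) f z / k`!%:R * (w - z) ^+ k.

Lemma is_cderive_taylor_poly n f z w :
  is_cderive (taylor_poly n.+1 f z) w (taylor_poly n (cderive f) z w).
Proof.
pose a k := iter k (@cderive R) f z / k`!%:R.
apply: (@is_cderive_eq _ _ _ (\sum_(k < n.+1) a k * (k%:R * (w - z) ^+ k.-1 * 1))).
  apply: (@is_cderive_sum _ n.+1 (fun k w => a k * (w - z) ^+ k)) => k.
  by apply: is_cderiveZ; apply: is_cderiveX; apply: is_cderiveBc; exact: is_cderive_id.
rewrite big_ord_recl mul0r mul0r mulr0 add0r; apply: eq_bigr => k _.
have k1 : (k.+1%:R : C) != 0 by rewrite pnatr_eq0.
have kf : (k`!%:R : C) != 0 by rewrite pnatr_eq0 -lt0n fact_gt0.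
rewrite /a lift0 iterSr factS natrM [k.+1.-1]/=.
by move: k.+1%:R k`!%:R (iter k _ _ z) k1 kf => p q l p0 q0; field; rewrite p0 q0.
Qed.

Lemma taylor_poly_center n f z : taylor_poly n.+1 f z z = f z.
Proof.
rewrite /taylor_poly big_ord_recl big1 /= => [|k _].
  by rewrite expr0 mulr1 divr1 addr0.
by rewrite subrr expr0n mulr0.
Qed.

Lemma taylor_young f z r n : 0 < r -> holomorphic (disc z r) f -> forall e, 0 < e ->
  exists2 d, 0 < d & forall w, disc z d w ->
    nc (f w - taylor_poly n.+1 f z w) <= e * nc (w - z) ^+ n.
Proof.
move=> r0; elim: n f => [|n IH] f Hf e e0.
  have [d d0 fd] := holomorphic_continuous Hf (disc_center z r0) e0; exists d => // w /fd/ltW.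
  by rewrite /taylor_poly big_ord1 /= !expr0 divr1 !mulr1.
have [d d0 rem] := IH _ (holomorphic_cderive Hf) e e0.
exists (Num.min d r) => [|w]; first by rewrite lt_min d0.
rewrite /disc /= lt_min => /andP[wd wr].
pose g y := f y - taylor_poly n.+2 f z y.
have -> : f w - taylor_poly n.+2 f z w = g w - g z.
  by rewrite /g taylor_poly_center; ring.
rewrite exprSr mulrA.
apply: (@mean_value _ (closed_disc z (nc (w - z))) g
  (fun y => cderive f y - taylor_poly n.+1 (cderive f) z y)).
- exact: closed_disc_convex.
- move=> y yz; apply: is_cderiveB; last exact: is_cderive_taylor_poly.
  by apply: (holomorphic_is_cderive Hf); exact: (le_lt_trans yz wr).
- move=> y yz; apply: le_trans (rem y (le_lt_trans yz wd)) _.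
  by rewrite ler_pM2l //; apply: lerXn2r; rewrite ?nnegrE ?nc_ge0.
- by rewrite /closed_disc /= subrr nc0 nc_ge0.
- exact: lexx.
Qed.

Lemma taylor_young2 f z r : 0 < r -> holomorphic (disc z r) f -> forall e, 0 < e ->
  exists2 d, 0 < d & forall w, disc z d w ->
    nc (f w - (f z + cderive f z * (w - z) + cderive (cderive f) z / 2 * (w - z) ^+ 2)) <=
    e * nc (w - z) ^+ 2.
Proof.
move=> r0 Hf e e0; have [d d0 rem] := taylor_young 2 r0 Hf e0; exists d => // w /rem.
by rewrite /taylor_poly !big_ord_recr big_ord0 /= add0r !divr1 expr0 expr1 mulr1.
Qed.

Lemma taylor_bound f z r (K : R) w : holomorphic (disc z r) f -> disc z r w ->
  (forall y, disc z r y -> nc (cderive (cderive f) y) <= K) ->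
  nc (f w - f z - cderive f z * (w - z)) <= K * nc (w - z) ^+ 2.
Proof.
move=> Hf wr bK; have r0 : 0 < r by apply: le_lt_trans (nc_ge0 _) wr.
have zr := disc_center z r0.
have sub y : closed_disc z (nc (w - z)) y -> disc z r y by move=> yw; exact: (le_lt_trans yw wr).
have K0 : 0 <= K by apply: le_trans (nc_ge0 _) (bK z zr).
rewrite expr2 mulrA; apply: (@almost_linear _ (closed_disc z (nc (w - z))) f (cderive f)).
- exact: closed_disc_convex.
- by move=> y /sub; exact: holomorphic_is_cderive.
- move=> y yw; apply: (@le_trans _ _ (K * nc (y - z))); last exact: ler_wpM2l.
  apply: (mean_value (@disc_convex R z r) _ bK zr (sub y yw)) => u.
  exact: (holomorphic_is_cderive (holomorphic_cderive Hf)).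
- by rewrite /closed_disc /= subrr nc0 nc_ge0.
- exact: lexx.
Qed.

End Taylor.

Section MaximumPrinciple.
Variable R : realType.
Local Notation C := (R[i]).
Implicit Types (f : C -> C) (z w k : C) (r e d eta M : R) (K : set C).

Definition second_order_at f z := exists b c : C, forall e, 0 < e ->
  exists2 d, 0 < d & forall w, disc z d w ->
    nc (f w - (f z + b * (w - z) + c * (w - z) ^+ 2)) <= e * nc (w - z) ^+ 2.

Lemma holomorphic_second_order K f z :
  copen K -> holomorphic K f -> K z -> second_order_at f z.
Proof.
move=> oK Hf Kz; have [r r0 rK] := oK z Kz.
exists (cderive f z), (cderive (cderive f) z / 2).
exact: taylor_young2 r0 (holomorphic_sub rK Hf).
Qed.

Lemma second_order_is_cderive f z : second_order_at f z -> exists l, is_cderive f z l.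
Proof.
move=> [b [c rem]]; exists b; apply/is_cderiveP => e e0.
have c1 : 0 < nc c + 1 by have := nc_ge0 c; lra.
have [d d0 small] := rem 1 ltr01.
exists (Num.min d (e / (nc c + 1))) => [|w]; first by rewrite lt_min d0 divr_gt0.
rewrite /disc /= lt_min ltr_pdivlMr // => /andP[/small wd we].
have -> : f w - f z - b * (w - z) =
  (f w - (f z + b * (w - z) + c * (w - z) ^+ 2)) + c * (w - z) ^+ 2 by ring.
apply: le_trans (ncD _ _) _; rewrite ncM ncX.
have : (nc (w - z) * (nc c + 1)) * nc (w - z) <= e * nc (w - z).
  by rewrite ler_wpM2r ?nc_ge0 // ltW.
by rewrite expr2 in wd *; lra.
Qed.

Lemma nc_parallelogram z k : nc (z + k) ^+ 2 + nc (z - k) ^+ 2 = 2 * nc z ^+ 2 + 2 * nc k ^+ 2.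
Proof. by rewrite !nc_sqr !ReD !ImD !ReN !ImN; ring. Qed.

Lemma nc_i : nc ('i%C : C) = 1.
Proof. by rewrite /nc /= expr0n expr1n /= add0r sqrtr1. Qed.

(* The first and second order terms cancel in the sum over k, -k, ik, -ik. *)
Lemma second_order_mean f z : second_order_at f z -> forall e, 0 < e ->
  exists2 d, 0 < d & forall k, nc k < d ->
    nc (f (z + k) + f (z - k) + (f (z + 'i%C * k) + f (z - 'i%C * k)) - 4 * f z) <=
    e * nc k ^+ 2.
Proof.
move=> [b [c rem]] e e0; have [d d0 small] := rem (e / 4) ltac:(lra); exists d => // k kd.
pose p y := f (z + y) - (f z + b * y + c * y ^+ 2).
have pk y : nc y = nc k -> nc (p y) <= e / 4 * nc k ^+ 2.
  move=> yk; have := small (z + y); rewrite /disc /= [z + y]addrC addrK yk => /(_ kd).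
  by rewrite [y + z]addrC.
have -> : f (z + k) + f (z - k) + (f (z + 'i%C * k) + f (z - 'i%C * k)) - 4 * f z =
    p k + p (- k) + (p ('i%C * k) + p (- ('i%C * k))).
  by rewrite /p !sqrrN exprMn sqr_i; ring.
have nik : nc ('i%C * k) = nc k by rewrite ncM nc_i mul1r.
have := pk k erefl; have := pk (- k) (ncN k).
have := pk _ nik; have := pk (- ('i%C * k)) (etrans (ncN _) nik).
have := ncD (p k + p (- k)) (p ('i%C * k) + p (- ('i%C * k))).
have := ncD (p k) (p (- k)); have := ncD (p ('i%C * k)) (p (- ('i%C * k))); lra.
Qed.

Lemma no_interior_max f z r eta : 0 < r -> 0 < eta -> second_order_at f z ->
  ~ (forall w, disc z r w -> nc (f w) + eta * nc w ^+ 2 <= nc (f z) + eta * nc z ^+ 2).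
Proof.
move=> r0 eta0 f2 fmax; have [d d0 mean] := second_order_mean f2 eta0.
pose t := Num.min r d / 2.
have [min_r min_d] : Num.min r d <= r /\ Num.min r d <= d by rewrite !ge_min !lexx orbT.
have m0 : 0 < Num.min r d by rewrite lt_min r0.
have t0 : 0 < t by rewrite divr_gt0.
have [tr td] : t < r /\ t < d by rewrite /t; lra.
pose k : C := t%:C%C; have kt : nc k = t by rewrite nc_real gtr0_norm.
have ikt : nc ('i%C * k) = t by rewrite ncM nc_i mul1r.
have maxk y : nc y = t -> nc (f (z + y)) + eta * nc (z + y) ^+ 2 <= nc (f z) + eta * nc z ^+ 2.
  by move=> yt; apply: fmax; rewrite /disc /= [z + y]addrC addrK yt.
have max_k := maxk k kt; have max_kN := maxk (- k) (etrans (ncN k) kt).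
have max_ik := maxk _ ikt; have max_ikN := maxk (- ('i%C * k)) (etrans (ncN _) ikt).
have sum1 := congr1 ( *%R eta) (nc_parallelogram z k).
have sum2 := congr1 ( *%R eta) (nc_parallelogram z ('i%C * k)).
rewrite kt in sum1; rewrite ikt in sum2.
have := mean k; rewrite kt => /(_ td); set s := f (z + k) + f (z - k) + _ => sum_small.
have : 4 * nc (f z) <= nc s + eta * t ^+ 2.
  by have := ncB_ge (4 * f z) s; rewrite nc_distC ncM nc_nat; lra.
have : nc s <= nc (f (z + k)) + nc (f (z - k)) + (nc (f (z + 'i%C * k)) + nc (f (z - 'i%C * k))).
  by apply: le_trans (ncD _ _) (lerD (ncD _ _) (ncD _ _)).
have : 0 < eta * t ^+ 2 by rewrite mulr_gt0 // exprn_gt0.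
lra.
Qed.

Lemma max_principle K f M : compact (K : set C^o) -> (forall z, K z -> ccontinuous f z) ->
  (forall z, K z -> nc (f z) <= M \/
     (exists2 r, 0 < r & disc z r `<=` K) /\ second_order_at f z) ->
  forall z, K z -> nc (f z) <= M.
Proof.
move=> cK cf bd z Kz; have K0 : K !=set0 by exists z.
have cnc w : rcontinuous (@nc R) w by apply: (@rcontinuous_nc _ id); exact: ccontinuous_id.
have [b Kb bmax] := compact_max K0 cK (fun w _ => cnc w).
have perturbed eta : 0 < eta -> nc (f z) <= M + eta * nc b ^+ 2.
  move=> eta0; have [|w Kw wmax] := @compact_max _ K (fun w => nc (f w) + eta * nc w ^+ 2) K0 cK.
    move=> w Kw; apply: rcontinuousD; first by apply: rcontinuous_nc; exact: cf.
    apply: rcontinuousM; first exact: rcontinuous_cst.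
    exact: (@rcontinuousM _ (@nc R) (@nc R)).
  have [fwM|[[r r0 rK] f2]] := bd w Kw; last first.
    by exfalso; apply: (no_interior_max r0 eta0 f2) => y /rK /wmax.
  have : eta * nc w ^+ 2 <= eta * nc b ^+ 2.
    by rewrite ler_pM2l // ler_pXn2r ?nnegrE ?nc_ge0 // bmax.
  have : 0 <= eta * nc z ^+ 2 by rewrite mulr_ge0 ?sqr_ge0 // ltW.
  by have := wmax z Kz; lra.
apply/ler_addgt0Pl => e e0; have b1 : 0 < nc b ^+ 2 + 1 by have := sqr_ge0 (nc b); lra.
apply: le_trans (perturbed (e / (nc b ^+ 2 + 1)) ltac:(by rewrite divr_gt0)) _.
rewrite addrC lerD2r mulrAC ler_pdivrMr // ler_pM2l //; lra.
Qed.

Lemma max_modulus_disc f z0 r r' M : r' < r -> (forall z, disc z0 r z -> second_order_at f z) ->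
  (forall z, nc (z - z0) = r' -> nc (f z) <= M) ->
  forall z, closed_disc z0 r' z -> nc (f z) <= M.
Proof.
move=> rr f2 bd; have sub z : closed_disc z0 r' z -> disc z0 r z.
  by move=> zr'; exact: (le_lt_trans zr' rr).
apply: max_principle; first exact: closed_disc_compact.
  by move=> z /sub/f2/second_order_is_cderive[l]; exact: is_cderive_continuous.
move=> z zr'; have [zE|zn] := eqVneq (nc (z - z0)) r'; first by left; exact: bd.
have zr : disc z0 r' z by rewrite /disc /= lt_def eq_sym zn.
right; split; last by apply: f2; exact: sub.
by have [s s0 sr] := disc_open zr; exists s => // w /sr/ltW.
Qed.

Lemma holomorphic_bounded f z0 r r' : r' < r -> holomorphic (disc z0 r) f ->
  exists2 M, 0 <= M & forall z, closed_disc z0 r' z -> nc (f z) <= M.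
Proof.
move=> rr Hf; have [r'0|r'0] := ltP r' 0.
  by exists 0 => // z; rewrite /closed_disc /=; have := nc_ge0 (z - z0); lra.
have [||z _ zmax] := @compact_max _ _ (fun z => nc (f z)) _ (@closed_disc_compact R z0 r').
- by exists z0; rewrite /closed_disc /= subrr nc0.
- move=> z zr'; apply: rcontinuous_nc; apply: (holomorphic_continuous Hf).
  exact: (le_lt_trans zr' rr).
by exists (nc (f z)); first exact: nc_ge0.
Qed.

End MaximumPrinciple.

(** * Schwarz lemma, Cauchy estimates, identity theorem *)

Section Schwarz.
Variable R : realType.
Local Notation C := (R[i]).
Implicit Types (f g : C -> C) (z w c l : C) (U : set C) (r e d M K : R).

Lemma ler_mul_left_limit (a r0 r M : R) : 0 <= a -> r0 < r ->
  (forall r', r0 < r' -> r' < r -> a * r' <= M) -> a * r <= M.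
Proof.
move=> a0 r0r le_M; apply/ler_addgt0Pl => e e0; have a1 : 0 < a + 1 by lra.
have d0 : 0 < e / (a + 1) by rewrite divr_gt0.
pose r' := Num.max ((r0 + r) / 2) (r - e / (a + 1)).
have r'r : r' < r by rewrite gt_max; apply/andP; split; lra.
have r'1 : (r0 + r) / 2 <= r' by rewrite le_max lexx.
have r'2 : r - e / (a + 1) <= r' by rewrite le_max lexx orbT.
have : a * (e / (a + 1)) <= e by rewrite mulrA ler_pdivrMr // mulrC ler_wpM2l; lra.
have := ler_wpM2l a0 r'2; have := le_M r' ltac:(lra) r'r; lra.
Qed.

Lemma exprn_small (q e : R) : 0 <= q -> q < 1 -> 0 < e -> exists n : nat, q ^+ n < e.
Proof.
move=> q0 q1 e0; have /cvgrPdist_lt/(_ _ e0)[n _ small] : q ^+ n @[n --> \oo] --> 0.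
  by apply: cvg_expr; rewrite ger0_norm.
exists n; have := small n (leqnn n); rewrite /= sub0r normrN ger0_norm //.
exact: exprn_ge0.
Qed.

(* At z = c the quotient takes its limit value. *)
Definition slope f c z : C := if z == c then cderive f c else (f z - f c) / (z - c).

Lemma slopeE f c z : z != c -> slope f c z = (f z - f c) / (z - c).
Proof. by rewrite /slope => /negbTE ->. Qed.

Lemma copen_neq0 U f : copen U -> holomorphic U f -> copen (U `&` [set z | f z != 0]).
Proof.
move=> oU Hf z [Uz fz]; have fz0 : 0 < nc (f z) by rewrite nc_gt0.
have [d d0 near_z] := holomorphic_continuous Hf Uz fz0; have [r r0 rU] := oU z Uz.
exists (Num.min d r) => [|w]; first by rewrite lt_min d0.
rewrite /disc /= lt_min => /andP[/near_z wd /rU Uw]; split=> //=.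
by rewrite -nc_gt0; have := ncB_ge (f z) (f w); rewrite nc_distC; lra.
Qed.

Lemma holomorphic_div_neq0 U f g : copen U -> holomorphic U f -> holomorphic U g ->
  holomorphic (U `&` [set z | g z != 0]) (fun z => f z / g z).
Proof.
move=> oU Hf Hg; apply: holomorphic_div; first exact: copen_neq0.
- by move=> z [].
- by apply: holomorphic_sub Hf => z [].
- by apply: holomorphic_sub Hg => z [].
Qed.

Lemma holomorphic_subc U c : copen U -> holomorphic U (fun z => z - c).
Proof. by move=> oU; apply: holomorphicBc => //; exact: holomorphic_id. Qed.

Lemma slope_second_order f c r z : holomorphic (disc c r) f -> disc c r z ->
  second_order_at (slope f c) z.
Proof.
move=> Hf zr; have r0 : 0 < r by apply: le_lt_trans (nc_ge0 _) zr.
have oD := @disc_open R c r.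
have [->|zc] := eqVneq z c; last first.
  pose V := disc c r `&` [set w | w - c != 0].
  have oV : copen V by apply: copen_neq0 => //; exact: holomorphic_subc.
  apply: (holomorphic_second_order oV); last by split=> //=; rewrite subr_eq0.
  apply: (@holomorphic_eq _ V (fun w => (f w - f c) / (w - c))) => //.
    by move=> w [_ /=]; rewrite subr_eq0 => wc; rewrite slopeE.
  by apply: holomorphic_div_neq0 => //; [exact: holomorphicBc|exact: holomorphic_subc].
pose b := iter 2 (@cderive R) f c / 2`!%:R; pose a := iter 3 (@cderive R) f c / 3`!%:R.
exists b, a => e e0; have [d d0 rem] := taylor_young 3 r0 Hf e0; exists d => // w /rem wd.
have [->|wc] := eqVneq w c; first by rewrite !subrr expr0n /= !mulr0 !addr0 subrr nc0 expr0n mulr0.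
have wc0 : w - c != 0 by rewrite subr_eq0.
rewrite slopeE // {1}/slope eqxx.
have -> : (f w - f c) / (w - c) - (cderive f c + b * (w - c) + a * (w - c) ^+ 2) =
    (f w - taylor_poly 4 f c w) / (w - c).
  rewrite /taylor_poly !big_ord_recr big_ord0 /= -/b -/a !expr0 !divr1 /=.
  by move: (cderive f c) b a => l b a; field.
by rewrite nc_div ler_pdivrMr ?nc_gt0 // -mulrA -exprSr.
Qed.

Lemma schwarz_disc f c r M z : holomorphic (disc c r) f ->
  (forall w, disc c r w -> nc (f w - f c) <= M) -> disc c r z ->
  nc (f z - f c) <= M / r * nc (z - c).
Proof.
move=> Hf bM zr; have r0 : 0 < r by apply: le_lt_trans (nc_ge0 _) zr.
have [->|zc] := eqVneq z c; first by rewrite !subrr !nc0 mulr0.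
have zc0 : 0 < nc (z - c) by rewrite nc_gt0 subr_eq0.
suff : nc (slope f c z) * r <= M.
  by rewrite slopeE // nc_div -ler_pdivlMr // ler_pdivrMr.
apply: (ler_mul_left_limit (nc_ge0 _) zr) => r' zr' r'r.
have r'0 : 0 < r' by lra.
rewrite -ler_pdivlMr //; apply: (max_modulus_disc r'r) (ltW zr').
  by move=> w; exact: slope_second_order.
move=> w wr'; have wc : w != c.
  by rewrite -subr_eq0 -nc_eq0 wr' gt_eqF.
rewrite slopeE // nc_div wr' ler_pM2r ?invr_gt0 // bM //.
by rewrite /disc /= wr'.
Qed.

Lemma is_cderive_le f z l r K : 0 < r -> is_cderive f z l ->
  (forall w, disc z r w -> nc (f w - f z) <= K * nc (w - z)) -> nc l <= K.
Proof.
move=> r0 /is_cderiveP df bd; apply/ler_addgt0Pl => e /df[d d0 small].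
pose t := Num.min d r / 2.
have [min_l min_r] : Num.min d r <= d /\ Num.min d r <= r by rewrite !ge_min !lexx orbT.
have m0 : 0 < Num.min d r by rewrite lt_min d0.
have t0 : 0 < t by rewrite divr_gt0.
have [td tr] : t < d /\ t < r by rewrite /t; lra.
pose w := z + t%:C%C.
have wt : nc (w - z) = t by rewrite /w [z + _]addrC addrK nc_real gtr0_norm.
have := small w; have := bd w; rewrite /disc /= wt => /(_ tr) inc /(_ td) rem.
rewrite -(ler_pM2r t0) -{1}wt -ncM.
have -> : l * (w - z) = (f w - f z) - (f w - f z - l * (w - z)) by ring.
apply: le_trans (ncB _ _) _; lra.
Qed.

Lemma cauchy_estimate f c r M : 0 < r -> holomorphic (disc c r) f ->
  (forall z, disc c r z -> nc (f z) <= M) -> nc (cderive f c) <= 2 * M / r.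
Proof.
move=> r0 Hf bM; have cr := disc_center c r0.
apply: (is_cderive_le r0 (holomorphic_is_cderive Hf cr)) => w wr.
apply: (schwarz_disc Hf _ wr) => z zr.
by have := ncB (f z) (f c); have := bM z zr; have := bM c cr; lra.
Qed.

(* At c, where Rocq divides by 0, the quotient is holomorphic because it vanishes nearby. *)
Lemma vanishing_quotient_second_order f c d r n z : 0 < d -> holomorphic (disc c r) f ->
  (forall w, disc c d w -> f w = 0) -> disc c r z ->
  second_order_at (fun w => f w / (w - c) ^+ n) z.
Proof.
move=> d0 Hf f0 zr; have oD := @disc_open R c r; have od := @disc_open R c d.
have [->|zc] := eqVneq z c.
  apply: (holomorphic_second_order od _ (disc_center c d0)).
  apply: (@holomorphic_eq _ _ (fun=> 0)) => // [w /f0 ->|]; first by rewrite mul0r.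
  exact: holomorphic_cst.
have Hn : holomorphic (disc c r) (fun w => (w - c) ^+ n).
  by apply: holomorphicX => //; exact: holomorphic_subc.
apply: holomorphic_second_order (holomorphic_div_neq0 oD Hf Hn) _.
  exact: copen_neq0.
by split=> //=; rewrite expf_neq0 // subr_eq0.
Qed.

Lemma vanish_disc f c d r : 0 < d -> holomorphic (disc c r) f ->
  (forall z, disc c d z -> f z = 0) -> forall z, disc c r z -> f z = 0.
Proof.
move=> d0 Hf f0 z zr; have zr0 : nc (z - c) < r by exact: zr.
pose r' := (nc (z - c) + r) / 2.
have [zr' r'r] : nc (z - c) < r' /\ r' < r by rewrite /r'; lra.
clearbody r'; have r'0 : 0 < r' by apply: le_lt_trans (nc_ge0 _) zr'.
have [M M0 bM] := holomorphic_bounded r'r Hf.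
have decay n : nc (f z) <= M * (nc (z - c) / r') ^+ n.
  have [->|zc] := eqVneq (f z) 0.
    by rewrite nc0 mulr_ge0 // exprn_ge0 // divr_ge0 ?nc_ge0 // ltW.
  have zc0 : 0 < nc (z - c).
    rewrite nc_gt0 subr_eq0; apply: contraNneq zc => ->; apply/eqP; apply: f0.
    exact: disc_center.
  have : nc (f z / (z - c) ^+ n) <= M / r' ^+ n.
    apply: (@max_modulus_disc _ (fun w => f w / (w - c) ^+ n) c r r') (ltW zr') => // w wr'.
      exact: vanishing_quotient_second_order f0 wr'.
    by rewrite nc_div ncX wr' ler_pM2r ?invr_gt0 ?exprn_gt0 // bM // /closed_disc /= wr'.
  by rewrite nc_div ncX ler_pdivrMr ?exprn_gt0 // expr_div_n mulrA mulrAC.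
apply/eqP; rewrite -nc_eq0 eq_le nc_ge0 andbT; apply/ler_addgt0Pl => e e0.
have q1 : nc (z - c) / r' < 1 by rewrite ltr_pdivrMr // mul1r.
have [||n small] := exprn_small _ q1 (e := e / (M + 1)).
- by rewrite divr_ge0 ?nc_ge0 // ltW.
- by rewrite divr_gt0 //; lra.
apply: le_trans (decay n) _; rewrite addr0; move: small; rewrite ltr_pdivlMr; last lra.
have : 0 <= (nc (z - c) / r') ^+ n by rewrite exprn_ge0 // divr_ge0 ?nc_ge0 // ltW.
by lra.
Qed.

Lemma identity_theorem U f z0 d : is_convex U -> copen U -> holomorphic U f -> U z0 -> 0 < d ->
  (forall z, disc z0 d z -> f z = 0) -> forall z, U z -> f z = 0.
Proof.
move=> cU oU Hf Uz0 d0 f0 z Uz.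
pose A w := exists2 s : R, 0 < s & forall y, disc w s y -> f y = 0.
have [s s0 fs] : A z; last exact: fs (disc_center z s0).
have Az0 : A z0 by exists d.
apply: (convex_propagation cU _ Uz0 Uz Az0) => y Uy.
have [r r0 rU] := oU y Uy; exists (r / 8) => [|u v Uu Uv ur vr [s s0 fs]]; first lra.
rewrite /disc /= in ur vr.
have sub : disc u (r / 2) `<=` U.
  by move=> w wu; apply: rU; rewrite /disc /= in wu *; have := nc_triangle w u y; lra.
exists (r / 8) => [|w wv]; first lra.
apply: (vanish_disc s0 (holomorphic_sub sub Hf) fs (r := r / 2) _).
rewrite /disc /= in wv *.
have := nc_triangle w v u; have := nc_triangle v y u; rewrite (nc_distC y u); lra.
Qed.

Lemma sqrt_unique U f g : is_convex U -> copen U -> holomorphic U f -> holomorphic U g ->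
  (forall z, U z -> f z ^+ 2 = g z ^+ 2) ->
  (forall z, U z -> f z = g z) \/ (forall z, U z -> f z = - g z).
Proof.
move=> cU oU Hf Hg fg.
have [|/existsNP[z0 /not_implyP[Uz0 /eqP ne]]] := pselect (forall z, U z -> f z = g z).
  by left.
right => z Uz; apply/eqP; rewrite -subr_eq0 opprK; apply/eqP.
have Hm : holomorphic U (fun z => f z - g z) by exact: holomorphicB.
have Hp : holomorphic U (fun z => f z + g z) by exact: holomorphicD.
have np : 0 < nc (f z0 - g z0) by rewrite nc_gt0 subr_eq0.
have [d d0 near0] := holomorphic_continuous Hm Uz0 np; have [r r0 rU] := oU _ Uz0.
apply: (@identity_theorem U (fun z => f z + g z) z0 (Num.min d r)) => //.
  by rewrite lt_min d0.
move=> w; rewrite /disc /= lt_min => /andP[wd wr].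
have nz : f w - g w != 0.
  rewrite -nc_gt0; have := near0 _ wd.
  have := ncB_ge (f z0 - g z0) (f w - g w); rewrite (nc_distC (f z0 - g z0) (f w - g w)); lra.
have := fg _ (rU _ wr) => /eqP; rewrite -subr_eq0 subr_sqr mulf_eq0 (negbTE nz) /=.
by move/eqP.
Qed.

End Schwarz.

(** * Limits along an ultrafilter *)

Lemma free_ultrafilter_nat : exists F : set_system nat, UltraFilter F /\ \oo `<=` F.
Proof. exact: ultraFilterLemma. Qed.

(* Limits along a fixed free ultrafilter replace the extraction of convergent
   subsequences: all bounded sequences converge at once. *)
Definition ultra : set_system nat := projT1 (cid free_ultrafilter_nat).

Global Instance ultra_ultrafilter : UltraFilter ultra.
Proof. by rewrite /ultra; case: cid => F []. Qed.

Lemma ultra_near (A : set nat) : (\forall n \near \oo, A n) -> ultra A.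
Proof. by rewrite /ultra; case: cid => F /= [_]; exact. Qed.

Section UltraLimit.
Variable R : realType.
Local Notation C := (R[i]).
Implicit Types (u v : nat -> C) (l m : C) (e M : R).

Definition uconverges u l := forall e, 0 < e -> ultra [set n | nc (u n - l) < e].

Lemma uconvergesE u l : uconverges u l <-> (u : nat -> C^o) @ ultra --> (l : C^o).
Proof.
rewrite cvgrPdist_lt; split=> [ul _ /gt0_complex_real[e /ul near_l ->]|ul e e0].
  by apply: filterS near_l => n; rewrite /= nc_distC; exact: real_complex_lt.
by apply: filterS (ul _ (real_complex_lt e0)) => n; rewrite /= nc_distC -(@ltcR R).
Qed.

Lemma uconverges_uniq u l m : uconverges u l -> uconverges u m -> l = m.
Proof.
by move=> /uconvergesE ul /uconvergesE um; exact: (cvg_unique (@norm_hausdorff _ C^o) ul um).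
Qed.

Lemma bounded_uconverges u M : ultra [set n | nc (u n) <= M] -> exists l, uconverges u l.
Proof.
move=> bu; have [|l [_ cl]] := @closed_disc_compact R 0 M ((u : nat -> C^o) @ ultra) _.
  by apply: filterS bu => n; rewrite /closed_disc /= subr0.
exists l => e e0.
have [//|far] := in_ultra_setVsetC [set n | nc (u n - l) < e] ultra_ultrafilter.
have near_l : nbhs (l : C^o) (disc l e) by apply/nbhs_disc; exists e.
by have [z [far_z /far_z]] := cl (~` disc l e) (disc l e) far near_l.
Qed.

Definition ulim u : C := xget 0 [set l | uconverges u l].

Lemma ulimP u M : ultra [set n | nc (u n) <= M] -> uconverges u (ulim u).
Proof.
by move=> /bounded_uconverges[l ul]; apply: (@xgetPex _ 0 [set l | uconverges u l]); exists l.
Qed.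

Lemma uconverges_eq u v l : ultra [set n | u n = v n] -> uconverges u l -> uconverges v l.
Proof. by move=> uv ul e /ul; apply: filterS2 uv => n /= <-. Qed.

Lemma uconverges_cst l : uconverges (fun=> l) l.
Proof. by move=> e e0; apply: filterS filterT => n _ /=; rewrite subrr nc0. Qed.

Lemma uconvergesB u v l m :
  uconverges u l -> uconverges v m -> uconverges (fun n => u n - v n) (l - m).
Proof.
move=> /uconvergesE ul /uconvergesE vm; apply/uconvergesE.
exact: (@cvgB _ _ _ _ _ (u : nat -> C^o) (v : nat -> C^o) l m ul vm).
Qed.

Lemma uconvergesM u v l m :
  uconverges u l -> uconverges v m -> uconverges (fun n => u n * v n) (l * m).
Proof.
move=> /uconvergesE ul /uconvergesE vm; apply/uconvergesE.
exact: (@cvgM _ _ _ _ (u : nat -> C^o) (v : nat -> C^o) l m ul vm).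
Qed.

Lemma uconverges_comp (f : C -> C) u l :
  uconverges u l -> ccontinuous f l -> uconverges (fun n => f (u n)) (f l).
Proof. by move=> ul cf e /cf[d d0 near_l]; apply: filterS (ul _ d0) => n /near_l. Qed.

Lemma uconverges_le u l M : uconverges u l -> ultra [set n | nc (u n) <= M] -> nc l <= M.
Proof.
move=> ul bu; apply/ler_addgt0Pl => e /ul near_l.
have [n [/= un bn]] := filter_ex (filterI near_l bu).
by have := ncB_ge l (u n); rewrite nc_distC; lra.
Qed.

Lemma uconverges_ge u l M : uconverges u l -> ultra [set n | M <= nc (u n)] -> M <= nc l.
Proof.
move=> ul bu; apply/ler_addgt0Pl => e /ul near_l.
have [n [/= un bn]] := filter_ex (filterI near_l bu).
by have := ncB_ge (u n) l; lra.
Qed.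

Lemma ultra_harmonic_lt e : 0 < e -> ultra [set n | n.+1%:R^-1 < e].
Proof. by move=> e0; apply: ultra_near; exact: (near_infty_natSinv_lt (PosNum e0)). Qed.

Lemma ultra_nat_gt M : ultra [set n | M < n%:R].
Proof.
apply: ultra_near; exists (Num.truncn M).+1 => // n /= h.
by apply: lt_le_trans (truncnS_gt M) _; rewrite ler_nat.
Qed.

End UltraLimit.

Section LimitsOfHolomorphic.
Variable R : realType.
Local Notation C := (R[i]).
Implicit Types (f : C -> C) (z w l : C) (U : set C) (fs : nat -> C -> C).

Definition locally_bounded fs U := forall z, U z -> exists r M : R,
  [/\ 0 < r, disc z r `<=` U &
      ultra [set n | holomorphic (disc z r) (fs n) /\
                     forall w, disc z r w -> nc (fs n w) <= M]].

Definition ulim_fun fs z := ulim (fun n => fs n z).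

Lemma cauchy_estimate_half f z (r M : R) w : 0 < r -> holomorphic (disc z r) f ->
  (forall y, disc z r y -> nc (f y) <= M) -> disc z (r / 2) w ->
  nc (cderive f w) <= 2 * M / (r / 2).
Proof.
move=> r0 Hf bM wr; have sub : disc w (r / 2) `<=` disc z r.
  by move=> y; rewrite /disc /= in wr *; have := nc_triangle y w z; lra.
apply: cauchy_estimate; first lra.
  exact: holomorphic_sub Hf.
by move=> y /sub /bM.
Qed.

Lemma locally_bounded_cderive fs U : locally_bounded fs U ->
  locally_bounded (fun n => cderive (fs n)) U.
Proof.
move=> bf z /bf[r [M [r0 rU ub]]]; have half : r / 2 <= r by lra.
exists (r / 2), (2 * M / (r / 2)); split; first lra.
  exact: subset_trans (disc_mono half) rU.
apply: filterS ub => n [Hn bn]; split.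
  exact: holomorphic_sub (disc_mono half) (holomorphic_cderive Hn).
by move=> w; exact: cauchy_estimate_half.
Qed.

Lemma locally_bounded_refine fs U z (r : R) : locally_bounded fs U -> U z -> 0 < r ->
  exists r' M : R, [/\ 0 < r', r' <= r, 0 <= M, disc z r' `<=` U &
    ultra [set n | holomorphic (disc z r') (fs n) /\
                   forall w, disc z r' w -> nc (fs n w) <= M]].
Proof.
move=> bf Uz r0; have [s [M [s0 sU ub]]] := bf z Uz.
have [min_l min_r] : Num.min s r <= s /\ Num.min s r <= r by rewrite !ge_min !lexx orbT.
exists (Num.min s r), M; split=> //; first by rewrite lt_min s0.
- have [n [_ bn]] := filter_ex ub.
  by apply: le_trans (nc_ge0 _) (bn z (disc_center z s0)).
- exact: subset_trans (disc_mono min_l) sU.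
apply: filterS ub => n [Hn bn]; split; first exact: holomorphic_sub (disc_mono min_l) Hn.
by move=> w /(disc_mono min_l)/bn.
Qed.

Lemma uconverges_ulim_fun fs U z : locally_bounded fs U -> U z ->
  uconverges (fun n => fs n z) (ulim_fun fs z).
Proof.
move=> bf /bf[r [M [r0 rU ub]]]; apply: (@ulimP _ _ M).
by apply: filterS ub => n [_]; apply; exact: disc_center.
Qed.

Lemma ulim_fun_is_cderive fs U z : locally_bounded fs U -> U z ->
  is_cderive (ulim_fun fs) z (ulim_fun (fun n => cderive (fs n)) z).
Proof.
move=> bf Uz; have b1 := locally_bounded_cderive bf; have b2 := locally_bounded_cderive b1.
have [r' [M' [r'0 _ ub]]] := bf z Uz.
have [r [M [r0 rr' M0 rU ub2]]] := locally_bounded_refine b2 Uz r'0.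
have bound w : disc z r w ->
    nc (ulim_fun fs w - ulim_fun fs z - ulim_fun (fun n => cderive (fs n)) z * (w - z)) <=
    M * nc (w - z) ^+ 2.
  move=> wr; have Uw : U w by exact: rU.
  apply: (@uconverges_le _ (fun n => fs n w - fs n z - cderive (fs n) z * (w - z))).
    apply: uconvergesB; first by apply: uconvergesB; exact: (uconverges_ulim_fun bf).
    by apply: uconvergesM (uconverges_cst _); exact: (uconverges_ulim_fun b1).
  apply: filterS2 ub ub2 => n [Hn _] [_ bn] /=; apply: taylor_bound wr bn.
  exact: holomorphic_sub (disc_mono rr') Hn.
apply/is_cderiveP => e e0; have M1 : 0 < M + 1 by lra.
exists (Num.min r (e / (M + 1))) => [|w]; first by rewrite lt_min r0 divr_gt0.
rewrite /disc /= lt_min => /andP[w1 w2]; apply: le_trans (bound w w1) _.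
rewrite expr2 mulrA; apply: ler_wpM2r; first exact: nc_ge0.
by move: w2; rewrite ltr_pdivlMr //; have := nc_ge0 (w - z); lra.
Qed.

Lemma holomorphic_ulim_fun fs U : copen U -> locally_bounded fs U -> holomorphic U (ulim_fun fs).
Proof.
move=> oU bf n; elim: n fs bf => [//|n IH] fs bf.
apply: (@cderivable_n_intro _ _ _ _ (ulim_fun (fun n => cderive (fs n)))) => //.
  by move=> z Uz; exact: (ulim_fun_is_cderive bf).
by apply: IH; exact: locally_bounded_cderive.
Qed.

Lemma cderive_ulim_fun fs U z : locally_bounded fs U -> U z ->
  cderive (ulim_fun fs) z = ulim_fun (fun n => cderive (fs n)) z.
Proof. by move=> bf Uz; apply: cderiveE; exact: (ulim_fun_is_cderive bf). Qed.

Lemma uconverges_ulim_fun_comp fs U (u : nat -> C) l : locally_bounded fs U -> U l ->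
  uconverges u l -> uconverges (fun n => fs n (u n)) (ulim_fun fs l).
Proof.
move=> bf Ul ul e e0; have [r' [M' [r'0 _ ub]]] := bf l Ul.
have [r [M [r0 rr' M0 rU ub1]]] := locally_bounded_refine (locally_bounded_cderive bf) Ul r'0.
have M1 : 0 < M + 1 by lra.
have d0 : 0 < Num.min r (e / 2 / (M + 1)) by rewrite lt_min r0 !divr_gt0.
have fl := uconverges_ulim_fun bf Ul (e := e / 2) ltac:(lra).
apply: filterS2 (filterI ub ub1) (filterI (ul _ d0) fl) => n [[Hn _] [_ bn]] [].
rewrite /= lt_min => /andP[u1 u2] fln.
have : nc (fs n (u n) - fs n l) <= M * nc (u n - l).
  apply: (mean_value (@disc_convex R l r) _ bn (disc_center l r0) u1) => w wr.
  exact: (holomorphic_is_cderive Hn (disc_mono rr' wr)).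
have : M * nc (u n - l) <= e / 2.
  by move: u2; rewrite ltr_pdivlMr //; have := nc_ge0 (u n - l); lra.
by have := nc_triangle (fs n (u n)) (fs n l) (ulim_fun fs l); lra.
Qed.

End LimitsOfHolomorphic.

(** * Holomorphic square roots *)

Section PrincipalSquareRoot.
Variable R : realType.
Local Notation C := (R[i]).
Implicit Types (z w : C).

Definition principal_sqrt w : C := if 0 <= complex.Re (sqrtc w) then sqrtc w else - sqrtc w.

Lemma sqr_principal_sqrt w : principal_sqrt w ^+ 2 = w.
Proof. by rewrite /principal_sqrt; case: ifP => _; rewrite ?sqrrN sqr_sqrtc. Qed.

Lemma Re_principal_sqrt_ge0 w : 0 <= complex.Re (principal_sqrt w).
Proof.
rewrite /principal_sqrt; case: ifP => // /negbT; rewrite -ltNge ReN oppr_ge0; exact: ltW.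
Qed.

Definition right_half_plane : set C := [set w | 0 < complex.Re w].

Lemma Re_principal_sqrt_gt0 w : right_half_plane w -> 0 < complex.Re (principal_sqrt w).
Proof.
rewrite /right_half_plane /= => w0; rewrite lt_def Re_principal_sqrt_ge0 andbT.
apply: contraTneq w0 => E.
by rewrite -(sqr_principal_sqrt w) expr2 ReM E mul0r sub0r -leNgt oppr_le0 -expr2 sqr_ge0.
Qed.

Lemma right_half_plane_open : copen right_half_plane.
Proof.
move=> z z0; exists (complex.Re z) => // w; rewrite /disc /right_half_plane /= => wz.
have := Re_le_nc (w - z); rewrite ler_norml ReD ReN => /andP[+ _].
by rewrite /right_half_plane /= in z0; lra.
Qed.

Lemma disc1_right_half_plane w : nc (w - 1) < 1 -> right_half_plane w.
Proof.
move=> w1; have := Re_le_nc (w - 1); rewrite ler_norml ReD ReN /= => /andP[+ _].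
by rewrite /right_half_plane /=; lra.
Qed.

Lemma Re_gt0_neq0 w : 0 < complex.Re w -> w != 0.
Proof. by move=> h; apply: contraTneq h => ->; rewrite ltxx. Qed.

Lemma principal_sqrtB z w : right_half_plane z ->
  principal_sqrt w - principal_sqrt z = (w - z) / (principal_sqrt w + principal_sqrt z).
Proof.
move=> z0; have -> : w - z = principal_sqrt w ^+ 2 - principal_sqrt z ^+ 2.
  by rewrite !sqr_principal_sqrt.
rewrite subr_sqr mulfK //.
apply: Re_gt0_neq0; rewrite ReD.
by have := Re_principal_sqrt_gt0 z0; have := Re_principal_sqrt_ge0 w; lra.
Qed.

Lemma principal_sqrt_continuous z : right_half_plane z -> ccontinuous principal_sqrt z.
Proof.
move=> z0 e e0; have rz := Re_principal_sqrt_gt0 z0.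
exists (e * complex.Re (principal_sqrt z)) => [|w wz]; first by rewrite mulr_gt0.
have Re_sum : complex.Re (principal_sqrt z) <= complex.Re (principal_sqrt w + principal_sqrt z).
  by rewrite ReD lerDr Re_principal_sqrt_ge0.
have := Re_le_nc (principal_sqrt w + principal_sqrt z); rewrite ler_norml => /andP[_ le_nc].
rewrite principal_sqrtB // nc_div ltr_pdivrMr; last first.
  by rewrite (lt_le_trans rz) // (le_trans Re_sum).
by apply: lt_le_trans wz _; rewrite ler_pM2l // (le_trans Re_sum).
Qed.

Lemma is_cderive_principal_sqrt z :
  right_half_plane z -> is_cderive principal_sqrt z (2 * principal_sqrt z)^-1.
Proof.
move=> z0; have rz := Re_principal_sqrt_gt0 z0.
have pz : principal_sqrt z + principal_sqrt z != 0 by apply: Re_gt0_neq0; rewrite ReD; lra.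
have quotient_cont : ccontinuous (fun w => (principal_sqrt w + principal_sqrt z)^-1) z.
  apply: ccontinuousV => // e /(principal_sqrt_continuous z0)[d d0 near_z].
  by exists d => // w /near_z; rewrite opprD addrACA subrr addr0.
apply/is_cderiveP => e /quotient_cont[d d0 near_z]; exists d => // w /near_z/ltW wd.
rewrite principal_sqrtB // mulrC -mulrBl ncM ler_wpM2r ?nc_ge0 //.
by rewrite mulr_natl mulr2n.
Qed.

Lemma holomorphic_principal_sqrt : holomorphic right_half_plane principal_sqrt.
Proof.
have oH := right_half_plane_open.
elim=> [//|n IH]; apply: (@cderivable_n_intro _ _ _ _ (fun z => (2 * principal_sqrt z)^-1)) => //.
  exact: is_cderive_principal_sqrt.
apply: cderivable_nV => //.
  by move=> z /Re_principal_sqrt_gt0 /Re_gt0_neq0 pz; rewrite mulf_neq0 // pnatr_eq0.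
by apply: cderivable_nM => //; exact: cderivable_n_cst.
Qed.

End PrincipalSquareRoot.

Section SquareRoots.
Variable R : realType.
Local Notation C := (R[i]).
Implicit Types (f g h X Y : C -> C) (x y z w c : C) (U V : set C) (d r : R).

Definition square_on X V := exists2 h, holomorphic V h & forall w, V w -> h w ^+ 2 = X w.

Definition square_at X z := exists2 r : R, 0 < r & square_on X (disc z r).

Lemma square_on_sub X U V : V `<=` U -> square_on X U -> square_on X V.
Proof. by move=> VU [h Hh hE]; exists h => [|w /VU /hE //]; exact: holomorphic_sub Hh. Qed.

Lemma square_on_at X U z : copen U -> square_on X U -> U z -> square_at X z.
Proof. by move=> oU hX /oU[r r0 rU]; exists r => //; exact: square_on_sub hX. Qed.

Lemma square_on_set0 X U : copen U -> (forall z, ~ U z) -> square_on X U.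
Proof. by move=> oU U0; exists (fun=> 0) => [|z /U0 //]; exact: holomorphic_cst. Qed.

Lemma square_at_near X Y z d : 0 < d -> (forall w, disc z d w -> X w = Y w) ->
  square_at X z -> square_at Y z.
Proof.
move=> d0 XY [r r0 [h Hh hE]]; exists (Num.min d r); first by rewrite lt_min d0.
have [min_l min_r] : Num.min d r <= d /\ Num.min d r <= r by rewrite !ge_min !lexx orbT.
exists h => [|w wm]; first exact: holomorphic_sub (disc_mono min_r) Hh.
by rewrite -(XY w (disc_mono min_l wm)) (hE w (disc_mono min_r wm)).
Qed.

Lemma square_at_eq X Y z : (forall w, X w = Y w) -> square_at X z -> square_at Y z.
Proof. by move=> XY; exact: (square_at_near ltr01). Qed.

Lemma square_at_cst c z : square_at (fun=> c) z.
Proof.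
exists 1 => //; exists (fun=> sqrtc c) => [|w _]; last by rewrite sqr_sqrtc.
by apply: holomorphic_cst; exact: disc_open.
Qed.

Lemma square_at_sqr U f z : copen U -> holomorphic U f -> U z -> square_at (fun w => f w ^+ 2) z.
Proof. by move=> oU Hf Uz; apply: (square_on_at oU) => //; exists f. Qed.

Lemma square_atM X Y z : square_at X z -> square_at Y z -> square_at (fun w => X w * Y w) z.
Proof.
move=> [r r0 [h Hh hE]] [s s0 [k Hk kE]]; exists (Num.min r s); first by rewrite lt_min r0.
have [min_l min_r] : Num.min r s <= r /\ Num.min r s <= s by rewrite !ge_min !lexx orbT.
exists (fun w => h w * k w).
  apply: holomorphicM; [exact: disc_open|exact: holomorphic_sub (disc_mono min_l) Hh|].
  exact: holomorphic_sub (disc_mono min_r) Hk.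
by move=> w wm; rewrite exprMn (hE w (disc_mono min_l wm)) (kE w (disc_mono min_r wm)).
Qed.

Lemma square_at_comp U X f z : copen U -> holomorphic U f -> U z -> square_at X (f z) ->
  square_at (fun w => X (f w)) z.
Proof.
move=> oU Hf Uz [r r0 [h Hh hE]].
have [s s0 sU] := oU z Uz; have [d d0 near_z] := holomorphic_continuous Hf Uz r0.
have [min_l min_r] : Num.min s d <= s /\ Num.min s d <= d by rewrite !ge_min !lexx orbT.
exists (Num.min s d); first by rewrite lt_min s0.
have fr w : disc z (Num.min s d) w -> disc (f z) r (f w) by move/(disc_mono min_r)/near_z.
exists (fun w => h (f w)); last by move=> w /fr /hE.
apply: (holomorphic_comp (@disc_open R _ _) (@disc_open R (f z) r) fr _ Hh).
exact: holomorphic_sub (subset_trans (disc_mono min_l) sU) Hf.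
Qed.

Lemma square_at_neq0 U X z : copen U -> holomorphic U X -> U z -> X z != 0 -> square_at X z.
Proof.
move=> oU HX Uz Xz.
have HY : holomorphic U (fun w => (X z)^-1 * X w) by exact: holomorphicZ.
have Y1 : (X z)^-1 * X z = 1 by rewrite mulVf.
have principal : square_at id 1.
  apply: (square_on_at (@right_half_plane_open R)); last by rewrite /right_half_plane /=.
  exists (@principal_sqrt R) => [|w _]; first exact: holomorphic_principal_sqrt.
  exact: sqr_principal_sqrt.
have sqY : square_at (fun w => (X z)^-1 * X w) z.
  by apply: (@square_at_comp U id _ z oU HY Uz); rewrite Y1.
by apply: square_at_eq (square_atM (square_at_cst (X z) z) sqY) => w; rewrite mulVKf.
Qed.

Lemma square_at_divr U X k z : copen U -> holomorphic U k -> U z -> k z != 0 ->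
  square_at (fun w => X w * k w) z -> square_at X z.
Proof.
move=> oU Hk Uz kz sq; have oV := copen_neq0 oU Hk; set V := _ `&` _ in oV.
have Vz : V z by [].
have sqV : square_at (fun w => (k w)^-1) z.
  apply: (square_at_neq0 oV _ Vz); last by rewrite invr_neq0.
  by apply: holomorphicV => // [w []//|]; apply: holomorphic_sub Hk => w [].
have [r r0 rV] := oV z Vz; apply: (square_at_near r0 _ (square_atM sq sqV)) => w /rV[_ kw].
by rewrite mulfK.
Qed.

Lemma square_on_through X U z0 c : copen U -> U z0 -> X z0 = c ^+ 2 -> square_on X U ->
  exists2 h, holomorphic U h & (forall z, U z -> h z ^+ 2 = X z) /\ h z0 = c.
Proof.
move=> oU Uz0 Xz0 [h Hh hE]; have /eqP := hE z0 Uz0.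
rewrite Xz0 eqf_sqr => /orP[/eqP e|/eqP e]; first by exists h.
exists (fun z => - h z); first exact: holomorphicN.
by split=> [z Uz|]; rewrite ?sqrrN ?hE // e opprK.
Qed.

Lemma square_at_zero_critical X z : square_at X z -> X z = 0 -> is_cderive X z 0.
Proof.
move=> [r r0 [h Hh hE]] X0; have zr := disc_center z r0.
have h0 : h z = 0 by apply/eqP; rewrite -sqrf_eq0 hE // X0.
apply: (@is_cderive_near _ (fun w => h w ^+ 2) _ _ _ r) => //.
apply: is_cderive_eq (is_cderiveX 2 (holomorphic_is_cderive Hh zr)) _.
by rewrite h0 expr1 mulr0 mul0r.
Qed.

Lemma glue_square_on X U V : copen U -> is_convex U -> copen V -> is_convex V ->
  square_on X U -> square_on X V -> square_on X (U `|` V).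
Proof.
move=> oU cU oV cV [h Hh hE] [k Hk kE].
have [k' Hk' [k'E hk']] : exists2 k', holomorphic V k' & (forall w, V w -> k' w ^+ 2 = X w) /\
    forall w, U w -> V w -> h w = k' w.
  have [e|e] := @sqrt_unique _ (U `&` V) h k (convexI cU cV) (copenI oU oV)
    ltac:(by apply: holomorphic_sub Hh => ? []) ltac:(by apply: holomorphic_sub Hk => ? [])
    ltac:(by move=> z [Uz Vz]; rewrite hE // kE).
  - by exists k => //; split=> // w Uw Vw; exact: e.
  - exists (fun w => - k w); first exact: holomorphicN.
    by split=> [w Vw|w Uw Vw]; [rewrite sqrrN kE|exact: e].
exists (fun w => if `[< U w >] then h w else k' w).
  apply: holomorphic_local => z [Uz|Vz]; [exists U|exists V]; split=> //.
    by apply: (@holomorphic_eq _ _ h) => // w Uw; rewrite asboolT.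
  by apply: (@holomorphic_eq _ _ k') => // w Vw; case: asboolP => // Uw; rewrite hk'.
by move=> w; case: asboolP => [Uw _|nU [//|Vw]]; [exact: hE|exact: k'E].
Qed.

End SquareRoots.

Section Slabs.
Variable R : realType.
Local Notation C := (R[i]).
Variable phi : C -> R.
Hypothesis phi_seg : forall x y t, phi (seg x y t) = phi x + t * (phi y - phi x).
Hypothesis phi_lipschitz : forall x y, `|phi x - phi y| <= nc (x - y).
Implicit Types (X : C -> C) (a b d u : R).

Definition slab a b : set C := [set w | a < phi w /\ phi w < b].

Lemma slab_open a b : copen (slab a b).
Proof.
move=> z [az zb]; exists (Num.min (phi z - a) (b - phi z)).
  by rewrite lt_min; apply/andP; split; lra.
move=> w; rewrite /disc /= lt_min => /andP[w1 w2].
by have := phi_lipschitz w z; rewrite ler_norml => /andP[u1 u2]; split; lra.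
Qed.

Lemma slab_convex a b : is_convex (slab a b).
Proof.
move=> x y t [ax xb] [ay yb] t0 t1; rewrite /slab /= phi_seg.
have -> : phi x + t * (phi y - phi x) = (1 - t) * phi x + t * phi y by ring.
have [->|tn0] := eqVneq t 0; first by rewrite subr0 mul1r mul0r addr0.
have tp : 0 < t by rewrite lt_def tn0.
have : t * a < t * phi y by rewrite ltr_pM2l.
have : t * phi y < t * b by rewrite ltr_pM2l.
have t1' : 0 <= 1 - t by lra.
have := ler_wpM2l t1' (ltW ax); have := ler_wpM2l t1' (ltW xb).
by move=> *; split; lra.
Qed.

Lemma glue_slabs X (S : R -> set C) a b : a <= b ->
  (forall d, copen (S d)) -> (forall d, is_convex (S d)) ->
  (forall d d', d <= d' -> S d `<=` S d') ->
  (forall u, a <= u -> u <= b ->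
     exists2 d, 0 < d & square_on X (S d `&` slab (u - d) (u + d))) ->
  exists2 d, 0 < d & square_on X (S d `&` slab (a - d) (b + d)).
Proof.
move=> ab oS cS monoS loc.
apply: (@cousin _ (fun s t => exists2 d, 0 < d & square_on X (S d `&` slab (s - d) (t + d)))) => //.
  move=> s m t sm mt [d1 d10 sq1] [d2 d20 sq2]; exists (Num.min d1 d2); first by rewrite lt_min d10.
  have [min_l min_r] : Num.min d1 d2 <= d1 /\ Num.min d1 d2 <= d2 by rewrite !ge_min !lexx orbT.
  have d0 : 0 < Num.min d1 d2 by rewrite lt_min d10.
  move: min_l min_r d0; set d := Num.min d1 d2 => min_l min_r d0.
  have left_half : square_on X (S d `&` slab (s - d) (m + d)).
    by apply: square_on_sub sq1 => w [/(monoS _ _ min_l) Sw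
         [/= v1 v2]]; split=> //; split=> /=; lra.
  have right_half : square_on X (S d `&` slab (m - d) (t + d)).
    by apply: square_on_sub sq2 => w [/(monoS _ _ min_r) Sw
         [/= v1 v2]]; split=> //; split=> /=; lra.
  have o a' b' : copen (S d `&` slab a' b') by apply: copenI => //; exact: slab_open.
  have c a' b' : is_convex (S d `&` slab a' b') by apply: convexI => //; exact: slab_convex.
  apply: square_on_sub (glue_square_on (o _ _) (c _ _) (o _ _) (c _ _) left_half right_half).
  move=> w [Sw [/= v1 v2]].
  by have [lt|ge] := ltP (phi w) (m + d); [left|right]; split=> //; split=> //=; lra.
move=> u au ub; have [d d0 sq] := loc u au ub; have half : d / 2 <= d by lra.
exists (d / 2); first lra.
move=> s t s1 s2 t1 t2 _ _; exists (d / 2); first lra.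
by apply: square_on_sub sq => w [/(monoS _ _ half) Sw [/= v1 v2]]; split=> //; split=> /=; lra.
Qed.

End Slabs.

Section SquareRootOnDisc.
Variable R : realType.
Local Notation C := (R[i]).
Implicit Types (X : C -> C) (z w c : C) (d r : R).
Local Notation Re := (@complex.Re R).
Local Notation Im := (@complex.Im R).

Lemma Re_seg x y t : Re (seg x y t) = Re x + t * (Re y - Re x).
Proof. by rewrite /seg ReD ReM ReD ReN /= mul0r subr0. Qed.

Lemma Im_seg x y t : Im (seg x y t) = Im x + t * (Im y - Im x).
Proof. by rewrite /seg ImD ImM ImD ImN /= mul0r addr0. Qed.

Lemma Re_lipschitz x y : `|Re x - Re y| <= nc (x - y).
Proof. by have := Re_le_nc (x - y); rewrite ReD ReN. Qed.

Lemma Im_lipschitz x y : `|Im x - Im y| <= nc (x - y).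
Proof. by have := Im_le_nc (x - y); rewrite ImD ImN. Qed.

Lemma box_sub_disc c d w : slab Re (Re c - d / 2) (Re c + d / 2) w ->
  slab Im (Im c - d / 2) (Im c + d / 2) w -> disc c d w.
Proof.
move=> [re1 re2] [im1 im2]; apply: le_lt_trans (nc_le_ReIm _) _; rewrite ReD ReN ImD ImN /=.
have : `|Re w - Re c| < d / 2 by rewrite ltr_norml; apply/andP; split; lra.
have : `|Im w - Im c| < d / 2 by rewrite ltr_norml; apply/andP; split; lra.
lra.
Qed.

Lemma square_on_smaller_disc X c r r' : r' < r ->
  (forall z, disc c r z -> square_at X z) -> square_on X (disc c r').
Proof.
move=> r'r loc; pose E := disc c r'.
have oE : copen E by exact: disc_open.
have cE : is_convex E by exact: disc_convex.
have [r'0|r'0] := leP r' 0.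
  by apply: square_on_set0 => // z; rewrite /disc /=; have := nc_ge0 (z - c); lra.
pose column x0 d := E `&` slab Re (x0 - d) (x0 + d).
have col_open x0 d : copen (column x0 d).
  by apply: copenI => //; exact: (slab_open Re_lipschitz).
have col_convex x0 d : is_convex (column x0 d).
  by apply: convexI => //; exact: (slab_convex Re_seg).
have local x0 y0 : exists2 d : R, 0 < d &
    square_on X (column x0 d `&` slab Im (y0 - d) (y0 + d)).
  pose p := Complex x0 y0.
  have box d w : (column x0 (d / 2) `&` slab Im (y0 - d / 2) (y0 + d / 2)) w -> disc p d w.
    by move=> [[_ re] im]; exact: box_sub_disc.
  have [pr|pr] := ltP (nc (p - c)) r.
    by have [d d0 sq] := loc p pr; exists (d / 2); [lra|apply: square_on_sub sq => w /box].
  exists ((r - r') / 2); first lra.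
  apply: square_on_set0; first by apply: copenI; [exact: col_open|exact: (slab_open Im_lipschitz)].
  move=> w Ew; have := box (r - r') w Ew; have [[/= Er _] _] := Ew.
  rewrite /E /disc /= in Er * => wp; have := nc_triangle p w c; rewrite (nc_distC p w); lra.
have columns x0 : exists2 d : R, 0 < d & square_on X (column x0 d).
  have [|||d d0 sq] := glue_slabs Im_seg Im_lipschitz (X := X) (S := column x0)
    (a := Im c - r) (b := Im c + r) _ (col_open x0) (col_convex x0).
  - lra.
  - by move=> d d' dd w [Ew [/= v1 v2]]; split=> //; split=> /=; lra.
  - by move=> u _ _; exact: local.
  exists d => //; apply: square_on_sub sq => w [Ew vw]; split=> //; rewrite /E /disc /= in Ew.
  by have := Im_lipschitz w c; rewrite ler_norml => /andP[u1 u2]; split=> /=; lra.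
have [|||d d0 sq] := glue_slabs Re_seg Re_lipschitz (X := X) (S := fun=> E)
  (a := Re c - r) (b := Re c + r) _ (fun=> oE) (fun=> cE).
- lra.
- by move=> ? ? _ w.
- by move=> u _ _; exact: columns.
apply: square_on_sub sq => w Ew; split=> //; rewrite /disc /= in Ew.
by have := Re_lipschitz w c; rewrite ler_norml => /andP[u1 u2]; split=> /=; lra.
Qed.

Lemma square_on_ulim_fun fs hs (U : set C) : copen U -> locally_bounded fs U ->
  (forall z, U z -> exists2 r, 0 < r & ultra [set n | holomorphic (disc z r) (hs n) /\
     forall w, disc z r w -> hs n w ^+ 2 = fs n w]) ->
  square_on (ulim_fun fs) U.
Proof.
move=> oU bf sq; have bh : locally_bounded hs U.
  move=> z Uz; have [r r0 ultra_sq] := sq z Uz.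
  have [s [M [s0 sr M0 sU ub]]] := locally_bounded_refine bf Uz r0.
  exists s, (M + 1); split=> //; apply: filterS2 ultra_sq ub => n [Hn hE] [_ bn].
  split=> [|w ws]; first exact: holomorphic_sub (disc_mono sr) Hn.
  have := bn w ws; rewrite -(hE w (disc_mono sr ws)) ncX.
  by have := nc_ge0 (hs n w); nra.
exists (ulim_fun hs) => [|w Uw]; first exact: holomorphic_ulim_fun.
have [r r0 ultra_sq] := sq w Uw; have hw := uconverges_ulim_fun bh Uw.
apply: uconverges_uniq (uconverges_ulim_fun bf Uw).
apply: uconverges_eq (uconvergesM hw hw).
by apply: filterS ultra_sq => n [_ hE] /=; rewrite -expr2 hE //; exact: disc_center.
Qed.

Lemma locally_bounded_cst X (U : set C) :
  copen U -> holomorphic U X -> locally_bounded (fun=> X) U.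
Proof.
move=> oU HX z Uz; have [r r0 rU] := oU z Uz.
have [d d0 near_z] := holomorphic_continuous HX Uz ltr01.
have [min_l min_r] : Num.min r d <= r /\ Num.min r d <= d by rewrite !ge_min !lexx orbT.
have sub := subset_trans (disc_mono min_l) rU.
exists (Num.min r d), (nc (X z) + 1); split=> //; first by rewrite lt_min r0.
apply: filterS filterT => n _; split=> [|w /(disc_mono min_r)/near_z].
  exact: holomorphic_sub HX.
by have := ncB_ge (X w) (X z); lra.
Qed.

Lemma square_on_disc X c r : holomorphic (disc c r) X ->
  (forall z, disc c r z -> square_at X z) -> square_on X (disc c r).
Proof.
move=> HX loc; have oD := @disc_open R c r; have bX := locally_bounded_cst oD HX.
have smaller (n : nat) : exists h, holomorphic (disc c (r - n.+1%:R^-1)) h /\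
    forall w, disc c (r - n.+1%:R^-1) w -> h w ^+ 2 = X w.
  have [|h Hh hE] := @square_on_smaller_disc X c r (r - n.+1%:R^-1) _ loc; last by exists h.
  by rewrite ltrBlDr ltrDl invr_gt0 ltr0n.
have [hs hsP] := choice smaller.
have [|h Hh hE] := @square_on_ulim_fun (fun=> X) hs _ oD bX.
  move=> z zr; pose d := (r - nc (z - c)) / 2.
  have d0 : 0 < d by rewrite /d; rewrite /disc /= in zr; lra.
  exists d => //; apply: filterS (ultra_harmonic_lt d0) => n /= nd.
  have sub : disc z d `<=` disc c (r - n.+1%:R^-1).
    move=> w; rewrite /disc /=; have := nc_triangle w z c; rewrite /d in nd *.
    by move: nd; set q := n.+1%:R^-1; lra.
  have [Hn hE] := hsP n; split; first exact: holomorphic_sub Hn.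
  by move=> w /sub /hE.
exists h => // w wr; rewrite (hE w wr).
by apply: uconverges_uniq (uconverges_ulim_fun bX wr) (uconverges_cst _).
Qed.

Lemma square_at_ulim_fun fs (U : set C) z r : locally_bounded fs U -> U z -> 0 < r ->
  ultra [set n | forall w, disc z r w -> square_at (fs n) w] -> square_at (ulim_fun fs) z.
Proof.
move=> bf Uz r0 sq; have [s [M [s0 sr M0 sU bM]]] := locally_bounded_refine bf Uz r0.
pose V := disc z s; exists s => //.
have roots (n : nat) : exists h, square_on (fs n) V ->
    holomorphic V h /\ forall w, V w -> h w ^+ 2 = fs n w.
  by have [[h Hh hE]|no] := pselect (square_on (fs n) V); [exists h|exists (fun=> 0)].
have [hs hsP] := choice roots.
have bV : locally_bounded fs V.
  move=> w Vw; have [t t0 tV] := disc_open Vw; exists t, M; split=> //.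
  by apply: filterS bM => n [Hn bn]; split=> [|y /tV /bn //]; exact: holomorphic_sub Hn.
apply: (square_on_ulim_fun (hs := hs)) => // [|w Vw]; first exact: disc_open.
have [t t0 tV] := disc_open Vw; exists t => //; apply: filterS2 sq bM => n sqn [Hn _].
have [|Hh hE] := hsP n; last by split=> [|y /tV /hE //]; exact: holomorphic_sub Hh.
by apply: square_on_disc => // y ys; apply: sqn; exact: disc_mono ys.
Qed.

End SquareRootOnDisc.

(** * The theorems of Bloch and Landau for the Gaussian integers *)

Section GaussianIntegers.
Variable R : realType.
Local Notation C := (R[i]).
Implicit Types (l m w : C) (N : nat).

Definition gaussian : set C := [set l | exists a b : int, l = Complex a%:~R b%:~R].

Lemma gaussian0 : gaussian 0.
Proof. by exists 0, 0. Qed.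

Lemma gaussian1 : gaussian 1.
Proof. by exists 1, 0. Qed.

Lemma gaussianD l m : gaussian l -> gaussian m -> gaussian (l + m).
Proof. by move=> [a [b ->]] [a' [b' ->]]; exists (a + a'), (b + b'); rewrite !intrD. Qed.

Lemma gaussianN l : gaussian l -> gaussian (- l).
Proof. by move=> [a [b ->]]; exists (- a), (- b); rewrite !rmorphN. Qed.

Lemma gaussianB l m : gaussian l -> gaussian m -> gaussian (l - m).
Proof. by move=> hl /gaussianN; exact: gaussianD. Qed.

Lemma gaussian_mulrn l N : gaussian l -> gaussian (l *+ N).
Proof.
move=> hl; elim: N => [|N IH]; first exact: gaussian0.
by rewrite mulrS; exact: gaussianD.
Qed.

Lemma gaussian_translate l m : gaussian m -> gaussian (l + m) <-> gaussian l.
Proof. by move=> hm; split=> [/gaussianB/(_ hm)|hl]; [rewrite addrK|exact: gaussianD]. Qed.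

Lemma nearest_int (x : R) : exists a : int, `|x - a%:~R| <= 1 / 2.
Proof.
exists (Num.floor (x + 1 / 2)); rewrite ler_norml.
have := floor_itv (x + 1 / 2); rewrite intrD => /andP[floor_le lt_floor1].
by apply/andP; split; lra.
Qed.

Lemma nc_le34 w : `|complex.Re w| <= 1 / 2 -> `|complex.Im w| <= 1 / 2 -> nc w <= 3 / 4.
Proof.
move=> re im; have p0 : 0 <= 3 / 4 :> R by lra.
have sqr_le (t : R) : `|t| <= 1 / 2 -> t ^+ 2 <= 1 / 4.
  by rewrite -real_normK ?num_real // => t2; have := normr_ge0 t; nra.
rewrite -(@ler_pXn2r _ 2) ?nnegrE ?nc_ge0 // nc_sqr.
by have := sqr_le _ re; have := sqr_le _ im; lra.
Qed.

Lemma nearest_gaussian w : exists2 l, gaussian l & nc (w - l) <= 3 / 4.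
Proof.
have [a ha] := nearest_int (complex.Re w); have [b hb] := nearest_int (complex.Im w).
exists (Complex a%:~R b%:~R); first by exists a, b.
by apply: nc_le34; rewrite ?ReD ?ImD ?ReN ?ImN.
Qed.

Lemma gaussian_norm_ge1 l : gaussian l -> l != 0 -> 1 <= nc l.
Proof.
have int_norm_ge1 (a : int) : a != 0 -> 1 <= `|a%:~R| :> R.
  by move=> a0; rewrite -intr_norm ler1z -gtz0_ge1 normr_gt0.
move=> [a [b ->]] ne; have [a0|a0] := eqVneq a 0.
  have b0 : b != 0 by apply: contraNneq ne => ->; rewrite a0.
  exact: le_trans (int_norm_ge1 _ b0) (Im_le_nc (Complex a%:~R b%:~R)).
exact: le_trans (int_norm_ge1 _ a0) (Re_le_nc (Complex a%:~R b%:~R)).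
Qed.

Lemma gaussian_close_eq l m : gaussian l -> gaussian m -> nc (l - m) < 1 -> l = m.
Proof.
move=> hl hm close; apply/eqP; rewrite -subr_eq0; apply: contraTT close => ne.
by rewrite -leNgt; apply: gaussian_norm_ge1 => //; exact: gaussianB.
Qed.

Lemma small_not_gaussian l : l != 0 -> nc l < 1 -> ~ gaussian l.
Proof. by move=> l0 small hl; have := gaussian_norm_ge1 hl l0; lra. Qed.

Lemma not_gaussian_isolated w : ~ gaussian w ->
  exists2 d : R, 0 < d /\ d <= 1 / 4 & forall l, gaussian l -> d <= nc (l - w).
Proof.
move=> nw; have [l0 hl0 wl0] := nearest_gaussian w.
have w0 : 0 < nc (l0 - w).
  by rewrite nc_gt0 subr_eq0; apply: contra_notN nw => /eqP <-.
exists (Num.min (1 / 4) (nc (l0 - w))).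
  by split; [rewrite lt_min w0 andbT; lra|rewrite ge_min lexx].
move=> l hl; have [->|ne] := eqVneq l l0; first by rewrite ge_min lexx orbT.
rewrite ge_min; apply/orP; left; have := nc_triangle l w l0.
have := gaussian_norm_ge1 (gaussianB hl hl0); rewrite subr_eq0 => /(_ ne); lra.
Qed.

Definition gaussian_multiple N : set C := [set t | exists2 s, gaussian s & t = N%:R * s].

Lemma gaussian_multiple_gaussian N t : gaussian_multiple N t -> gaussian t.
Proof. by move=> [s hs ->]; rewrite mulr_natl; exact: gaussian_mulrn. Qed.

Lemma gaussian_multiple0 N : gaussian_multiple N 0.
Proof. by exists 0; rewrite ?mulr0 //; exact: gaussian0. Qed.

Lemma gaussian_multipleN N t : gaussian_multiple N t -> gaussian_multiple N (- t).
Proof. by move=> [s hs ->]; exists (- s); rewrite ?mulrN //; exact: gaussianN. Qed.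

Lemma gaussian_multipleD N s t :
  gaussian_multiple N s -> gaussian_multiple N t -> gaussian_multiple N (s + t).
Proof. by move=> [a ha ->] [b hb ->]; exists (a + b); rewrite ?mulrDr //; exact: gaussianD. Qed.

Lemma natr_complex N : (N%:R : C) = (N%:R : R)%:C%C.
Proof. by rewrite rmorph_nat. Qed.

Lemma gaussian_residue N t : (0 < N)%N -> gaussian t ->
  exists i j : nat, [/\ (i < N)%N, (j < N)%N & gaussian_multiple N (t - Complex i%:R j%:R)].
Proof.
move=> N0 [a [b ->]]; have nz : (N : int) != 0 by rewrite eqz_nat -lt0n.
have residue (k : int) : exists2 i : nat, (i < N)%N & (k %% N)%Z = i.
  exists `|(k %% N)%Z|%N; last by rewrite gez0_abs // modz_ge0.
  by rewrite -ltz_nat gez0_abs ?modz_ge0 // ltz_pmod.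
have [i iN ei] := residue a; have [j jN ej] := residue b.
exists i, j; split=> //; exists (Complex (a %/ N)%Z%:~R (b %/ N)%Z%:~R).
  by exists (a %/ N)%Z, (b %/ N)%Z.
have quotient (k : int) (m : nat) :
    (k %% N)%Z = m -> (k%:~R : R) - m%:R = N%:R * ((k %/ N)%Z)%:~R.
  by move=> em; rewrite {1}(divz_eq k N) em rmorphD rmorphM /= addrK mulrC.
rewrite natr_complex; apply/eqP.
by rewrite eq_complex /= !mul0r subr0 addr0 !quotient // !eqxx.
Qed.

End GaussianIntegers.

Section Bloch.
Variable R : realType.
Local Notation C := (R[i]).
Implicit Types (f g : C -> C) (z w c l a : C) (r s t : R).

Lemma decrease_modulus f w l r : 0 < r -> is_cderive f w l -> l != 0 -> f w != 0 ->
  exists2 y, disc w r y & nc (f y) < nc (f w).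
Proof.
move=> r0 /is_cderiveP df l0 f0.
have nf : 0 < nc (f w) by rewrite nc_gt0.
have nl : 0 < nc l by rewrite nc_gt0.
have [e e0 small] := df (nc l / 2) ltac:(lra).
pose q := f w / l; have nq : 0 < nc q by rewrite nc_div divr_gt0.
have [min_l min_r] : Num.min r e <= r /\ Num.min r e <= e by rewrite !ge_min !lexx orbT.
have m0 : 0 < Num.min r e / (2 * nc q) by rewrite divr_gt0 ?mulr_gt0 // lt_min r0.
pose s := Num.min (1 / 2) (Num.min r e / (2 * nc q)).
have s0 : 0 < s by rewrite lt_min m0 andbT; lra.
have [s1 s2] : s <= 1 / 2 /\ s <= Num.min r e / (2 * nc q) by rewrite !ge_min !lexx orbT.
have sq : s * nc q <= Num.min r e / 2 by move: s2; rewrite ler_pdivlMr ?mulr_gt0 //; lra.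
have sq0 : 0 < s * nc q by rewrite mulr_gt0.
pose y := w - s%:C%C * q; have yw : y - w = - (s%:C%C * q) by rewrite /y addrC addKr.
have nyw : nc (y - w) = s * nc q by rewrite yw ncN ncM nc_real gtr0_norm.
exists y; first by rewrite /disc /= nyw; lra.
have := small y; rewrite /disc /= nyw => /(_ ltac:(lra)).
have -> : l * (y - w) = - (s%:C%C * f w) by rewrite yw /q; field.
have -> : nc l / 2 * (s * nc q) = s * nc (f w) / 2.
  by rewrite /q nc_div; field; rewrite gt_eqF.
have := ncD (f y - f w - - (s%:C%C * f w)) ((1 - s)%:C%C * f w).
have -> : f y - f w - - (s%:C%C * f w) + (1 - s)%:C%C * f w = f y.
  by rewrite rmorphB /=; ring.
rewrite ncM nc_real ger0_norm; last lra.
have : 0 < s * nc (f w) by rewrite mulr_gt0.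
lra.
Qed.

Lemma near_linear_covering f c r s a l : 0 < s -> s < r -> holomorphic (disc c r) f -> a != 0 ->
  (forall w, closed_disc c s w -> nc (cderive f w - a) <= nc a / 2) ->
  nc (l - f c) < nc a * s / 4 -> exists w, [/\ disc c s w, f w = l & cderive f w != 0].
Proof.
move=> s0 sr Hf a0 near_a lc; have na : 0 < nc a by rewrite nc_gt0.
have df w : closed_disc c s w -> is_cderive f w (cderive f w).
  by move=> ws; apply: (holomorphic_is_cderive Hf); exact: (le_lt_trans ws sr).
have cs : closed_disc c s c by rewrite /closed_disc /= subrr nc0 ltW.
have [||w ws wmin] := @compact_min _ _ (fun w => nc (f w - l)) _ (@closed_disc_compact R c s).
- by exists c.
- move=> w /df/is_cderive_continuous cf; apply: rcontinuous_nc.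
  exact: ccontinuousB cf (ccontinuous_cst _ _).
have dw : cderive f w != 0.
  rewrite -nc_gt0; have := near_a w ws; have := ncB_ge a (cderive f w).
  by rewrite (nc_distC a); lra.
have w_lt : disc c s w.
  rewrite /disc /= lt_neqAle ws andbT; apply/eqP => wE.
  have := almost_linear (@closed_disc_convex R c s) df near_a cs ws; rewrite wE => lin.
  have := ncB_ge (a * (w - c)) (f w - f c); rewrite (nc_distC (a * _)) ncM wE => far.
  have := ncB_ge (f w - f c) (l - f c); rewrite opprB addrA subrK => tri.
  by have := wmin c cs; rewrite (nc_distC (f c)); lra.
exists w; split=> //; apply/eqP; rewrite -subr_eq0; apply/negPn/negP => fl.
have [s' s'0 s'sub] := disc_open w_lt.
have [y /s'sub/ltW ys lt] := decrease_modulus s'0 (is_cderiveBc l (df w ws)) dw fl.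
by have := wmin y ys; lra.
Qed.

(* The point maximises (1 - |z|)|g'(z)| on the closed unit disc. *)
Lemma bloch_point g r : 1 < r -> holomorphic (disc 0 r) g -> cderive g 0 != 0 ->
  exists z0 t, [/\ 0 < t, disc z0 t `<=` disc 0 1,
    nc (cderive g 0) <= 2 * (nc (cderive g z0) * t) &
    forall w, disc z0 t w -> nc (cderive g w) <= 2 * nc (cderive g z0)].
Proof.
move=> r1 Hg g'0; have n0 : 0 < nc (cderive g 0) by rewrite nc_gt0.
have [||z0 z01 zmax] := @compact_max _ _ (fun z => nc (cderive g z) * (1 - nc z)) _
  (@closed_disc_compact R 0 1).
- by exists 0; rewrite /closed_disc /= subrr nc0.
- move=> z; rewrite /closed_disc /= subr0 => z1; apply: rcontinuousM.
    apply: rcontinuous_nc; apply: (holomorphic_continuous (holomorphic_cderive Hg)).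
    by rewrite disc0E; lra.
  apply: rcontinuousD; first exact: rcontinuous_cst.
  by apply: rcontinuousN; apply: (@rcontinuous_nc _ id); exact: ccontinuous_id.
have max0 : nc (cderive g 0) <= nc (cderive g z0) * (1 - nc z0).
  by have := zmax 0; rewrite /closed_disc /= subrr nc0 subr0 mulr1; apply; exact: ler01.
rewrite /closed_disc /= subr0 in z01.
have z0_lt : nc z0 < 1.
  rewrite lt_neqAle z01 andbT; apply: contraTneq max0 => ->.
  by rewrite subrr mulr0 -ltNge.
exists z0, ((1 - nc z0) / 2); split; first lra.
- by move=> w; rewrite disc0E /disc /=; have := ncB_ge w z0; lra.
- by lra.
move=> w; rewrite /disc /= => wt; have wz0 := ncB_ge w z0.
have := zmax w; rewrite /closed_disc /= subr0 => /(_ ltac:(lra)) wmax.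
have : nc (cderive g w) * ((1 - nc z0) / 2) <= nc (cderive g w) * (1 - nc w).
  by apply: ler_wpM2l; [exact: nc_ge0|lra].
move=> /le_trans/(_ wmax) le_w; have t0 : 0 < (1 - nc z0) / 2 by lra.
by rewrite -(ler_pM2r t0); lra.
Qed.

Lemma bloch g r : 1 < r -> holomorphic (disc 0 r) g -> cderive g 0 != 0 ->
  exists z0, forall l, nc (l - g z0) < nc (cderive g 0) / 48 ->
    exists w, [/\ disc 0 1 w, g w = l & cderive g w != 0].
Proof.
move=> r1 Hg g'0; have [z0 [t [t0 sub big bd]]] := bloch_point r1 Hg g'0.
have Ht : holomorphic (disc z0 t) g.
  by apply: holomorphic_sub Hg; apply: subset_trans sub _; apply: disc_mono; exact: ltW.
set a := cderive g z0 in big bd.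
have na : 0 < nc a.
  rewrite lt_def nc_ge0 andbT; apply: contraTneq big => ->.
  by rewrite mul0r mulr0 -ltNge nc_gt0.
exists z0 => l lz; have t6 : 0 < t / 6 by lra.
have t6t : t / 6 < t by lra.
have near_a w : closed_disc z0 (t / 6) w -> nc (cderive g w - a) <= nc a / 2.
  move=> wt; have wt' : disc z0 t w by exact: (le_lt_trans wt t6t).
  have bound y : disc z0 t y -> nc (cderive g y - a) <= 3 * nc a.
    by move=> yt; have := ncB (cderive g y) a; have := bd y yt; lra.
  have := schwarz_disc (holomorphic_cderive Ht) bound wt'.
  rewrite mulrAC ler_pdivlMr // => le_w.
  have : 3 * nc a * nc (w - z0) <= 3 * nc a * (t / 6) by rewrite ler_pM2l //; lra.
  by move=> /(le_trans le_w) le_t; rewrite -(ler_pM2r t0); lra.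
have a0 : a != 0 by rewrite -nc_gt0.
have [|w [wt gw dw]] := near_linear_covering t6 t6t Ht a0 near_a (l := l); first lra.
by exists w; split=> //; apply: sub; exact: disc_mono (ltW t6t) w wt.
Qed.

End Bloch.

Section Landau.
Variable R : realType.
Local Notation C := (R[i]).
Implicit Types (f G : C -> C) (z w c l : C) (L U V : set C) (r s : R).

(* G takes every value in L with even multiplicities only. *)
Definition even_over L G U := holomorphic U G /\
  forall l z, L l -> U z -> square_at (fun w => G w - l) z.

Lemma even_over_sub L G U V : V `<=` U -> even_over L G U -> even_over L G V.
Proof.
by move=> VU [HG ev]; split=> [|l z Ll /VU]; [exact: holomorphic_sub HG|exact: ev].
Qed.

Lemma even_over_comp L G f U V : copen U -> copen V -> holomorphic U f ->
  (forall z, U z -> V (f z)) -> even_over L G V -> even_over L (fun z => G (f z)) U.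
Proof.
move=> oU oV Hf UV [HG ev]; split; first exact: (holomorphic_comp oU oV UV Hf HG).
move=> l z Ll Uz; apply: (@square_at_comp _ U (fun w => G w - l) f) => //.
by apply: ev => //; exact: UV.
Qed.

Lemma even_over_avoid L G U : copen U -> holomorphic U G -> (forall z, U z -> ~ L (G z)) ->
  even_over L G U.
Proof.
move=> oU HG avoid; split=> // l z Ll Uz.
apply: (square_at_neq0 oU (holomorphicBc l oU HG) Uz).
by rewrite subr_eq0; apply: contra_notN (avoid z Uz) => /eqP ->.
Qed.

Lemma even_over_translate G t U : copen U -> gaussian t -> even_over (@gaussian R) G U ->
  even_over (@gaussian R) (fun z => G z + t) U.
Proof.
move=> oU ht [HG ev]; split.
  by apply: holomorphicD => //; exact: holomorphic_cst.
move=> l z hl Uz; apply: square_at_eq (ev _ z (gaussianB hl ht) Uz) => w; ring.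
Qed.

Lemma even_over_critical L G U z : even_over L G U -> U z -> L (G z) -> cderive G z = 0.
Proof.
move=> [HG ev] Uz Lz.
have d0 := square_at_zero_critical (ev _ z Lz Uz) (subrr _).
exact: is_cderive_uniq (is_cderiveBc _ (holomorphic_is_cderive HG Uz)) d0.
Qed.

Lemma landau G c r : 0 < r -> even_over (@gaussian R) G (disc c r) ->
  nc (cderive G c) <= 48 / r.
Proof.
move=> r0 evG; have [HG _] := evG; rewrite ler_pdivlMr //.
apply: (ler_mul_left_limit (nc_ge0 _) r0) => s s0 sr; rewrite leNgt; apply/negP => big.
pose f z := c + s%:C%C * z; pose g z := G (f z); pose U := disc (0 : C) (r / s).
have oU : copen U by exact: disc_open.
have r1 : 1 < r / s by rewrite ltr_pdivlMr // mul1r.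
have fU z : U z -> disc c r (f z).
  rewrite /U disc0E /f /disc /= [c + _]addrC addrK ncM nc_real gtr0_norm //.
  by rewrite ltr_pdivlMr // mulrC.
have Hf : holomorphic U f by exact: holomorphic_affine.
have evg := even_over_comp oU (@disc_open R c r) Hf fU evG.
have U0 : U 0 by apply: disc_center; lra.
have g'0 : cderive g 0 = cderive G c * s%:C%C.
  apply: cderiveE; apply: (@is_cderive_comp _ f G).
    apply: is_cderive_eq (is_cderiveD (is_cderive_cst c 0) (is_cderive_mulc _ 0)) _.
    by rewrite add0r.
  by rewrite /f mulr0 addr0; apply: (holomorphic_is_cderive HG); exact: disc_center.
have n0 : nc (cderive g 0) = nc (cderive G c) * s by rewrite g'0 ncM nc_real gtr0_norm.
have [|z0 cover] := bloch r1 evg.1; first by rewrite -nc_gt0 n0; lra.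
have [l hl lz] := nearest_gaussian (g z0).
have [|w [w1 gw dw]] := cover l; first by rewrite nc_distC n0; lra.
have Uw : U w by exact: disc_mono (ltW r1) w w1.
by move/eqP: dw; apply; apply: (even_over_critical evg Uw); move: hl; rewrite -gw.
Qed.

Lemma landau_growth G r s z : s < r -> even_over (@gaussian R) G (disc 0 r) ->
  nc z <= s -> nc (G z - G 0) <= 48 / (r - s) * nc z.
Proof.
move=> sr ev zs; have [HG _] := ev; have s0 : 0 <= s by apply: le_trans (nc_ge0 z) zs.
have sub w : closed_disc 0 s w -> nc w <= s by rewrite /closed_disc /= subr0.
rewrite -[X in _ * nc X]subr0.
apply: (mean_value (@closed_disc_convex R 0 s) (f' := cderive G)).
- by move=> w /sub ws; apply: (holomorphic_is_cderive HG); rewrite disc0E; lra.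
- move=> w /sub ws; apply: landau; first lra.
  apply: even_over_sub ev => y; rewrite disc0E /disc /=.
  by have := ncB_ge y w; lra.
- by rewrite /closed_disc /= subrr nc0.
- by rewrite /closed_disc /= subr0.
Qed.

End Landau.

(** * Towers of double covers of the disc *)

Section Blaschke.
Variable R : realType.
Local Notation C := (R[i]).
Implicit Types (a b c x y z w : C) (f g : C -> C).

Definition unit_disc : set C := disc 0 1.

Lemma unit_discE z : unit_disc z = (nc z < 1) :> Prop.
Proof. exact: disc0E. Qed.

Lemma unit_disc0 : unit_disc 0.
Proof. by rewrite unit_discE nc0. Qed.

Lemma unit_disc_open : copen unit_disc.
Proof. exact: disc_open. Qed.

Lemma unit_disc_convex : is_convex unit_disc.
Proof. exact: disc_convex. Qed.

Definition blaschke a z : C := (z - a) / (1 - cconj a * z).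

Lemma cconjK a : cconj (cconj a) = a.
Proof. exact: conjcK. Qed.

Lemma cconj_real (r : R) : cconj (r%:C%C : C) = r%:C%C.
Proof. exact: conjc_real. Qed.

Lemma cconj_nat n : cconj (n%:R : C) = n%:R.
Proof. by rewrite /cconj rmorph_nat. Qed.

Lemma cconjN a : cconj (- a) = - cconj a.
Proof. by rewrite /cconj rmorphN. Qed.

Lemma cconjD a b : cconj (a + b) = cconj a + cconj b.
Proof. by rewrite /cconj rmorphD. Qed.

Lemma cconjB a b : cconj (a - b) = cconj a - cconj b.
Proof. by rewrite /cconj rmorphB. Qed.

Lemma cconjM a b : cconj (a * b) = cconj a * cconj b.
Proof. by rewrite /cconj rmorphM. Qed.

Lemma cconjV a : cconj a^-1 = (cconj a)^-1.
Proof. by rewrite /cconj fmorphV. Qed.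

Lemma cconj_den a z : cconj (1 - cconj a * z) = 1 - a * cconj z.
Proof. by rewrite cconjB (cconj_nat 1) cconjM cconjK. Qed.

Lemma blaschke_identity a z :
  nc (1 - cconj a * z) ^+ 2 - nc (z - a) ^+ 2 = (1 - nc a ^+ 2) * (1 - nc z ^+ 2).
Proof. by rewrite !nc_sqr; case: a => a1 a2; case: z => z1 z2 /=; ring. Qed.

Lemma nc_sqr_lt1 z : nc z < 1 -> nc z ^+ 2 < 1.
Proof. by move=> z1; have := nc_ge0 z; nra. Qed.

Lemma blaschke_den_neq0 a z : nc a < 1 -> nc z < 1 -> 1 - cconj a * z != 0.
Proof.
move=> a1 z1; rewrite -nc_gt0; have := ncB_ge 1 (cconj a * z).
rewrite nc1 ncM nc_conj; have := nc_ge0 a; have := nc_ge0 z => z0 a0.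
have : nc a * nc z < 1 by apply: le_lt_trans a1; rewrite ler_piMr // ltW.
lra.
Qed.

Lemma blaschke_den_self_neq0 a : nc a < 1 -> 1 - a * cconj a != 0.
Proof. by move=> a1; rewrite mulrC blaschke_den_neq0. Qed.

Lemma nc_blaschke_den_self a : nc a < 1 -> nc (1 - a * cconj a) = 1 - nc a ^+ 2.
Proof.
move=> /nc_sqr_lt1 a1; rewrite mul_cconj -(rmorphB (real_complex R) 1) nc_real ger0_norm //.
by rewrite subr_ge0 ltW.
Qed.

Lemma one_sub_blaschke a z : nc a < 1 -> nc z < 1 ->
  1 - nc (blaschke a z) ^+ 2 =
  (1 - nc a ^+ 2) * (1 - nc z ^+ 2) / nc (1 - cconj a * z) ^+ 2.
Proof.
move=> a1 z1; rewrite -blaschke_identity nc_div expr_div_n mulrBl divff //.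
by rewrite expf_neq0 // nc_eq0 blaschke_den_neq0.
Qed.

Lemma blaschke_lt1 a z : nc a < 1 -> nc z < 1 -> nc (blaschke a z) < 1.
Proof.
move=> a1 z1; rewrite -(@ltr_pXn2r _ 2) ?nnegrE ?nc_ge0 // expr1n -subr_gt0 one_sub_blaschke //.
apply: divr_gt0; first by apply: mulr_gt0; rewrite subr_gt0 nc_sqr_lt1.
by apply: exprn_gt0; rewrite nc_gt0 blaschke_den_neq0.
Qed.

Lemma blaschke_self a : blaschke a a = 0.
Proof. by rewrite /blaschke subrr mul0r. Qed.

Lemma blaschke_0 a : blaschke a 0 = - a.
Proof. by rewrite /blaschke mulr0 subr0 sub0r divr1. Qed.

Lemma blaschkeK a z : nc a < 1 -> nc z < 1 -> blaschke (- a) (blaschke a z) = z.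
Proof.
move=> a1 z1; have den := blaschke_den_neq0 a1 z1; have den_self := blaschke_den_self_neq0 a1.
rewrite /blaschke cconjN; move: (cconj a) den den_self => k den den_self; field; rewrite den /=.
by have -> : 1 - k * z - - k * (z - a) = 1 - a * k by ring.
Qed.

Lemma blaschkeNK a z : nc a < 1 -> nc z < 1 -> blaschke a (blaschke (- a) z) = z.
Proof. by move=> a1 z1; rewrite -{1}(opprK a) blaschkeK // ncN. Qed.

Definition blaschke_slope a y x : C :=
  (1 - a * cconj a) / ((1 - cconj a * x) * (1 - cconj a * y)).

Lemma blaschkeB a x y : nc a < 1 -> nc x < 1 -> nc y < 1 ->
  blaschke a x - blaschke a y = (x - y) * blaschke_slope a y x.
Proof.
move=> a1 x1 y1; have := blaschke_den_neq0 a1 x1; have := blaschke_den_neq0 a1 y1.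
by rewrite /blaschke /blaschke_slope; move: (cconj a) => k dy dx; field; rewrite dx dy.
Qed.

Lemma blaschke_slope_neq0 a y x : nc a < 1 -> nc y < 1 -> nc x < 1 -> blaschke_slope a y x != 0.
Proof.
move=> a1 y1 x1; rewrite mulf_neq0 ?blaschke_den_self_neq0 // invr_neq0 // mulf_neq0 //;
by rewrite blaschke_den_neq0.
Qed.

Lemma holomorphic_blaschke_den a : holomorphic unit_disc (fun z => 1 - cconj a * z).
Proof.
have oD := unit_disc_open; apply: holomorphicB => //; first exact: holomorphic_cst.
by apply: holomorphicZ => //; exact: holomorphic_id.
Qed.

Lemma holomorphic_blaschke a : nc a < 1 -> holomorphic unit_disc (blaschke a).
Proof.
move=> a1; apply: (holomorphic_div unit_disc_open) (holomorphic_blaschke_den a).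
- by move=> z; rewrite unit_discE; exact: blaschke_den_neq0.
- exact: holomorphic_subc unit_disc_open.
Qed.

Lemma holomorphic_blaschke_slope a y : nc a < 1 -> nc y < 1 ->
  holomorphic unit_disc (blaschke_slope a y).
Proof.
move=> a1 y1; have oD := unit_disc_open; apply: holomorphic_div => //.
- by move=> z; rewrite unit_discE => z1; rewrite mulf_neq0 // blaschke_den_neq0.
- exact: holomorphic_cst.
- apply: holomorphicM => //; [exact: holomorphic_blaschke_den|exact: holomorphic_cst].
Qed.

Lemma is_cderive_blaschke a z : nc a < 1 -> nc z < 1 ->
  is_cderive (blaschke a) z (blaschke_slope a z z).
Proof.
move=> a1 z1; have den := blaschke_den_neq0 a1 z1.
have num' := is_cderiveBc a (is_cderive_id z).
have den' := is_cderiveB (is_cderive_cst 1 z) (is_cderive_mulc (cconj a) z).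
apply: is_cderive_eq (is_cderiveM num' (is_cderiveV (f := fun w => 1 - cconj a * w) den den')) _.
by rewrite /blaschke_slope; move: (cconj a) den => k den; field.
Qed.

Definition selfmap f := holomorphic unit_disc f /\ forall z, unit_disc z -> unit_disc (f z).

Lemma selfmap_comp f g : selfmap f -> selfmap g -> selfmap (fun z => f (g z)).
Proof.
move=> [Hf fD] [Hg gD]; split=> [|z /gD /fD //].
exact: (holomorphic_comp unit_disc_open unit_disc_open gD Hg Hf).
Qed.

Lemma selfmap_blaschke a : nc a < 1 -> selfmap (blaschke a).
Proof.
by move=> a1; split=> [|z]; [exact: holomorphic_blaschke|rewrite !unit_discE; exact: blaschke_lt1].
Qed.

Lemma selfmap_id : selfmap id.
Proof. by split=> //; apply: holomorphic_id; exact: unit_disc_open. Qed.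

Lemma selfmap_schwarz f z : selfmap f -> f 0 = 0 -> nc z < 1 -> nc (f z) <= nc z.
Proof.
move=> [Hf fD] f0 z1.
have := @schwarz_disc _ f 0 1 1 z Hf; rewrite f0 !subr0 divr1 mul1r; apply.
  by move=> w /fD; rewrite unit_discE subr0; exact: ltW.
by rewrite disc0E.
Qed.

Lemma selfmap_cderive0 f : selfmap f -> f 0 = 0 -> nc (cderive f 0) <= 1.
Proof.
move=> sf f0; apply: (is_cderive_le ltr01); first exact: (holomorphic_is_cderive sf.1 unit_disc0).
by move=> w; rewrite disc0E f0 !subr0 mul1r => w1; exact: selfmap_schwarz.
Qed.

End Blaschke.

Section DoubleCover.
Variable R : realType.
Local Notation C := (R[i]).
Implicit Types (b x y z : C) (phi : C -> C) (B : set C).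
Local Notation D := (@unit_disc R).

Definition cover_root b : C := sqrtc (- b).

Definition cover_chart b : C -> C := blaschke (- cover_root b).

(* The two-sheeted branched covering of the disc by itself with critical value b that fixes 0. *)
Definition double_cover b z : C := blaschke (- b) (cover_chart b z ^+ 2).

Definition double_cover_slope b y x : C := blaschke_slope (- cover_root b) y x *
  (cover_chart b x + cover_chart b y) *
  blaschke_slope (- b) (cover_chart b y ^+ 2) (cover_chart b x ^+ 2).

Lemma cover_root_sqr b : cover_root b ^+ 2 = - b.
Proof. exact: sqr_sqrtc. Qed.

Lemma nc_cover_root_sqr b : nc (cover_root b) ^+ 2 = nc b.
Proof. by rewrite -ncX cover_root_sqr ncN. Qed.

Lemma nc_cover_root b : nc b < 1 -> nc (- cover_root b) < 1.
Proof.
move=> b1; rewrite ncN ltNge; apply/negP => ge1.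
by have := nc_cover_root_sqr b; nra.
Qed.

Lemma selfmap_cover_chart b : nc b < 1 -> selfmap (cover_chart b).
Proof. by move=> b1; apply: selfmap_blaschke; exact: nc_cover_root. Qed.

Lemma cover_chart_sqr_lt1 b z : nc b < 1 -> nc z < 1 -> nc (cover_chart b z ^+ 2) < 1.
Proof. by move=> b1 z1; rewrite ncX nc_sqr_lt1 // blaschke_lt1 // nc_cover_root. Qed.

Lemma selfmap_cover_chart_sqr b : nc b < 1 -> selfmap (fun z => cover_chart b z ^+ 2).
Proof.
move=> b1; split=> [|z]; last by rewrite !unit_discE; exact: cover_chart_sqr_lt1.
by apply: holomorphicX; [exact: unit_disc_open|exact: (selfmap_cover_chart b1).1].
Qed.

Lemma selfmap_double_cover b : nc b < 1 -> selfmap (double_cover b).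
Proof.
move=> b1; apply: (@selfmap_comp _ (blaschke (- b)) _ _ (selfmap_cover_chart_sqr b1)).
by apply: selfmap_blaschke; rewrite ncN.
Qed.

Lemma cover_chart_0 b : cover_chart b 0 = cover_root b.
Proof. by rewrite /cover_chart blaschke_0 opprK. Qed.

Lemma double_cover_0 b : double_cover b 0 = 0.
Proof. by rewrite /double_cover cover_chart_0 cover_root_sqr blaschke_self. Qed.

Lemma double_coverB_sqr b y x : nc b < 1 -> nc y < 1 -> nc x < 1 ->
  double_cover b x - double_cover b y = (cover_chart b x ^+ 2 - cover_chart b y ^+ 2) *
    blaschke_slope (- b) (cover_chart b y ^+ 2) (cover_chart b x ^+ 2).
Proof. by move=> b1 y1 x1; rewrite blaschkeB ?cover_chart_sqr_lt1 ?ncN. Qed.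

Lemma double_coverB b y x : nc b < 1 -> nc y < 1 -> nc x < 1 ->
  double_cover b x - double_cover b y = (x - y) * double_cover_slope b y x.
Proof.
move=> b1 y1 x1; rewrite double_coverB_sqr // subr_sqr blaschkeB ?nc_cover_root //.
by rewrite /double_cover_slope !mulrA.
Qed.

Lemma holomorphic_double_cover_unit b y : nc b < 1 -> nc y < 1 ->
  holomorphic D (fun x => blaschke_slope (- b) (cover_chart b y ^+ 2) (cover_chart b x ^+ 2)).
Proof.
move=> b1 y1; have oD := @unit_disc_open R; have [Hsqr sqrD] := selfmap_cover_chart_sqr b1.
apply: (holomorphic_comp oD oD sqrD Hsqr); apply: holomorphic_blaschke_slope.
  by rewrite ncN.
exact: cover_chart_sqr_lt1.
Qed.

Lemma holomorphic_double_cover_slope b y : nc b < 1 -> nc y < 1 ->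
  holomorphic D (double_cover_slope b y).
Proof.
move=> b1 y1; have oD := @unit_disc_open R.
apply: holomorphicM (holomorphic_double_cover_unit b1 y1) => //.
apply: holomorphicM => //; first by apply: holomorphic_blaschke_slope => //; exact: nc_cover_root.
by apply: holomorphicD => //; [exact: (selfmap_cover_chart b1).1|exact: holomorphic_cst].
Qed.

Lemma cover_chart_critical b y : nc b < 1 -> nc y < 1 ->
  (cover_chart b y == 0) = (double_cover b y == b).
Proof.
move=> b1 y1; apply/eqP/eqP => [E|E].
  by rewrite /double_cover E expr0n /= blaschke_0 opprK.
apply/eqP; rewrite -sqrf_eq0 -(@blaschkeNK _ b (cover_chart b y ^+ 2)) ?cover_chart_sqr_lt1 //.
by rewrite -/(double_cover b y) E blaschke_self.
Qed.

Lemma double_cover_slope_neq0 b y : nc b < 1 -> nc y < 1 -> double_cover b y != b ->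
  double_cover_slope b y y != 0.
Proof.
move=> b1 y1; rewrite -cover_chart_critical // => chart_y.
apply: mulf_neq0; last by rewrite blaschke_slope_neq0 ?ncN ?cover_chart_sqr_lt1.
apply: mulf_neq0; first by rewrite blaschke_slope_neq0 // nc_cover_root.
by rewrite -mulr2n mulrn_eq0.
Qed.

Lemma is_cderive_double_cover b : nc b < 1 ->
  is_cderive (double_cover b) 0 (double_cover_slope b 0 0).
Proof.
move=> b1; have D0 : nc (0 : C) < 1 by rewrite nc0.
have chart' : is_cderive (cover_chart b) 0 (blaschke_slope (- cover_root b) 0 0).
  by apply: is_cderive_blaschke => //; exact: nc_cover_root.
have b1N : nc (- b) < 1 by rewrite ncN.
have outer' := is_cderive_blaschke b1N (cover_chart_sqr_lt1 b1 D0).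
apply: is_cderive_eq (is_cderive_comp (is_cderiveX 2 chart') outer') _.
rewrite /double_cover_slope /=; ring.
Qed.

Lemma nc_cderive_double_cover b : nc b < 1 ->
  nc (cderive (double_cover b) 0) * (1 + nc b) = 2 * nc (cover_root b).
Proof.
move=> b1; have root1 : nc (cover_root b) < 1 by rewrite -ncN nc_cover_root.
rewrite (cderiveE (is_cderive_double_cover b1)) /double_cover_slope cover_chart_0 cover_root_sqr.
rewrite /blaschke_slope !cconjN !mulrNN !mulr0 subr0 mul1r divr1 [cconj b * b]mulrC.
rewrite -mulr2n -(mulr_natl (cover_root b)) !ncM ncV ncM nc_nat.
rewrite !nc_blaschke_den_self // nc_cover_root_sqr.
by field; have := nc_sqr_lt1 b1; have := nc_ge0 b => *; rewrite !gt_eqF //; nra.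
Qed.

Lemma nc_cderive_double_cover_le b (r : R) : nc b <= r -> r < 1 ->
  nc (cderive (double_cover b) 0) <= 1 - (1 - Num.sqrt r) ^+ 2 / 2.
Proof.
move=> br r1; have b1 : nc b < 1 by lra.
have := nc_cderive_double_cover b1; rewrite -(nc_cover_root_sqr b); set t := nc (cover_root b).
have t0 : 0 <= t by exact: nc_ge0.
have ts : t <= Num.sqrt r.
  rewrite -(@ler_pXn2r _ 2) ?nnegrE ?sqrtr_ge0 // sqr_sqrtr ?nc_cover_root_sqr //.
  by apply: le_trans br; exact: nc_ge0.
have s1 : Num.sqrt r < 1 by rewrite -[X in _ < X]sqrtr1 ltr_sqrt.
set s := Num.sqrt r in ts s1 *; set d := nc _ => E.
have t2 : 0 < 1 + t ^+ 2 by have := sqr_ge0 t; lra.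
have contraction : (1 - s) ^+ 2 * (1 + t ^+ 2) <= (1 - t) ^+ 2 * 2.
  by apply: ler_pM; rewrite ?sqr_ge0 ?(ltW t2) //; nra.
by rewrite -(ler_pM2r t2) E; lra.
Qed.

Lemma double_cover_root b phi : nc b < 1 -> selfmap phi -> phi 0 = 0 ->
  (forall z, D z -> square_at (fun w => phi w - b) z) ->
  exists psi, [/\ selfmap psi, psi 0 = 0 & forall z, D z -> phi z = double_cover b (psi z)].
Proof.
move=> b1 sphi phi0 sq; have oD := @unit_disc_open R.
have phi1 z : D z -> nc (phi z) < 1 by move=> /sphi.2; rewrite unit_discE.
pose X z := blaschke b (phi z).
have HX : holomorphic D X := (selfmap_comp (selfmap_blaschke b1) sphi).1.
have sqX z : D z -> square_at X z.
  move=> Dz; apply: (square_atM (sq z Dz)).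
  have den w : D w -> 1 - cconj b * phi w != 0 by move=> /phi1; exact: blaschke_den_neq0.
  apply: (@square_at_neq0 _ D) => //; last by rewrite invr_neq0 // den.
  apply: holomorphicV => //.
  exact: (holomorphic_comp oD oD sphi.2 sphi.1 (holomorphic_blaschke_den b)).
have [h Hh [hE h_at0]] : exists2 h, holomorphic D h &
    (forall z, D z -> h z ^+ 2 = X z) /\ h 0 = cover_root b.
  apply: square_on_through => //; first exact: unit_disc0; last exact: square_on_disc.
  by rewrite /X phi0 blaschke_0 cover_root_sqr.
have h_lt1 z : D z -> nc (h z) < 1.
  move=> Dz; rewrite ltNge; apply/negP => ge1.
  have : nc (h z ^+ 2) < 1 by rewrite hE // blaschke_lt1 // phi1.
  by rewrite ncX; nra.
have root1 : nc (cover_root b) < 1 by rewrite -ncN nc_cover_root.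
exists (fun z => blaschke (cover_root b) (h z)); split.
- apply: (selfmap_comp (selfmap_blaschke root1)); split=> // z /h_lt1.
  by rewrite unit_discE.
- by rewrite h_at0 blaschke_self.
- move=> z Dz; rewrite /double_cover /cover_chart blaschkeK ?h_lt1 // hE // blaschkeK //.
  exact: phi1.
Qed.

Definition next_branch b B : set C :=
  [set y | [/\ nc y < 1, B (double_cover b y) & double_cover b y != b]].

Lemma even_over_double_cover_lift b B phi psi : nc b < 1 -> even_over B phi D -> selfmap psi ->
  (forall z, D z -> phi z = double_cover b (psi z)) -> even_over (next_branch b B) psi D.
Proof.
move=> b1 [_ ev] [Hpsi psiD] phiE; have oD := @unit_disc_open R.
split=> // y z [y1 By noncritical] Dz.
have [e|ne] := eqVneq (psi z) y; last first.
  by apply: (square_at_neq0 oD (holomorphicBc y oD Hpsi) Dz); rewrite subr_eq0.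
apply: (@square_at_divr _ D _ (fun w => double_cover_slope b y (psi w))) => //.
- exact: (holomorphic_comp oD oD psiD Hpsi (holomorphic_double_cover_slope b1 y1)).
- by rewrite e double_cover_slope_neq0.
have [r r0 rD] := oD z Dz; apply: (square_at_near r0 _ (ev _ z By Dz)) => w /rD Dw.
by rewrite phiE // double_coverB // -unit_discE; exact: psiD.
Qed.

Lemma double_cover_lift b B phi : nc b < 1 -> B b -> even_over B phi D -> selfmap phi ->
  phi 0 = 0 -> exists psi, [/\ even_over (next_branch b B) psi D, selfmap psi, psi 0 = 0 &
    forall z, D z -> phi z = double_cover b (psi z)].
Proof.
move=> b1 Bb ev sphi phi0.
have [psi [spsi psi0 phiE]] := double_cover_root b1 sphi phi0 (fun z => ev.2 b z Bb).
by exists psi; split=> //; exact: even_over_double_cover_lift phiE.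
Qed.

End DoubleCover.

Section Tower.
Variable R : realType.
Local Notation C := (R[i]).
Implicit Types (b l x y z w : C) (F G phi X Y : C -> C) (L B : set C) (r s : R).
Local Notation D := (@unit_disc R).

Definition odd_at X x := exists2 Y, square_at Y x &
  exists2 d : R, 0 < d & forall w, disc x d w -> X w = (w - x) * Y w.

(* F is a finite tower of two-sheeted coverings; B is the set of points where the values in L
   are still taken with odd multiplicity. *)
Record tower L F B := Tower {
  tower_selfmap : selfmap F;
  tower_fix0 : F 0 = 0;
  tower_multiplicity : forall l x, L l -> D x ->
     square_at (fun w => F w - l) x \/ (B x /\ odd_at (fun w => F w - l) x);
  tower_branch : forall b, B b -> b != 0 /\ nc b < 1;
  tower_lift : forall G, even_over L G D -> selfmap G -> G 0 = 0 ->
    exists phi, [/\ even_over B phi D, selfmap phi, phi 0 = 0 &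
                    forall z, D z -> G z = F (phi z)] }.

Lemma tower_id L : (forall b, L b -> b != 0 /\ nc b < 1) -> tower L id L.
Proof.
move=> hL; have oD := @unit_disc_open R; split=> //; first exact: selfmap_id.
  move=> l x Ll Dx; have [->|ne] := eqVneq x l.
    right; split=> //; exists (fun=> 1); first exact: square_at_cst.
    by exists 1 => // w _; rewrite mulr1.
  by left; apply: (square_at_neq0 oD (holomorphic_subc l oD) Dx); rewrite subr_eq0.
by move=> G eG sG G0; exists G.
Qed.

Lemma odd_at_double_cover X b x : nc b < 1 -> D x -> odd_at X (double_cover b x) ->
  if double_cover b x == b then square_at (fun w => X (double_cover b w)) x
  else odd_at (fun w => X (double_cover b w)) x.
Proof.
move=> b1 Dx [Y sqY [d d0 XE]]; have oD := @unit_disc_open R.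
have x1 : nc x < 1 by rewrite -unit_discE.
have [Hdc _] := selfmap_double_cover b1.
have sqYdc : square_at (fun w => Y (double_cover b w)) x by exact: (square_at_comp oD Hdc Dx sqY).
have [r1 r10 near_d] := holomorphic_continuous Hdc Dx d0; have [r2 r20 r2D] := oD x Dx.
have r0 : 0 < Num.min r1 r2 by rewrite lt_min r10.
have XdcE w : disc x (Num.min r1 r2) w -> nc w < 1 /\ X (double_cover b w) =
    (double_cover b w - double_cover b x) * Y (double_cover b w).
  rewrite /disc /= lt_min => /andP[w1 w2]; split; first by rewrite -unit_discE; exact: r2D.
  by rewrite XE //; exact: near_d.
case: ifPn => [critical|noncritical].
  have chart0 : cover_chart b x = 0 by apply/eqP; rewrite cover_chart_critical.
  pose u w := blaschke_slope (- b) (cover_chart b x ^+ 2) (cover_chart b w ^+ 2).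
  have squ : square_at u x.
    apply: (square_at_neq0 oD (holomorphic_double_cover_unit b1 x1) Dx).
    by rewrite blaschke_slope_neq0 ?ncN ?cover_chart_sqr_lt1.
  have sqN := square_at_sqr oD (selfmap_cover_chart b1).1 Dx.
  apply: (square_at_near r0 _ (square_atM (square_atM sqN squ) sqYdc)) => w /XdcE[w1 ->].
  by rewrite double_coverB_sqr // chart0 expr0n subr0 /u chart0 expr0n.
exists (fun w => double_cover_slope b x w * Y (double_cover b w)).
  apply: square_atM => //.
  apply: (square_at_neq0 oD (holomorphic_double_cover_slope b1 x1) Dx).
  exact: double_cover_slope_neq0.
by exists (Num.min r1 r2) => // w /XdcE[w1 ->]; rewrite (double_coverB b1 x1) // mulrA.
Qed.

Lemma tower_step L F B b : tower L F B -> B b ->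
  tower L (fun z => F (double_cover b z)) (next_branch b B).
Proof.
move=> tw Bb; have oD := @unit_disc_open R; have [b0 b1] := tower_branch tw Bb.
have [Hdc dcD] := selfmap_double_cover b1.
split.
- exact: selfmap_comp (tower_selfmap tw) (selfmap_double_cover b1).
- by rewrite double_cover_0 (tower_fix0 tw).
- move=> l x Ll Dx.
  have [sq|[Bx /(odd_at_double_cover b1 Dx)]] := tower_multiplicity tw Ll (dcD x Dx).
    by left; exact: (square_at_comp oD Hdc Dx sq).
  by case: ifPn => [_ sq|ne odd]; [left|right; split=> //; split=> //; rewrite -unit_discE].
- move=> y [y1 By _]; split=> //; apply: contraTneq (tower_branch tw By).1 => ->.
  by rewrite double_cover_0 eqxx.
- move=> G eG sG G0; have [phi [ephi sphi phi0 GE]] := tower_lift tw eG sG G0.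
  have [psi [epsi spsi psi0 phiE]] := double_cover_lift b1 Bb ephi sphi phi0.
  by exists psi; split=> // z Dz; rewrite GE // phiE.
Qed.

(* Lifting z |-> r z, which avoids L, through the tower bounds the derivative from below. *)
Lemma tower_cderive_ge L F B r : 0 < r -> r < 1 -> (forall l, L l -> r <= nc l) ->
  tower L F B -> r <= nc (cderive F 0).
Proof.
move=> r0 r1 Lr tw; have oD := @unit_disc_open R; have D0 := @unit_disc0 R.
pose G z : C := r%:C%C * z.
have Gr z : D z -> nc (G z) < r.
  by rewrite unit_discE ncM nc_real gtr0_norm // => z1; rewrite -ltr_pdivlMl // mulVf ?gt_eqF.
have HG : holomorphic D G by apply: holomorphicZ => //; exact: holomorphic_id.
have eG : even_over L G D.
  by apply: even_over_avoid => // z /Gr Gz /Lr; rewrite leNgt Gz.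
have sG : selfmap G by split=> // z /Gr; rewrite unit_discE; lra.
have [phi [_ sphi phi0 GE]] := tower_lift tw eG sG ltac:(by rewrite /G mulr0).
have G' : r%:C%C = cderive F 0 * cderive phi 0.
  have lifted : is_cderive (fun z => F (phi z)) 0 (cderive F 0 * cderive phi 0).
    apply: is_cderive_comp; first exact: (holomorphic_is_cderive sphi.1 D0).
    by rewrite phi0; exact: (holomorphic_is_cderive (tower_selfmap tw).1 D0).
  by apply: (is_cderive_uniq _ lifted); apply: is_cderive_near ltr01 GE _; exact: is_cderive_mulc.
have <- : nc (r%:C%C : C) = r by rewrite nc_real gtr0_norm.
by rewrite G' ncM ler_piMr ?nc_ge0 // selfmap_cderive0.
Qed.

Lemma tower_cderive_step L F B b s : tower L F B -> B b -> nc b <= s -> s < 1 ->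
  nc (cderive (fun z => F (double_cover b z)) 0) <=
  nc (cderive F 0) * (1 - (1 - Num.sqrt s) ^+ 2 / 2).
Proof.
move=> tw Bb bs s1; have [_ b1] := tower_branch tw Bb; have D0 := @unit_disc0 R.
have composed : is_cderive (fun z => F (double_cover b z)) 0
    (cderive F 0 * cderive (double_cover b) 0).
  apply: is_cderive_comp; first exact: (holomorphic_is_cderive (selfmap_double_cover b1).1 D0).
  by rewrite double_cover_0; exact: (holomorphic_is_cderive (tower_selfmap tw).1 D0).
rewrite (cderiveE composed) ncM; apply: ler_wpM2l; first exact: nc_ge0.
exact: nc_cderive_double_cover_le.
Qed.

Lemma tower_exists L r s : 0 < r -> r < 1 -> 0 < s -> s < 1 ->
  (forall l, L l -> r <= nc l /\ nc l < 1) ->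
  exists F B, tower L F B /\ forall b, B b -> s < nc b.
Proof.
move=> r0 r1 s0 s1 hL; apply: contrapT => none.
pose q := 1 - (1 - Num.sqrt s) ^+ 2 / 2.
have [sq0 sq1] : 0 <= Num.sqrt s /\ Num.sqrt s < 1.
  by rewrite sqrtr_ge0 -[X in _ < X]sqrtr1 ltr_sqrt.
have [q0 q1] : 0 <= q /\ q < 1 by rewrite /q; split; nra.
have towers (k : nat) : exists F B, tower L F B /\ nc (cderive F 0) <= q ^+ k.
  elim: k => [|k [F [B [tw dF]]]].
    exists id, L; split; last by rewrite expr0 (cderiveE (is_cderive_id 0)) nc1.
    by apply: tower_id => b /hL[rb b1]; split=> //; rewrite -nc_gt0; lra.
  have [b Bb bs] : exists2 b, B b & nc b <= s.
    apply: contrapT => nb; apply: none; exists F, B; split=> // b Bb.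
    by rewrite ltNge; apply/negP => sb; apply: nb; exists b.
  exists (fun z => F (double_cover b z)), (next_branch b B); split; first exact: tower_step.
  apply: le_trans (tower_cderive_step tw Bb bs s1) _.
  by rewrite -/q exprSr ler_wpM2r.
have [k qk] := exprn_small q0 q1 r0; have [F [B [tw dF]]] := towers k.
have := tower_cderive_ge r0 r1 (fun l Ll => (hL l Ll).1) tw; lra.
Qed.

End Tower.

(** * The universal branched covering *)

Section RescaledTower.
Variable R : realType.
Local Notation C := (R[i]).
Local Notation D := (@unit_disc R).
Local Notation lattice := (@gaussian R).
Variables (w0 : C) (s : R).
Hypothesis s1 : 1 < s.
Implicit Types (z w l x : C) (F G : C -> C) (B : set C).

Definition scaled_gaussian : set C := [set x | nc x < 1 /\ gaussian (w0 + s%:C%C * x)].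

Let s0 : 0 < s. Proof. by apply: lt_trans s1; rewrite ltr01. Qed.

Let sC0 : s%:C%C != 0 :> C. Proof. by rewrite -nc_gt0 nc_real gtr0_norm. Qed.

Let nc_s : nc (s%:C%C : C) = s. Proof. by rewrite nc_real gtr0_norm. Qed.

Lemma scaled_gaussian_far (d : R) x : (forall l, gaussian l -> d <= nc (l - w0)) ->
  scaled_gaussian x -> d / s <= nc x.
Proof.
move=> far [_ /far]; rewrite [w0 + _]addrC addrK ncM nc_s => dx.
by rewrite ler_pdivrMr // mulrC.
Qed.

Lemma even_over_rescaled F B : tower scaled_gaussian F B ->
  (forall b, B b -> 1 - s^-1 < nc b) ->
  even_over lattice (fun z => w0 + s%:C%C * F z) (disc 0 (1 - s^-1)).
Proof.
move=> tw farB; have oD := @unit_disc_open R; have [HF FD] := tower_selfmap tw.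
have sub : disc 0 (1 - s^-1) `<=` D.
  by apply: disc_mono; have := invr_gt0 s; rewrite s0; lra.
have HsF : holomorphic D (fun z => w0 + s%:C%C * F z).
  by apply: holomorphicD => //; [exact: holomorphic_cst|exact: holomorphicZ].
split=> [|l z hl zs]; first exact: holomorphic_sub HsF.
have Dz := sub z zs; pose x := (l - w0) / s%:C%C.
have lx : l = w0 + s%:C%C * x by rewrite /x mulrC divfK // addrC subrK.
have [x1|x1] := ltP (nc x) 1; last first.
  apply: (square_at_neq0 oD (holomorphicBc l oD HsF) Dz).
  rewrite lx opprD addrACA subrr add0r -mulrBr mulf_neq0 // subr_eq0.
  by apply: contraTneq x1 => <-; rewrite -ltNge -unit_discE; exact: FD.
have Lx : scaled_gaussian x by split=> //; rewrite -lx.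
have sqF : square_at (fun w => F w - x) z.
  have [//|[/farB Bz _]] := tower_multiplicity tw Lx Dz.
  by move: zs; rewrite disc0E; lra.
by apply: square_at_eq (square_atM (square_at_cst s%:C%C z) sqF) => w; rewrite lx; ring.
Qed.

Lemma rescaled_lift F B G : tower scaled_gaussian F B -> even_over lattice G D -> G 0 = w0 ->
  (forall z, D z -> nc (G z - w0) < s) ->
  exists phi, [/\ selfmap phi, phi 0 = 0 & forall z, D z -> G z = w0 + s%:C%C * F (phi z)].
Proof.
move=> tw [HG evG] G0 Gs; have oD := @unit_disc_open R.
pose g z := s%:C%C^-1 * (G z - w0).
have Hg : holomorphic D g by apply: holomorphicZ => //; exact: holomorphicBc.
have sg : selfmap g.
  split=> // z Dz; rewrite unit_discE ncM ncV nc_s ltr_pdivrMl // mulr1; exact: Gs.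
have evg : even_over scaled_gaussian g D.
  split=> // x z [x1 Lx] Dz.
  apply: square_at_eq (square_atM (square_at_cst s%:C%C^-1 z) (evG _ z Lx Dz)) => w.
  by rewrite /g; move: sC0 => k0; field.
have g0 : g 0 = 0 by rewrite /g G0 subrr mulr0.
have [phi [_ sphi phi0 gE]] := tower_lift tw evg sg g0.
exists phi; split=> // z Dz.
by rewrite -gE // /g mulVKf // addrC subrK.
Qed.

(* F behaves like a universal map for functions that stay within distance s of w0. *)
Definition universal_within (d : R) F := [/\ holomorphic D F, F 0 = w0,
  even_over lattice F (disc 0 (1 - s^-1)), d <= nc (cderive F 0) &
  forall G, even_over lattice G D -> G 0 = w0 -> (forall z, D z -> nc (G z - w0) < s) ->
    exists phi, [/\ selfmap phi, phi 0 = 0 & forall z, D z -> G z = F (phi z)]].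

Lemma universal_within_exists (d : R) : 0 < d -> d <= 1 / 4 ->
  (forall l, gaussian l -> d <= nc (l - w0)) -> exists F, universal_within d F.
Proof.
move=> d0 d4 far; have oD := @unit_disc_open R.
have sV1 : s^-1 < 1 by rewrite invf_lt1.
have sV0 : 0 < s^-1 by rewrite invr_gt0.
have ds0 : 0 < d / s by rewrite divr_gt0.
have ds1 : d / s < 1 by rewrite ltr_pdivrMr // mul1r; have := s1; lra.
have [||l Ll|F [B [tw farB]]] := tower_exists (L := scaled_gaussian) (s := 1 - s^-1) ds0 ds1.
- lra.
- lra.
- by split; [exact: scaled_gaussian_far|case: Ll].
exists (fun z => w0 + s%:C%C * F z); split.
- apply: holomorphicD => //; first exact: holomorphic_cst.
  by apply: holomorphicZ => //; exact: (tower_selfmap tw).1.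
- by rewrite (tower_fix0 tw) mulr0 addr0.
- exact: even_over_rescaled tw farB.
- have F' := holomorphic_is_cderive (tower_selfmap tw).1 (@unit_disc0 R).
  rewrite (cderiveE (is_cderiveD (is_cderive_cst w0 0) (is_cderiveZ s%:C%C F'))).
  rewrite add0r ncM nc_s mulrC -ler_pdivrMr //; apply: (tower_cderive_ge ds0 ds1) tw => l.
  exact: scaled_gaussian_far.
- by move=> G evG G0 Gs; exact: rescaled_lift tw evG G0 Gs.
Qed.

End RescaledTower.

Section Universal.
Variable R : realType.
Local Notation C := (R[i]).
Local Notation D := (@unit_disc R).
Local Notation lattice := (@gaussian R).
Implicit Types (z w l : C) (F G phi : C -> C) (phis : nat -> C -> C).

Lemma selfmap_ulim_fun phis : ultra [set n | selfmap (phis n) /\ phis n 0 = 0] ->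
  [/\ locally_bounded phis D, selfmap (ulim_fun phis) & ulim_fun phis 0 = 0].
Proof.
move=> good; have oD := @unit_disc_open R.
have bounded : locally_bounded phis D.
  move=> z Dz; have [r r0 rD] := oD z Dz; exists r, 1; split=> //.
  apply: filterS good => n [[Hp pD] _]; split; first exact: holomorphic_sub Hp.
  by move=> w /rD /pD; rewrite unit_discE => /ltW.
split=> //.
- split; first exact: holomorphic_ulim_fun.
  move=> z Dz; rewrite unit_discE; have z1 : nc z < 1 by rewrite -unit_discE.
  apply: le_lt_trans z1; apply: (uconverges_le (uconverges_ulim_fun bounded Dz)).
  by apply: filterS good => n [sp p0] /=; apply: selfmap_schwarz => //; rewrite -unit_discE.
- apply: uconverges_uniq (uconverges_ulim_fun bounded (@unit_disc0 R)) _.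
  by apply: uconverges_eq (uconverges_cst 0); apply: filterS good => n [_ p0] /=; rewrite p0.
Qed.

(* F is the universal covering of C, branched to order two over the Gaussian integers. *)
Definition universal_at F w := [/\ even_over lattice F D, F 0 = w, cderive F 0 != 0 &
  forall G, even_over lattice G D -> G 0 = w ->
    exists phi, [/\ selfmap phi, phi 0 = 0 & forall z, D z -> G z = F (phi z)]].

Section Limit.
Variables (w0 : C) (d : R) (fs : nat -> C -> C).
Hypothesis d0 : 0 < d.
Hypothesis univ_fs : forall n, universal_within w0 n.+2%:R d (fs n).

Let ultra_scale e : 0 < e -> ultra [set n | (n.+2%:R : R)^-1 < e].
Proof.
move=> /(@ultra_harmonic_lt R); apply: filterS => n /=; apply: le_lt_trans.
by rewrite lef_pV2 ?posrE ?ltr0n // ler_nat.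
Qed.

Lemma approximants_locally_bounded : locally_bounded fs D.
Proof.
move=> z; rewrite unit_discE => z1; pose r := (1 - nc z) / 4.
have r0 : 0 < r by rewrite /r; lra.
have zr : nc z + r + r + r < 1 by rewrite /r; lra.
have near_z w : disc z r w -> nc w <= nc z + r by rewrite /disc /=; have := ncB_ge w z; lra.
exists r, (nc w0 + 48 / r); split=> //; first by move=> w /near_z; rewrite unit_discE; lra.
apply: filterS (ultra_scale r0) => n /= nr; have [Hf f0 evf _ _] := univ_fs n; split.
  by apply: holomorphic_sub Hf => w /near_z; rewrite unit_discE; lra.
move: n.+2%:R^-1 nr evf => q qr evf w /near_z wr; have zq : nc z + r < 1 - q by lra.
have := landau_growth zq evf wr; rewrite f0 => growth.
have slope_le : 48 / (1 - q - (nc z + r)) * nc w <= 48 / r.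
  rewrite -[leRHS]mulr1; apply: ler_pM; rewrite ?nc_ge0 ?divr_ge0 //; try lra.
  by rewrite ler_pM2l // lef_pV2 ?posrE //; lra.
by have := ncD (fs n w - w0) w0; rewrite subrK; lra.
Qed.

Let bounded := approximants_locally_bounded.

Lemma even_over_limit : even_over lattice (ulim_fun fs) D.
Proof.
have oD := @unit_disc_open R; split=> [|l z hl Dz]; first exact: holomorphic_ulim_fun.
have boundedB : locally_bounded (fun n w => fs n w - l) D.
  move=> y /bounded[r [M [r0 rD bM]]]; exists r, (M + nc l); split=> //.
  apply: filterS bM => n [Hf fM]; split; first by apply: holomorphicBc => //; exact: disc_open.
  by move=> w /fM; have := ncB (fs n w) l; lra.
have [s [s0 sD small]] : exists s, [/\ 0 < s, disc z s `<=` D & nc z + s + s < 1].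
  exists ((1 - nc z) / 3); move: Dz; rewrite unit_discE => z1.
  by split=> [|w|]; [|rewrite unit_discE /disc /=; have := ncB_ge w z|]; lra.
have sq : square_at (ulim_fun (fun n w => fs n w - l)) z.
  apply: (square_at_ulim_fun boundedB Dz s0); apply: filterS (ultra_scale s0) => n /= ns w ws.
  have [_ _ evf _ _] := univ_fs n; apply: evf.2 => //.
  by move: n.+2%:R^-1 ns ws => q; rewrite disc0E /disc /=; have := ncB_ge w z; lra.
apply: (square_at_near s0 _ sq) => w /sD Dw.
apply: uconverges_uniq (uconverges_ulim_fun boundedB Dw) _.
by apply: uconvergesB; [exact: (uconverges_ulim_fun bounded)|exact: uconverges_cst].
Qed.

Lemma limit_0 : ulim_fun fs 0 = w0.
Proof.
apply: uconverges_uniq (uconverges_ulim_fun bounded (@unit_disc0 R)) _.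
by apply: uconverges_eq (uconverges_cst w0); apply: filterE => n /=; have [_ ->] := univ_fs n.
Qed.

Lemma limit_cderive_neq0 : cderive (ulim_fun fs) 0 != 0.
Proof.
have D0 := @unit_disc0 R; rewrite -nc_gt0; apply: (lt_le_trans d0).
rewrite (cderive_ulim_fun bounded D0).
apply: (uconverges_ge (uconverges_ulim_fun (locally_bounded_cderive bounded) D0)).
by apply: filterE => n /=; have [] := univ_fs n.
Qed.

Lemma limit_lift_bounded G (M : R) : even_over lattice G D -> G 0 = w0 ->
  (forall z, D z -> nc (G z - w0) <= M) ->
  exists phi, [/\ selfmap phi, phi 0 = 0 & forall z, D z -> G z = ulim_fun fs (phi z)].
Proof.
move=> evG G0 GM.
have lift (n : nat) : exists phi, M < n.+2%:R -> [/\ selfmap phi, phi 0 = 0 &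
    forall z, D z -> G z = fs n (phi z)].
  have [Mn|nM] := ltP M n.+2%:R; last by exists id.
  have [_ _ _ _ liftn] := univ_fs n.
  have [|phi phiP] := liftn G evG G0; last by exists phi.
  by move=> z /GM; lra.
have [phis phisP] := choice lift.
have large : ultra [set n | M < n.+2%:R].
  by apply: filterS (ultra_nat_gt M) => n /= /lt_le_trans; apply; rewrite ler_nat ltnW.
have [bphi sphi phi0] : [/\ locally_bounded phis D, selfmap (ulim_fun phis) &
    ulim_fun phis 0 = 0].
  by apply: selfmap_ulim_fun; apply: filterS large => n /phisP[].
exists (ulim_fun phis); split=> // z Dz.
apply: uconverges_uniq (uconverges_ulim_fun_comp bounded (sphi.2 _ Dz)
  (uconverges_ulim_fun bphi Dz)).
apply: uconverges_eq (uconverges_cst _).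
by apply: filterS large => n /phisP[_ _ GE] /=; rewrite GE.
Qed.

Lemma limit_lift_dilated G (t : R) : 0 < t -> t < 1 -> even_over lattice G D -> G 0 = w0 ->
  exists phi, [/\ selfmap phi, phi 0 = 0 &
    forall z, D z -> G (t%:C%C * z) = ulim_fun fs (phi z)].
Proof.
move=> t0 t1 evG G0; have oD := @unit_disc_open R.
have tD z : D z -> nc (t%:C%C * z) <= t.
  by rewrite unit_discE ncM nc_real gtr0_norm // => z1; rewrite ler_piMr // ltW.
apply: (@limit_lift_bounded (fun z => G (t%:C%C * z)) (48 / (1 - t))).
- apply: even_over_comp evG => //; first by apply: holomorphicZ => //; exact: holomorphic_id.
  by move=> z /tD; rewrite unit_discE; lra.
- by rewrite mulr0.
- move=> z Dz; rewrite -G0; apply: le_trans (landau_growth t1 evG (tD z Dz)) _.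
  by rewrite ler_piMr ?divr_ge0 //; have := tD z Dz; lra.
Qed.

Lemma limit_universal_at : universal_at (ulim_fun fs) w0.
Proof.
split; [exact: even_over_limit|exact: limit_0|exact: limit_cderive_neq0|move=> G evG G0].
pose t (n : nat) : R := 1 - n.+2%:R^-1.
have dilated (n : nat) : exists phi, [/\ selfmap phi, phi 0 = 0 &
    forall z, D z -> G ((t n)%:C%C * z) = ulim_fun fs (phi z)].
  apply: limit_lift_dilated => //; first by rewrite subr_gt0 invf_lt1 ?ltr0n // ltr1n.
  by rewrite ltrBlDr ltrDl invr_gt0 ltr0n.
have [phis phisP] := choice dilated.
have [bphi sphi phi0] : [/\ locally_bounded phis D, selfmap (ulim_fun phis) &
    ulim_fun phis 0 = 0].
  by apply: selfmap_ulim_fun; apply: filterE => n; have [] := phisP n.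
exists (ulim_fun phis); split=> // z Dz.
have t1 : uconverges (fun n => (t n)%:C%C * z) z.
  move=> e e0; apply: filterS (ultra_scale e0) => n /= ne.
  have -> : (t n)%:C%C * z - z = - (n.+2%:R^-1%:C%C * z) by rewrite rmorphB /=; ring.
  have z1 : nc z < 1 by rewrite -unit_discE.
  rewrite ncN ncM nc_real ger0_norm ?invr_ge0 ?ler0n //.
  by apply: le_lt_trans ne; rewrite ler_piMr ?invr_ge0 ?ler0n // ltW.
apply: uconverges_uniq (uconverges_comp t1 (holomorphic_continuous evG.1 Dz)) _.
have HF := even_over_limit.1.
apply: uconverges_eq (uconverges_comp (uconverges_ulim_fun bphi Dz)
  (holomorphic_continuous HF (sphi.2 z Dz))).
by apply: filterE => n /=; have [_ _ ->] := phisP n.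
Qed.

End Limit.

Lemma universal_exists w : ~ gaussian w -> exists F, universal_at F w.
Proof.
move=> /not_gaussian_isolated[d [d0 d4] far].
have approximant (n : nat) : exists F, universal_within w n.+2%:R d F.
  by apply: universal_within_exists => //; rewrite ltr1n.
have [fs univ_fs] := choice approximant.
by exists (ulim_fun fs); exact: (limit_universal_at d0 univ_fs).
Qed.

End Universal.

(** * Automorphisms of the disc *)

Section Injectivity.
Variable R : realType.
Local Notation C := (R[i]).
Implicit Types (c x y z w : C) (f g F : C -> C) (U V : set C).

Lemma local_injective f c (r : R) : 0 < r -> holomorphic (disc c r) f -> cderive f c != 0 ->
  exists2 d : R, 0 < d & forall x y, disc c d x -> disc c d y -> f x = f y -> x = y.
Proof.
move=> r0 Hf f'c; set a := cderive f c; have na : 0 < nc a by rewrite nc_gt0.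
have [d d0 near_a] := holomorphic_continuous (holomorphic_cderive Hf) (disc_center c r0)
  (e := nc a / 2) ltac:(lra).
exists (Num.min d r) => [|x y xd yd fxy]; first by rewrite lt_min d0.
have [dd dr] : Num.min d r <= d /\ Num.min d r <= r by rewrite !ge_min !lexx orbT.
have := almost_linear (@disc_convex R c (Num.min d r)) (f' := cderive f) (a := a) (K := nc a / 2)
  (fun w wd => holomorphic_is_cderive Hf (disc_mono dr wd))
  (fun w wd => ltW (near_a w (disc_mono dd wd))) xd yd.
rewrite fxy subrr sub0r ncN ncM => close; apply/esym/eqP.
by rewrite -subr_eq0 -nc_eq0 eq_le nc_ge0 andbT; have := nc_ge0 (y - x); nra.
Qed.

Lemma rigid_lift U V F f g x0 : copen V -> holomorphic V F -> copen U -> is_convex U ->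
  holomorphic U f -> holomorphic U g -> (forall z, U z -> V (f z)) -> U x0 -> f x0 = g x0 ->
  cderive F (f x0) != 0 -> (forall z, U z -> F (f z) = F (g z)) -> forall z, U z -> f z = g z.
Proof.
move=> oV HF oU cU Hf Hg fV Ux0 fg0 F'0 Ffg z Uz.
have [r r0 rV] := oV _ (fV _ Ux0).
have [d d0 inj] := local_injective r0 (holomorphic_sub rV HF) F'0.
have [d1 d10 near_f] := holomorphic_continuous Hf Ux0 d0.
have [d2 d20 near_g] := holomorphic_continuous Hg Ux0 d0; have [s s0 sU] := oU _ Ux0.
apply/eqP; rewrite -subr_eq0; apply/eqP.
apply: (@identity_theorem _ U (fun z => f z - g z) x0 (Num.min s (Num.min d1 d2))) => //.
- exact: holomorphicB.
- by rewrite !lt_min s0 d10.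
move=> w; rewrite /disc /= !lt_min => /and3P[ws w1 w2].
apply/eqP; rewrite subr_eq0; apply/eqP; apply: inj; [exact: near_f| |by apply: Ffg; exact: sU].
by rewrite /disc /= fg0; exact: near_g.
Qed.

End Injectivity.

Section DiscAutomorphisms.
Variable R : realType.
Local Notation C := (R[i]).
Implicit Types (a x y z w u : C) (f g : C -> C).
Local Notation D := (@unit_disc R).
Local Notation Re := (@complex.Re R).

Definition disc_aut f := selfmap f /\ exists g, [/\ selfmap g,
  forall z, D z -> g (f z) = z & forall z, D z -> f (g z) = z].

Lemma disc_aut_comp f g : disc_aut f -> disc_aut g -> disc_aut (fun z => f (g z)).
Proof.
move=> [sf [f' [sf' f'K fK]]] [sg [g' [sg' g'K gK]]]; split; first exact: selfmap_comp.
exists (fun z => g' (f' z)); split=> [|z Dz|z Dz]; first exact: selfmap_comp.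
- by rewrite f'K ?g'K //; exact: sg.2.
- by rewrite gK ?fK //; exact: sf'.2.
Qed.

Lemma disc_aut_blaschke a : nc a < 1 -> disc_aut (blaschke a).
Proof.
move=> a1; split; first exact: selfmap_blaschke.
exists (blaschke (- a)); split=> [|z|z]; first by apply: selfmap_blaschke; rewrite ncN.
- by rewrite unit_discE; exact: blaschkeK.
- by rewrite unit_discE; exact: blaschkeNK.
Qed.

Lemma disc_aut_id : disc_aut id.
Proof. by split; [exact: selfmap_id|exists id; split=> //; exact: selfmap_id]. Qed.

Definition recentre a b f z : C := blaschke b (f (blaschke (- a) z)).

Lemma selfmap_recentre a b f : nc a < 1 -> nc b < 1 -> selfmap f -> selfmap (recentre a b f).
Proof.
move=> a1 b1 sf; apply: (@selfmap_comp _ (blaschke b) (fun z => f (blaschke (- a) z))).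
  exact: selfmap_blaschke.
by apply: selfmap_comp => //; apply: selfmap_blaschke; rewrite ncN.
Qed.

Lemma disc_aut_recentre a b f : nc a < 1 -> nc b < 1 -> disc_aut f ->
  disc_aut (recentre a b f).
Proof.
move=> a1 b1 af; apply: (@disc_aut_comp (blaschke b) (fun z => f (blaschke (- a) z))).
  exact: disc_aut_blaschke.
by apply: disc_aut_comp => //; apply: disc_aut_blaschke; rewrite ncN.
Qed.

Lemma recentre_0 a f : recentre a (f a) f 0 = 0.
Proof. by rewrite /recentre blaschke_0 opprK blaschke_self. Qed.

Lemma disc_aut_fix0_modulus f z : disc_aut f -> f 0 = 0 -> D z -> nc (f z) = nc z.
Proof.
move=> [sf [g [sg gK fK]]] f0 Dz.
have g0 : g 0 = 0 by rewrite -[X in g X]f0 gK //; exact: unit_disc0.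
have z1 : nc z < 1 by rewrite -unit_discE.
apply/le_anti; rewrite selfmap_schwarz //= -{1}(gK z Dz) selfmap_schwarz //.
by rewrite -unit_discE; exact: sf.2.
Qed.

Lemma disc_aut_dist f a x : disc_aut f -> D a -> D x ->
  nc (blaschke (f a) (f x)) = nc (blaschke a x).
Proof.
move=> af Da Dx; have [a1 x1] : nc a < 1 /\ nc x < 1 by rewrite -!unit_discE.
have fa1 : nc (f a) < 1 by rewrite -unit_discE; exact: af.1.2.
have Dm : D (blaschke a x) by rewrite unit_discE blaschke_lt1.
have := disc_aut_fix0_modulus (disc_aut_recentre a1 fa1 af) (recentre_0 a f) Dm.
by rewrite /recentre blaschkeK.
Qed.

Lemma disc_aut_fix0_inner f a x : disc_aut f -> f 0 = 0 -> D a -> D x ->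
  Re (cconj (f a) * f x) = Re (cconj a * x).
Proof.
move=> af f0 Da Dx; have := disc_aut_dist af Da Dx.
have polar (p q : C) : nc (1 - cconj p * q) ^+ 2 =
    1 - 2 * Re (cconj p * q) + nc p ^+ 2 * nc q ^+ 2.
  by rewrite !nc_sqr; case: p => p1 p2; case: q => q1 q2 /=; ring.
have [na nx] := (disc_aut_fix0_modulus af f0 Da, disc_aut_fix0_modulus af f0 Dx).
have lt1 y : D y -> nc y < 1 by rewrite unit_discE.
move=> /(congr1 (fun r => 1 - r ^+ 2)); rewrite !one_sub_blaschke ?na ?nx ?lt1 //.
have num0 : (1 - nc a ^+ 2) * (1 - nc x ^+ 2) != 0.
  by rewrite mulf_neq0 // gt_eqF // subr_gt0 nc_sqr_lt1 ?lt1.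
move=> /(mulfI num0)/invr_inj; rewrite !polar na nx; lra.
Qed.

(* f preserves real inner products, so comparing f near 0 with its linear part shows that
   conj(f'(0)) f(x) - x is orthogonal to every vector, in particular to itself. *)
Lemma disc_aut_fix0_linear f x : disc_aut f -> f 0 = 0 -> D x ->
  cconj (cderive f 0) * f x = x.
Proof.
have expand (t : R) u p q : Re (cconj q * p) = Re (cconj (t%:C%C * (cconj u * p - x)) * x) ->
    t * nc (cconj u * p - x) ^+ 2 = Re (cconj (u * (t%:C%C * (cconj u * p - x)) - q) * p).
  by rewrite nc_sqr; case: u p q x => [u1 u2] [p1 p2] [q1 q2] [x1 x2] /=; lra.
move=> af f0 Dx; have fx1 : nc (f x) < 1 by rewrite -unit_discE; exact: af.1.2.
set u := cderive f 0; pose v := cconj u * f x - x; apply: eq_of_nc_small => e e0.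
rewrite -/v; have [v0|v0] := leP (nc v) 0; first by lra.
have /is_cderiveP/(_ e e0)[d d0 near0] := holomorphic_is_cderive af.1.1 (@unit_disc0 R).
pose t := Num.min d 1 / (2 * nc v); have m0 : 0 < Num.min d 1 by rewrite lt_min d0 ltr01.
have t0 : 0 < t by rewrite divr_gt0 // mulr_gt0.
pose w := t%:C%C * v; have nw : nc w = Num.min d 1 / 2.
  by rewrite ncM nc_real gtr0_norm // /t; field; rewrite gt_eqF.
have [wd w1] : nc w < d /\ nc w < 1.
  have : Num.min d 1 <= d /\ Num.min d 1 <= 1 by rewrite !ge_min !lexx orbT.
  by rewrite nw; lra.
have Dw : D w by rewrite unit_discE.
have inner : t * nc v ^+ 2 = Re (cconj (u * w - f w) * f x).
  by apply: expand; exact: disc_aut_fix0_inner.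
have := near0 w; rewrite disc0E -/u f0 !subr0 => /(_ wd) close.
have : t * nc v ^+ 2 <= e * nc w * 1.
  rewrite inner; apply: le_trans (le_trans (ler_norm _) (Re_le_nc _)) _.
  rewrite ncM nc_conj nc_distC; apply: ler_pM; rewrite ?nc_ge0 //; exact: ltW.
rewrite mulr1 /w ncM nc_real gtr0_norm // expr2 [leRHS]mulrCA ler_pM2l //.
by rewrite ler_pM2r.
Qed.

Lemma disc_aut_fix0 f : disc_aut f -> f 0 = 0 ->
  nc (cderive f 0) = 1 /\ forall z, D z -> f z = cderive f 0 * z.
Proof.
move=> af f0; set u := cderive f 0.
have u1 : nc u = 1.
  pose h : C := (1 / 2)%:C%C; have nh : nc h = 1 / 2 by rewrite nc_real ger0_norm //; lra.
  have Dh : D h by rewrite unit_discE nh; lra.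
  have := congr1 (@nc R) (disc_aut_fix0_linear af f0 Dh).
  by rewrite ncM nc_conj (disc_aut_fix0_modulus af f0 Dh) nh -/u; lra.
by split=> // z Dz; rewrite -{2}(disc_aut_fix0_linear af f0 Dz) mulrA mul_cconj u1 expr1n mul1r.
Qed.

Lemma disc_aut_mob f : disc_aut f -> exists a u, [/\ nc a < 1, nc u = 1 &
  forall z, D z -> f z = mob a u z].
Proof.
move=> af; have [sf [g [sg gK fK]]] := af; have D0 := @unit_disc0 R.
pose a := g 0; have a1 : nc a < 1 by rewrite -unit_discE; exact: sg.2.
have at0 : disc_aut (fun z => f (blaschke (- a) z)).
  by apply: disc_aut_comp => //; apply: disc_aut_blaschke; rewrite ncN.
have [|] := disc_aut_fix0 at0; first by rewrite blaschke_0 opprK /a fK.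
set u := cderive _ 0 => u1 rotation; exists a, u; split=> // z Dz.
have z1 : nc z < 1 by rewrite -unit_discE.
by rewrite -{1}(blaschkeK a1 z1) rotation ?unit_discE ?blaschke_lt1 // /mob -mulrA.
Qed.

Lemma disc_aut_fix_cderive1 f z0 : disc_aut f -> D z0 -> f z0 = z0 -> cderive f z0 = 1 ->
  forall z, D z -> f z = z.
Proof.
move=> af Dz0 fz0 f'1 z Dz; have D0 : nc (0 : C) < 1 by rewrite nc0.
have [a1 z1] : nc z0 < 1 /\ nc z < 1 by rewrite -!unit_discE.
have aN1 : nc (- z0) < 1 by rewrite ncN.
have m0 : blaschke (- z0) 0 = z0 by rewrite blaschke_0 opprK.
have aconj := disc_aut_recentre a1 a1 af.
have conj0 : recentre z0 z0 f 0 = 0 by rewrite -{2}fz0 recentre_0.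
have [_ rotation] := disc_aut_fix0 aconj conj0.
have conj' : cderive (recentre z0 z0 f) 0 = 1.
  have f' : is_cderive f (blaschke (- z0) 0) 1.
    by rewrite m0 -f'1; exact: holomorphic_is_cderive af.1.1 Dz0.
  have outer' : is_cderive (blaschke z0) (f (blaschke (- z0) 0)) (blaschke_slope z0 z0 z0).
    by rewrite m0 fz0; exact: is_cderive_blaschke.
  rewrite (cderiveE (is_cderive_comp (is_cderive_comp (is_cderive_blaschke aN1 D0) f') outer')).
  rewrite /blaschke_slope cconjN; have := blaschke_den_self_neq0 a1.
  rewrite !mulr0 !subr0 !mul1r divr1 mulrNN [cconj z0 * z0]mulrC.
  by move: (cconj z0) => k den; field.
have Dm : D (blaschke z0 z) by rewrite unit_discE blaschke_lt1.
have := rotation _ Dm; rewrite conj' mul1r /recentre blaschkeK // => fixed.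
have fz1 : nc (f z) < 1 by rewrite -unit_discE; exact: af.1.2.
by rewrite -(blaschkeK a1 fz1) fixed blaschkeK.
Qed.

Lemma selfmap_compact f (s : R) : s < 1 -> selfmap f ->
  exists2 r : R, 0 <= r /\ r < 1 & forall z, nc z <= s -> nc (f z) <= r.
Proof.
move=> s1 [Hf fD]; have [s0|s0] := ltP s 0.
  by exists 0 => // z; have := nc_ge0 z; lra.
have in_disc z : closed_disc 0 s z -> D z by rewrite /closed_disc /= subr0 unit_discE; lra.
have [||z0 /in_disc Dz0 fmax] := @compact_max _ (closed_disc 0 s) (fun z => nc (f z)) _
  (@closed_disc_compact R 0 s).
- by exists 0; rewrite /closed_disc /= subrr nc0.
- by move=> z /in_disc Dz; apply: rcontinuous_nc; exact: holomorphic_continuous Hf Dz.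
exists (nc (f z0)) => [|z zs]; first by rewrite nc_ge0 -unit_discE; split=> //; exact: fD.
by apply: fmax; rewrite /closed_disc /= subr0.
Qed.

End DiscAutomorphisms.

Section Hyperboloid.
Variable R : realType.
Local Notation C := (R[i]).
Implicit Types (a z u s : C) (f : C -> C) (v w : C * C).
Local Notation D := (@unit_disc R).

(* The disc is the hyperboloid t^2 - |x|^2 = 1, t > 0, of R x C, on which Moebius maps act
   linearly; a finite orbit therefore has a fixed barycenter. *)
Definition hyperboloid z : C * C :=
  ((1 + z * cconj z) / (1 - z * cconj z), 2 * z / (1 - z * cconj z)).

Definition lorentz a u v : C * C :=
  (((1 + a * cconj a) * v.1 - cconj a * v.2 - a * cconj v.2) / (1 - a * cconj a),
   u * (v.2 + a ^+ 2 * cconj v.2 - 2 * a * v.1) / (1 - a * cconj a)).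

Definition timelike v := `|v.2| < v.1.

Lemma mul_cconj_norm z : z * cconj z = `|z| ^+ 2.
Proof. by rewrite mul_cconj normcE rmorphXn. Qed.

Lemma unit_disc_normE z : D z = (`|z| < 1) :> Prop.
Proof. by rewrite unit_discE normcE -(rmorph1 (real_complex R)) ltcR. Qed.

Lemma hyperboloid_den_gt0 z : D z -> 0 < 1 - z * cconj z.
Proof. by rewrite unit_disc_normE mul_cconj_norm subr_gt0 => z1; rewrite exprn_ilt1. Qed.

Lemma hyperboloid_inj z z' : D z -> D z' -> hyperboloid z = hyperboloid z' -> z = z'.
Proof.
have cancel y : D y -> (hyperboloid y).2 / (1 + (hyperboloid y).1) = y.
  move=> /hyperboloid_den_gt0 den; rewrite /hyperboloid /=.
  move: (y * cconj y) den => k den; field.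
  by rewrite gt_eqF //=; have -> : 1 - k + (1 + k) = 2 by ring.
by move=> Dz Dz' zz'; rewrite -(cancel z Dz) zz' cancel.
Qed.

Lemma timelike_hyperboloid z : D z -> timelike (hyperboloid z).
Proof.
move=> Dz; have den := hyperboloid_den_gt0 Dz.
rewrite /timelike /= normrM normfV (gtr0_norm den) ltr_pM2r ?invr_gt0 // normrM normr_nat.
rewrite mul_cconj_norm -subr_gt0.
have -> : 1 + `|z| ^+ 2 - 2 * `|z| = (1 - `|z|) ^+ 2 by ring.
by rewrite exprn_gt0 // subr_gt0 -unit_disc_normE.
Qed.

Lemma timelikeD v w : timelike v -> timelike w -> timelike (v + w).
Proof. by move=> tv tw; apply: le_lt_trans (ler_normD _ _) _; exact: ltrD. Qed.

Lemma timelike_sum n (h : nat -> C * C) : (forall j, timelike (h j)) ->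
  timelike (\sum_(j < n.+1) h j).
Proof.
move=> th; elim: n => [|n IH]; first by rewrite big_ord1.
by rewrite big_ord_recr; exact: timelikeD.
Qed.

Lemma timelike_ray v : timelike v -> exists z s,
  [/\ D z, 0 < s & v = (s * (hyperboloid z).1, s * (hyperboloid z).2)].
Proof.
case: v => t x; rewrite /timelike /= => xt; have t0 : 0 < t by apply: le_lt_trans xt.
have q0 : 0 < t ^+ 2 - `|x| ^+ 2 by rewrite subr_gt0 ltr_pXn2r ?nnegrE // ltW.
pose s := sqrtC (t ^+ 2 - `|x| ^+ 2); have s0 : 0 < s by rewrite sqrtC_gt0.
have ts0 : 0 < t + s by rewrite addr_gt0.
exists (x / (t + s)), s; split=> //.
  rewrite unit_disc_normE normrM normfV (gtr0_norm ts0) ltr_pdivrMr // mul1r.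
  by apply: lt_trans xt _; rewrite ltrDl.
have x2 : `|x| ^+ 2 = (t - s) * (t + s) by rewrite -subr_sqr sqrtCK subKr.
rewrite /hyperboloid mul_cconj_norm normrM normfV (gtr0_norm ts0) expr_div_n x2.
have ts : t + s != 0 by rewrite gt_eqF.
have den : t + s - (t - s) != 0.
  have -> : t + s - (t - s) = s *+ 2 by ring.
  by rewrite mulrn_eq0 /= gt_eqF.
by congr pair; field; rewrite ts.
Qed.

Lemma lorentzD a u v w : lorentz a u (v + w) = lorentz a u v + lorentz a u w.
Proof.
have conjD : cconj (v + w).2 = cconj v.2 + cconj w.2 by exact: cconjD.
by congr pair; rewrite conjD /=; ring.
Qed.

Lemma lorentz0 a u : lorentz a u 0 = 0.
Proof. by apply: (addrI (lorentz a u 0)); rewrite -lorentzD !addr0. Qed.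

Lemma lorentz_sum a u n (h : nat -> C * C) :
  lorentz a u (\sum_(j < n) h j) = \sum_(j < n) lorentz a u (h j).
Proof. exact: (big_morph _ (lorentzD a u) (lorentz0 a u)). Qed.

Lemma lorentzZ a u s v : 0 < s ->
  lorentz a u (s * v.1, s * v.2) = (s * (lorentz a u v).1, s * (lorentz a u v).2).
Proof.
move=> /gt0_complex_real[r _ ->].
have conjZ : cconj (r%:C%C * v.2) = r%:C%C * cconj v.2 by rewrite cconjM cconj_real.
by congr pair; rewrite /= conjZ; ring.
Qed.

Lemma hyperboloid_mob a u z : nc a < 1 -> nc u = 1 -> D z ->
  hyperboloid (mob a u z) = lorentz a u (hyperboloid z).
Proof.
move=> a1 u1 Dz; have z1 : nc z < 1 by rewrite -unit_discE.
have conj_drift : cconj (2 * z / (1 - z * cconj z)) = 2 * cconj z / (1 - z * cconj z).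
  by rewrite cconjM cconjV cconjM cconj_nat [z * _]mulrC cconj_den mulrC.
have uu : u * cconj u = 1 by rewrite mul_cconj u1 expr1n.
have den := blaschke_den_neq0 a1 z1.
have den' : 1 - a * cconj z != 0 by rewrite -cconj_den -nc_gt0 nc_conj nc_gt0.
have mm : mob a u z * cconj (mob a u z) =
    (z - a) * (cconj z - cconj a) / ((1 - cconj a * z) * (1 - a * cconj z)).
  rewrite /mob cconjM cconjV cconjM cconjB cconj_den.
  rewrite -[RHS]mul1r -[X in _ = X * _]uu.
  move: (cconj u) (cconj a) (cconj z) den den' => cu ca cz den den'.
  by field; rewrite den' den.
have dena : 1 - a * cconj a != 0 by exact: blaschke_den_self_neq0.
have denz : 1 - z * cconj z != 0 by rewrite gt_eqF // hyperboloid_den_gt0.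
rewrite /hyperboloid /lorentz mm /= conj_drift /mob.
move: (cconj a) (cconj z) den den' dena denz {mm conj_drift} => ca cz den den' dena denz.
have den2 : (1 - ca * z) * (1 - a * cz) - (z - a) * (cz - ca) != 0.
  rewrite (_ : _ - _ = (1 - a * ca) * (1 - z * cz)); last by ring.
  exact: mulf_neq0.
by congr pair; field; rewrite ?den ?den' ?dena ?denz.
Qed.

Lemma finite_order_fixed f m : disc_aut f -> (0 < m)%N ->
  (forall z, D z -> iter m f z = z) -> exists2 z, D z & f z = z.
Proof.
move=> af; case: m => // m _ fm; have [a [u [a1 u1 fE]]] := disc_aut_mob af.
have D0 := @unit_disc0 R; have fD := af.1.2.
have orbitD j : D (iter j f 0) by elim: j => //= j; exact: fD.
pose v := \sum_(j < m.+1) hyperboloid (iter j f 0).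
have [z [s [Dz s0 vE]]] : exists z s,
    [/\ D z, 0 < s & v = (s * (hyperboloid z).1, s * (hyperboloid z).2)].
  apply: timelike_ray; apply: (@timelike_sum m (fun j => hyperboloid (iter j f 0))) => j.
  exact: timelike_hyperboloid.
have invariant : lorentz a u v = v.
  rewrite /v (@lorentz_sum a u m.+1 (fun j => hyperboloid (iter j f 0))).
  rewrite big_ord_recr [RHS]big_ord_recl addrC /=; congr (_ + _).
    by apply: eq_bigr => j _; rewrite -hyperboloid_mob // -fE.
  by rewrite -hyperboloid_mob // -fE // -iterS fm.
exists z => //; apply: hyperboloid_inj => //; first exact: fD.
move: invariant; rewrite vE lorentzZ // fE // hyperboloid_mob //.
have s_neq0 : s != 0 by rewrite gt_eqF.
case: (lorentz _ _ _) => p q; case: (hyperboloid z) => p' q' [].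
by move=> /(mulfI s_neq0) -> /(mulfI s_neq0) ->.
Qed.

End Hyperboloid.

(** * Deck transformations *)

Section Lifting.
Variable R : realType.
Local Notation C := (R[i]).
Implicit Types (a l t x y z w : C) (f g h G phi psi : C -> C) (r : R).
Local Notation D := (@unit_disc R).
Local Notation lattice := (@gaussian R).
Let oD := @unit_disc_open R.
Let cD := @unit_disc_convex R.
Let D0 := @unit_disc0 R.

Lemma even_over_selfmap G f : even_over lattice G D -> selfmap f ->
  even_over lattice (fun z => G (f z)) D.
Proof. by move=> evG [Hf fD]; exact: (even_over_comp oD oD Hf fD). Qed.

Lemma even_over_square (k : R) l : 0 < k -> k < 1 -> gaussian l ->
  even_over lattice (fun w => l + k%:C%C * w ^+ 2) D.
Proof.
move=> k0 k1 hl.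
have Hsqr : holomorphic D (fun w => k%:C%C * w ^+ 2).
  by apply: holomorphicZ => //; apply: holomorphicX => //; exact: holomorphic_id.
have HG : holomorphic D (fun w => l + k%:C%C * w ^+ 2).
  by apply: holomorphicD => //; exact: holomorphic_cst.
split=> // m w hm Dw; have w1 : nc w < 1 by rewrite -unit_discE.
have [->|ne] := eqVneq m l.
  have sq := square_at_sqr oD (holomorphic_id oD) Dw.
  by apply: square_at_eq (square_atM (square_at_cst k%:C%C w) sq) => y; ring.
apply: (square_at_neq0 oD (holomorphicBc m oD HG) Dw).
apply: contraNneq ne => e; apply/eqP; apply: gaussian_close_eq => //.
have -> : m - l = k%:C%C * w ^+ 2 by rewrite -[LHS]addr0 -e; ring.
by rewrite ncM ncX nc_real gtr0_norm //; have := nc_ge0 w; nra.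
Qed.

Lemma universal_lift_from F w G a : universal_at F w -> D a -> even_over lattice G D -> G a = w ->
  exists phi, [/\ selfmap phi, phi a = 0 & forall z, D z -> G z = F (phi z)].
Proof.
move=> [_ _ _ lift] Da evG Ga; have a1 : nc a < 1 by rewrite -unit_discE.
have aN1 : nc (- a) < 1 by rewrite ncN.
have [|phi [sphi phi0 GE]] := lift _ (even_over_selfmap evG (selfmap_blaschke aN1)).
  by rewrite blaschke_0 opprK.
exists (fun z => phi (blaschke a z)); split.
- by apply: selfmap_comp => //; exact: selfmap_blaschke.
- by rewrite blaschke_self.
- move=> z Dz; have z1 : nc z < 1 by rewrite -unit_discE.
  by rewrite -GE ?blaschkeK // unit_discE blaschke_lt1.
Qed.

Variables (F : C -> C) (w0 : C).
Hypothesis univF : universal_at F w0.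

Let evF : even_over lattice F D. Proof. by case: univF. Qed.

Lemma universal_holomorphic : holomorphic D F.
Proof. by case: evF. Qed.

Let HF := universal_holomorphic.

Lemma universal_base_not_gaussian : ~ gaussian (F 0).
Proof.
have [_ _ F'0 _] := univF; move=> lattice0.
by move/eqP: F'0; apply; exact: even_over_critical evF D0 lattice0.
Qed.

(* The universal map with another base value factors through F and conversely; the composition
   of the two factors is the identity by rigidity. *)
Lemma universal_change_base F1 z0 : D z0 -> universal_at F1 (F z0) ->
  exists psi, [/\ selfmap psi, psi 0 = z0 & forall z, D z -> F1 z = F (psi z)].
Proof.
move=> Dz0 univ1; have [_ F0 F'0 _] := univF; have [evF1 _ _ _] := univ1.
have [phi [sphi phiz0 FE]] := universal_lift_from univ1 Dz0 evF erefl.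
have Dphi0 : D (phi 0) := sphi.2 0 D0.
have F1phi0 : F1 (phi 0) = w0 by rewrite -FE.
have [psi [spsi psiphi0 F1E]] := universal_lift_from univF Dphi0 evF1 F1phi0.
have sps := selfmap_comp spsi sphi.
have id_comp z : D z -> psi (phi z) = z.
  apply: (rigid_lift oD HF oD cD sps.1 (holomorphic_id oD) sps.2 D0) => // [|w Dw].
    by rewrite psiphi0.
  by rewrite -F1E ?FE //; exact: sphi.2.
by exists psi; split=> //; rewrite -phiz0 id_comp.
Qed.

Lemma universal_lift G a z0 : D a -> D z0 -> ~ gaussian (F z0) -> even_over lattice G D ->
  G a = F z0 -> exists phi, [/\ selfmap phi, phi a = z0 & forall z, D z -> G z = F (phi z)].
Proof.
move=> Da Dz0 nonlattice evG Ga.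
have [F1 univ1] := universal_exists nonlattice.
have [psi [spsi psi0 F1E]] := universal_change_base Dz0 univ1.
have [phi [sphi phia GE]] := universal_lift_from univ1 Da evG Ga.
exists (fun z => psi (phi z)); split; [exact: selfmap_comp|by rewrite phia|].
by move=> z Dz; rewrite GE // F1E //; exact: sphi.2.
Qed.

Lemma universal_cderive_neq0 z : D z -> ~ gaussian (F z) -> cderive F z != 0.
Proof.
move=> Dz nonlattice; have [d [d0 _] far] := not_gaussian_isolated nonlattice.
pose G w := F z + d%:C%C * w.
have avoid w : D w -> ~ gaussian (G w).
  rewrite unit_discE => w1 /far; rewrite /G [F z + _]addrC addrK ncM nc_real gtr0_norm //.
  by rewrite leNgt gtr_pMr // w1.
have evG : even_over lattice G D.
  by apply: even_over_avoid => //; exact: holomorphic_affine.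
have [|phi [sphi phi0 GE]] := universal_lift D0 Dz nonlattice evG.
  by rewrite /G mulr0 addr0.
have G' := is_cderiveD (is_cderive_cst (F z) 0) (is_cderive_mulc d%:C%C 0).
have lifted : is_cderive (fun w => F (phi w)) 0 (cderive F z * cderive phi 0).
  apply: is_cderive_comp; first exact: (holomorphic_is_cderive sphi.1 D0).
  by rewrite phi0; exact: holomorphic_is_cderive HF Dz.
have E := is_cderive_uniq (is_cderive_near ltr01 GE G') lifted.
apply/eqP => F'0; move/eqP: E; rewrite F'0 mul0r add0r -nc_eq0 nc_real normr_eq0.
by rewrite gt_eqF.
Qed.

Lemma universal_not_locally_constant z r c : D z -> 0 < r ->
  ~ (forall w, disc z r w -> F w = c).
Proof.
move=> Dz r0 Fc; have [_ _ /eqP F'0 _] := univF.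
have const w : D w -> F w - c = 0.
  apply: (@identity_theorem _ D (fun w => F w - c) z r) => // [|y /Fc ->].
    exact: holomorphicBc.
  by rewrite subrr.
apply/F'0/cderiveE; apply: (is_cderive_near ltr01 _ (is_cderive_cst c 0)) => w /const/eqP.
by rewrite subr_eq0 => /eqP.
Qed.

Lemma universal_not_gaussian_near z r : D z -> 0 < r ->
  exists2 y, D y /\ disc z r y & ~ gaussian (F y).
Proof.
move=> Dz r0; have [hz|nonlattice] := pselect (gaussian (F z)); last first.
  by exists z => //; split=> //; exact: disc_center.
have [d d0 near1] := holomorphic_continuous HF Dz ltr01; have [s s0 sD] := oD Dz.
have m0 : 0 < Num.min r (Num.min d s) by rewrite !lt_min r0 d0.
apply: contrapT => none; apply: (universal_not_locally_constant Dz m0 (c := F z)) => w.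
rewrite /disc /= !lt_min => /and3P[wr wd ws].
apply: gaussian_close_eq => //; last exact: near1.
by apply: contrapT => nonlattice; apply: none; exists w => //; split=> //; exact: sD.
Qed.

Lemma square_chart_left_inverse z r h l : 0 < r -> disc z r `<=` D -> gaussian l ->
  holomorphic (disc z r) h -> (forall w, disc z r w -> nc (h w) < 1 / 2) ->
  (forall w, disc z r w -> F w = l + h w ^+ 2) ->
  exists2 phi, selfmap phi & forall w, disc z r w -> phi (2 * h w) = w.
Proof.
move=> r0 rD hl Hh h2 FE; have oV := @disc_open R z r.
pose k : R := 1 / 4; have [k0 k1] : 0 < k /\ k < 1 by rewrite /k; lra.
have chartD w : disc z r w -> D (2 * h w).
  by move=> /h2; rewrite unit_discE ncM nc_nat; lra.
have four : k%:C%C * 4 = 1 :> C.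
  have -> : (4 : C) = (4 : R)%:C%C by rewrite rmorph_nat.
  by rewrite -(rmorphM (real_complex R)) /k divfK // pnatr_eq0.
have GE w : disc z r w -> l + k%:C%C * (2 * h w) ^+ 2 = F w.
  by move=> /FE ->; rewrite exprMn -natrX mulrA four mul1r.
have [y [Dy yr] nonlattice] := universal_not_gaussian_near (rD z (disc_center z r0)) r0.
have [|phi [sphi phiy GphiE]] := universal_lift (chartD _ yr) Dy nonlattice
  (even_over_square k0 k1 hl); first exact: GE.
have Hchart : holomorphic (disc z r) (fun w => 2 * h w) by exact: holomorphicZ.
exists phi => //.
apply: (rigid_lift oD HF oV (@disc_convex R z r) (holomorphic_comp oV oD chartD Hchart sphi.1)
  (holomorphic_id oV) _ yr) => //.
- by move=> w /chartD; exact: sphi.2.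
- by rewrite phiy; exact: universal_cderive_neq0.
- by move=> w wr; rewrite -GphiE ?GE //; exact: chartD.
Qed.

Lemma universal_square_chart z : D z -> gaussian (F z) -> exists r h,
  [/\ 0 < r, disc z r `<=` D, holomorphic (disc z r) h, h z = 0 /\ cderive h z != 0 &
      forall w, disc z r w -> F w = F z + h w ^+ 2].
Proof.
move=> Dz hz; have [s s0 [h Hh hE]] := evF.2 _ z hz Dz; have zs := disc_center z s0.
have h0 : h z = 0 by apply/eqP; rewrite -sqrf_eq0 hE // subrr.
have half0 : 0 < 1 / 2 :> R by lra.
have [d d0 near0] := holomorphic_continuous Hh zs half0; have [t t0 tD] := oD Dz.
pose r := Num.min s (Num.min d t); have r0 : 0 < r by rewrite !lt_min s0 d0.
have inV w : disc z r w -> [/\ disc z s w, nc (h w) < 1 / 2 & D w].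
  rewrite /disc /= !lt_min => /and3P[ws wd wt]; split=> //; last exact: tD.
  by have := near0 w wd; rewrite h0 subr0.
have rD : disc z r `<=` D by move=> w /inV[].
have HhV : holomorphic (disc z r) h by apply: holomorphic_sub Hh => w /inV[].
have FE w : disc z r w -> F w = F z + h w ^+ 2.
  by move=> /inV[ws _ _]; rewrite hE // addrC subrK.
exists r, h; split=> //; split=> //.
have [|phi sphi left_inverse] := square_chart_left_inverse r0 rD hz HhV _ FE.
  by move=> w /inV[].
have chart' : is_cderive (fun w => 2 * h w) z (2 * cderive h z).
  by apply: is_cderiveZ; exact: holomorphic_is_cderive Hh zs.
have D2h : D (2 * h z) by rewrite h0 mulr0.
have := is_cderive_comp chart' (holomorphic_is_cderive sphi.1 D2h).
move=> /(is_cderive_near r0 left_inverse) /is_cderive_uniq/(_ (is_cderive_id z)).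
by apply: contra_eqN => /eqP ->; rewrite !mulr0 eq_sym oner_eq0.
Qed.

Lemma universal_cderive2_neq0 z : D z -> gaussian (F z) ->
  cderive F z = 0 /\ cderive (cderive F) z != 0.
Proof.
move=> Dz hz; have [r [h [r0 rD Hh [h0 h'0] FE]]] := universal_square_chart Dz hz.
have F' w : disc z r w -> is_cderive F w (2 * (h w * cderive h w)).
  move=> wr; have h' := holomorphic_is_cderive Hh wr; have [s s0 sr] := disc_open wr.
  apply: (is_cderive_near s0 (fun y ys => esym (FE y (sr y ys)))).
  apply: is_cderive_eq (is_cderiveD (is_cderive_cst (F z) w) (is_cderiveX 2 h')) _.
  by rewrite add0r /= expr1 mulrA.
have zr := disc_center z r0.
split; first by rewrite (cderiveE (F' z zr)) h0 mul0r mulr0.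
have F'' := is_cderiveZ 2 (is_cderiveM (holomorphic_is_cderive Hh zr)
  (holomorphic_is_cderive (holomorphic_cderive Hh) zr)).
have F''E := is_cderive_near r0 (fun w wr => esym (cderiveE (F' w wr))) F''.
by rewrite (cderiveE F''E) h0 mul0r addr0 !mulf_neq0 // pnatr_eq0.
Qed.

Lemma universal_small_values : nc w0 <= 3 / 4 -> exists2 r : R, 0 <= r /\ r < 1 &
  forall w, nc w <= 3 / 4 -> exists2 x, nc x <= r & F x = w.
Proof.
move=> w034; pose k : R := 7 / 8; have [k0 k1] : 0 < k /\ k < 1 by rewrite /k; lra.
have kC0 : k%:C%C != 0 :> C by rewrite -nc_gt0 nc_real gtr0_norm.
pose s w : C := sqrtc (w / k%:C%C).
have sE w : k%:C%C * s w ^+ 2 = w by rewrite sqr_sqrtc mulrC divfK.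
have s_small w : nc w <= 3 / 4 -> nc (s w) <= 19 / 20.
  move=> w34; rewrite leNgt; apply/negP => big.
  have : nc (k%:C%C * s w ^+ 2) <= 3 / 4 by rewrite sE.
  by rewrite ncM ncX nc_real gtr0_norm // /k; nra.
have sD w : nc w <= 3 / 4 -> D (s w) by move=> /s_small; rewrite unit_discE; lra.
have [_ F0 _ _] := univF.
have [|phi [sphi _ GE]] := universal_lift (sD w0 w034) D0 universal_base_not_gaussian
  (even_over_square k0 k1 (@gaussian0 R)); first by rewrite add0r sE F0.
have [|r r01 phir] := @selfmap_compact _ phi (19 / 20) _ sphi; first by lra.
exists r => // w w34; exists (phi (s w)); first by apply: phir; exact: s_small.
by rewrite -GE ?add0r ?sE //; exact: sD.
Qed.

End Lifting.

Section DeckTransformations.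
Variable R : realType.
Local Notation C := (R[i]).
Implicit Types (s t x z : C) (f g : C -> C).
Local Notation D := (@unit_disc R).
Variables (F : C -> C) (w0 : C).
Hypothesis univF : universal_at F w0.
Let oD := @unit_disc_open R.
Let cD := @unit_disc_convex R.
Let HF := universal_holomorphic univF.

Definition deck t f := [/\ disc_aut f, gaussian t & forall z, D z -> F (f z) = F z + t].

Lemma deck_id : deck 0 id.
Proof. by split=> [| |z _]; [exact: disc_aut_id|exact: gaussian0|rewrite addr0]. Qed.

Lemma deck_comp s t f g : deck s f -> deck t g -> deck (s + t) (fun z => f (g z)).
Proof.
move=> [af hs fE] [ag ht gE]; split; [exact: disc_aut_comp|exact: gaussianD|].
by move=> z Dz; rewrite fE ?gE //; [rewrite -addrA [t + s]addrC|exact: ag.1.2].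
Qed.

Lemma deck_inv t f : deck t f -> exists g, [/\ deck (- t) g,
  forall z, D z -> g (f z) = z & forall z, D z -> f (g z) = z].
Proof.
move=> [[sf [g [sg gK fK]]] ht fE]; exists g; split=> //; split.
- by split=> //; exists f.
- exact: gaussianN.
- by move=> z Dz; rewrite -{2}(fK z Dz) fE ?addrK //; exact: sg.2.
Qed.

Lemma deck_exists t z x : D z -> D x -> gaussian t -> ~ gaussian (F z) -> F x = F z + t ->
  exists2 f, deck t f & f z = x.
Proof.
move=> Dz Dx ht nonz Fx; have [evF _ _ _] := univF.
have nonx : ~ gaussian (F x) by rewrite Fx => /(gaussian_translate _ ht).
have [f [sf fz fE]] := universal_lift univF Dz Dx nonx (even_over_translate oD ht evF) (esym Fx).
have [|g [sg gx gE]] := universal_lift univF Dx Dz nonz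
  (even_over_translate oD (gaussianN ht) evF); first by rewrite Fx addrK.
have [sgf sfg] := (selfmap_comp sg sf, selfmap_comp sf sg).
exists f => //; split=> //; last by move=> w Dw; rewrite -fE.
split=> //; exists g; split=> //.
- apply: (rigid_lift oD HF oD cD sgf.1 (holomorphic_id oD) sgf.2 Dz); rewrite ?fz ?gx //.
    exact: (universal_cderive_neq0 univF).
  by move=> w Dw; rewrite -gE ?fE; [rewrite -fE // addrK|exact: sf.2].
- apply: (rigid_lift oD HF oD cD sfg.1 (holomorphic_id oD) sfg.2 Dx); rewrite ?gx ?fz //.
    exact: (universal_cderive_neq0 univF).
  by move=> w Dw; rewrite -fE; [rewrite -gE // addrNK|exact: sg.2].
Qed.

Lemma deck_unique s f g z : deck s f -> deck s g -> D z -> ~ gaussian (F z) -> f z = g z ->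
  forall w, D w -> f w = g w.
Proof.
move=> [af hs fE] [ag _ gE] Dz nonz fg.
apply: (rigid_lift oD HF oD cD af.1.1 ag.1.1 af.1.2 Dz) => // [|w Dw]; last by rewrite fE ?gE.
apply: (universal_cderive_neq0 univF); first exact: af.1.2.
by rewrite fE // => /(gaussian_translate _ hs).
Qed.

End DeckTransformations.

(** * Cocompactness and division *)

Section PseudoDistanceBounds.
Variable R : realType.
Local Notation C := (R[i]).
Implicit Types (a p x w : C) (r : R).

Lemma blaschke_le_dist a p r : nc a <= r -> r < 1 -> nc p < 1 ->
  nc (blaschke a p) <= nc (p - a) / (1 - r).
Proof.
move=> ar r1 p1; have a1 : nc a < 1 by lra.
have den : 1 - r <= nc (1 - cconj a * p).
  have := ncB_ge 1 (cconj a * p); rewrite nc1 ncM nc_conj.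
  by have := nc_ge0 a; have := nc_ge0 p; nra.
rewrite /blaschke nc_div ler_wpM2l ?nc_ge0 // lef_pV2 ?posrE //; last lra.
by apply: lt_le_trans den; lra.
Qed.

Lemma blaschke_half_le x w r : nc x <= r -> r < 1 -> nc w <= 1 / 2 ->
  nc (blaschke x w) <= Num.sqrt (1 - (1 - r ^+ 2) * (3 / 16)).
Proof.
move=> xr r1 w2; have x0 := nc_ge0 x; have w0 := nc_ge0 w.
have [x1 w1] : nc x < 1 /\ nc w < 1 by lra.
rewrite -(@ler_pXn2r _ 2) ?nnegrE ?nc_ge0 ?sqrtr_ge0 // sqr_sqrtr; last by nra.
rewrite lerBrDr -lerBrDl one_sub_blaschke //.
rewrite ler_pdivlMr; last by rewrite exprn_gt0 // nc_gt0 blaschke_den_neq0.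
have den : nc (1 - cconj x * w) ^+ 2 <= 4.
  have : nc (1 - cconj x * w) <= 2.
    by apply: le_trans (ncB _ _) _; rewrite nc1 ncM nc_conj; nra.
  by have := nc_ge0 (1 - cconj x * w); nra.
have num : (1 - r ^+ 2) * (3 / 4) <= (1 - nc x ^+ 2) * (1 - nc w ^+ 2).
  by apply: ler_pM; nra.
have : (1 - r ^+ 2) * (3 / 16) * nc (1 - cconj x * w) ^+ 2 <= (1 - r ^+ 2) * (3 / 16) * 4.
  by apply: ler_wpM2l => //; nra.
by lra.
Qed.

Lemma finite_family_bound (T : finType) (f : T -> R) : (forall i, f i < 1) ->
  exists2 r, 0 <= r /\ r < 1 & forall i, f i <= r.
Proof.
move=> f1; exists (\big[Num.max/0]_i f i) => [|i]; last exact: le_bigmax.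
by split; [exact: bigmax_ge_id|apply: bigmax_lt => // i _; rewrite ltr01].
Qed.

Definition cell_center : C := Complex (1 / 2) (1 / 2).

Lemma nc_cell_center : nc cell_center <= 3 / 4.
Proof. by apply: nc_le34; rewrite /= ger0_norm //; lra. Qed.

Lemma cell_center_neq0 : cell_center != 0.
Proof. by apply/eqP => /(congr1 (@complex.Re R)) /= /eqP; rewrite gt_eqF //; lra. Qed.

Lemma cell_center_div_not_gaussian n : (0 < n)%N -> ~ gaussian (cell_center / n%:R).
Proof.
move=> n0; have nC0 : (n%:R : C) != 0 by rewrite pnatr_eq0 -lt0n.
apply: small_not_gaussian; first by rewrite mulf_neq0 ?cell_center_neq0 // invr_neq0.
have n1 : 1 <= n%:R :> R by rewrite ler1n.
by rewrite nc_div nc_nat ltr_pdivrMr ?ltr0n //; have := nc_cell_center; lra.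
Qed.

End PseudoDistanceBounds.

Section Cocompactness.
Variable R : realType.
Local Notation C := (R[i]).
Implicit Types (l s t x y z w : C) (f g gam : C -> C) (N n : nat).
Local Notation D := (@unit_disc R).
Variable F : C -> C.
Hypothesis univF : universal_at F (cell_center R).
Let D0 := @unit_disc0 R.

Let F0 : F 0 = cell_center R. Proof. by case: univF. Qed.

Lemma deck_small t : gaussian t -> nc (cell_center R + t) <= 3 / 4 -> exists gam, deck F t gam.
Proof.
move=> ht near; have [r [r0 r1] values] := universal_small_values univF (nc_cell_center R).
have [x xr Fx] := values _ near; have Dx : D x by rewrite unit_discE; lra.
have [|gam] := deck_exists univF D0 Dx ht (universal_base_not_gaussian univF); first by rewrite F0.
by exists gam.
Qed.

Lemma deck_mulz t gam (a : int) : deck F t gam -> exists gam', deck F (t *~ a) gam'.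
Proof.
move=> dg.
have pos n : exists gam', deck F (t *+ n) gam'.
  elim: n => [|n [g dg']]; first by exists id; exact: deck_id.
  by exists (fun z => gam (g z)); rewrite mulrS; exact: deck_comp.
case: a => n; first exact: pos.
have [g dg'] := pos n.+1; have [g' [dg'' _ _]] := deck_inv dg'.
by exists g'; rewrite NegzE mulrNz.
Qed.

Lemma deck_gaussian t : gaussian t -> exists gam, deck F t gam.
Proof.
have opposite v : gaussian (- v) -> nc (cell_center R - v) <= 3 / 4 -> exists gam, deck F v gam.
  move=> hv near; have [g dg] := deck_small hv near; have [g' [dg' _ _]] := deck_inv dg.
  by exists g'; rewrite -(opprK v).
have half (a : R) : a = 1 / 2 \/ a = - (1 / 2) -> `|a| <= 1 / 2.
  by case=> ->; rewrite ?normrN ger0_norm //; lra.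
have [g1 d1] : exists gam, deck F 1 gam.
  apply: opposite; first exact/gaussianN/gaussian1.
  by apply: nc_le34; apply: half => /=; [right|left]; lra.
have [gi di] : exists gam, deck F (Complex 0 1) gam.
  apply: opposite; first by apply: gaussianN; exists 0, 1.
  by apply: nc_le34; apply: half => /=; [left|right]; lra.
move=> [a [b ->]]; have [g3 d3] := deck_mulz a d1; have [g4 d4] := deck_mulz b di.
exists (fun z => g3 (g4 z)).
suff -> : Complex a%:~R b%:~R = 1 *~ a + (Complex 0 1 : C) *~ b by exact: deck_comp.
rewrite -[Complex 0 1 *~ b]mulrzr -!(rmorph_int (real_complex R)).
by apply/eqP; rewrite eq_complex /= !mul0r !mul1r ?subr0 ?addr0 ?add0r !eqxx.
Qed.

Lemma deck_residues N (s : R) : s < 1 -> exists2 r : R, 0 <= r /\ r < 1 &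
  forall i j, (i < N)%N -> (j < N)%N -> exists2 gam, deck F (Complex i%:R j%:R) gam &
    forall x, nc x <= s -> nc (gam x) <= r.
Proof.
move=> s1; have residue (p : 'I_N * 'I_N) : exists gr : (C -> C) * R,
    [/\ deck F (Complex p.1%:R p.2%:R) gr.1, gr.2 < 1 &
        forall x, nc x <= s -> nc (gr.1 x) <= gr.2].
  have [|gam dg] := @deck_gaussian (Complex p.1%:R p.2%:R).
    by exists (p.1 : nat), (p.2 : nat).
  have [ag _ _] := dg; have [r [_ r1] gr] := selfmap_compact s1 ag.1.
  by exists (gam, r).
have [gr grP] := choice residue.
have [|r r01 le_r] := finite_family_bound (f := fun p => (gr p).2) _.
  by move=> p; have [] := grP p.
exists r => // i j iN jN; have [dg _ bound] := grP (Ordinal iN, Ordinal jN).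
exists (gr (Ordinal iN, Ordinal jN)).1 => // x /bound.
by have := le_r (Ordinal iN, Ordinal jN); lra.
Qed.

Lemma cocompact_generic N : (0 < N)%N -> exists2 r : R, 0 <= r /\ r < 1 &
  forall z, D z -> ~ gaussian (F z) ->
    exists gam t, [/\ deck F t gam, gaussian_multiple N t & nc (gam z) <= r].
Proof.
move=> N0; have [s [s0 s1] values] := universal_small_values univF (nc_cell_center R).
have [r r01 residues] := deck_residues N s1; exists r => // z Dz nonlattice.
have [l hl near] := nearest_gaussian (F z).
have [i [j [iN jN multiple]]] := gaussian_residue N0 hl.
have [x xs Fx] := values _ near; have Dx : D x by rewrite unit_discE; lra.
have [c [ac _ cE] cr] := residues i j iN jN.
have mt := gaussian_multipleN multiple.
have Fc : F (c x) = F z + - (l - Complex i%:R j%:R) by rewrite cE // Fx; ring.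
have [gam dg gz] :=
  deck_exists univF Dz (ac.1.2 x Dx) (gaussian_multiple_gaussian mt) nonlattice Fc.
by exists gam, (- (l - Complex i%:R j%:R)); split=> //; rewrite gz; exact: cr.
Qed.

Lemma cocompact N : (0 < N)%N -> exists2 r : R, 0 <= r /\ r < 1 &
  forall z, D z -> exists gam t, [/\ deck F t gam, gaussian_multiple N t & nc (gam z) <= r].
Proof.
move=> /cocompact_generic[r [r0 r1] generic].
exists (Num.sqrt (1 - (1 - r ^+ 2) * (3 / 16))).
  by split; [exact: sqrtr_ge0|rewrite -[X in _ < X]sqrtr1 ltr_sqrt //; nra].
move=> z Dz; have z1 : nc z < 1 by rewrite -unit_discE.
have [|y [Dy yz] nonlattice] := universal_not_gaussian_near univF Dz (r := (1 - nc z) / 4).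
  by lra.
rewrite /disc /= in yz; have [gam [t [dg mt gy]]] := generic y Dy nonlattice.
exists gam, t; split=> //; have [ag _ _] := dg.
have [gy1 gz1] : nc (gam y) < 1 /\ nc (gam z) < 1 by rewrite -!unit_discE; split; exact: ag.1.2.
rewrite -(blaschkeK gy1 gz1); apply: blaschke_half_le => //; first by rewrite ncN.
rewrite disc_aut_dist //; have zy : nc y <= (1 + nc z) / 2 by have := ncB_ge y z; lra.
apply: le_trans (blaschke_le_dist zy _ z1) _; first lra.
by rewrite nc_distC ler_pdivrMr; lra.
Qed.

End Cocompactness.

Section Division.
Variable R : realType.
Local Notation C := (R[i]).
Implicit Types (s t x y z w : C) (f g gam : C -> C) (n : nat).
Local Notation D := (@unit_disc R).
Local Notation lattice := (@gaussian R).
Variable F : C -> C.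
Hypothesis univF : universal_at F (cell_center R).
Let oD := @unit_disc_open R.
Let cD := @unit_disc_convex R.
Let D0 := @unit_disc0 R.
Let HF := universal_holomorphic univF.

Let F0 : F 0 = cell_center R. Proof. by case: univF. Qed.

(* f covers multiplication by 1/n on C. *)
Definition divides_by n f := selfmap f /\ forall z, D z -> F (f z) = F z / n%:R.

Lemma even_over_div n : (0 < n)%N -> even_over lattice (fun z => n%:R^-1 * F z) D.
Proof.
move=> n0; have nC0 : (n%:R : C) != 0 by rewrite pnatr_eq0 -lt0n.
split=> [|l z hl Dz]; first exact: holomorphicZ.
have hnl : gaussian (n%:R * l) by rewrite mulr_natl; exact: gaussian_mulrn.
have [[_ ev] _ _ _] := univF.
by apply: square_at_eq (square_atM (square_at_cst n%:R^-1 z) (ev _ z hnl Dz)) => w; field.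
Qed.

Lemma division_exists n : (0 < n)%N -> exists f, divides_by n f.
Proof.
move=> n0; have [r [r0 r1] values] := universal_small_values univF (nc_cell_center R).
have [|x xr Fx] := values (cell_center R / n%:R).
  rewrite nc_div nc_nat; apply: le_trans (nc_cell_center R).
  by rewrite ler_pdivrMr ?ltr0n // ler_peMr ?nc_ge0 // ler1n.
have Dx : D x by rewrite unit_discE; lra.
have [||f [sf _ fE]] := universal_lift univF D0 Dx _ (even_over_div n0).
- by rewrite Fx; exact: cell_center_div_not_gaussian.
- by rewrite F0 Fx mulrC.
by exists f; split=> // z Dz; rewrite -fE // mulrC.
Qed.

Lemma division_equivariant n f s gam : (0 < n)%N -> divides_by n f -> gaussian s ->
  deck F (n%:R * s) gam ->
  exists2 gam', deck F s gam' & forall z, D z -> f (gam z) = gam' (f z).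
Proof.
move=> n0 [sf fE] hs [ag _ gE]; have nC0 : (n%:R : C) != 0 by rewrite pnatr_eq0 -lt0n.
have Df0 := sf.2 0 D0; have Dg0 := ag.1.2 0 D0; have Dfg0 := sf.2 _ Dg0.
have non0 : ~ gaussian (F (f 0)) by rewrite fE // F0; exact: cell_center_div_not_gaussian.
have Ffg0 : F (f (gam 0)) = F (f 0) + s by rewrite !fE // gE //; field.
have [gam' dg' g'0] := deck_exists univF Df0 Dfg0 hs non0 Ffg0.
exists gam' => //; have [ag' _ g'E] := dg'.
have [sfg sgf] := (selfmap_comp sf ag.1, selfmap_comp ag'.1 sf).
apply: (rigid_lift oD HF oD cD sfg.1 sgf.1 sfg.2 D0) => // [|z Dz].
  by apply: (universal_cderive_neq0 univF Dfg0); rewrite Ffg0 => /(gaussian_translate _ hs).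
rewrite fE ?gE ?g'E //; [|exact: sf.2|exact: ag.1.2].
by rewrite fE //; field.
Qed.

Lemma universal_isolated_fiber x : D x ->
  exists2 d : R, 0 < d & forall y, disc x d y -> F y = F x -> y = x.
Proof.
move=> Dx; have [hx|nonlattice] := pselect (gaussian (F x)).
- have [r [h [r0 rD Hh [h0 h'0] FE]]] := universal_square_chart univF Dx hx.
  have [d d0 inj] := local_injective r0 Hh h'0.
  exists (Num.min d r) => [|y]; first by rewrite lt_min d0.
  rewrite /disc /= lt_min => /andP[yd yr] Fy; apply: inj => //; first exact: disc_center.
  by apply/eqP; rewrite h0 -sqrf_eq0 -(inj_eq (addrI (F x))) addr0 -FE ?Fy.
- have [r r0 rD] := oD Dx.
  have [d d0 inj] := local_injective r0 (holomorphic_sub rD HF)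
    (universal_cderive_neq0 univF Dx nonlattice).
  by exists d => // y yd; apply: inj => //; exact: disc_center.
Qed.

Lemma constant_on_fiber g : holomorphic D g -> D (g 0) ->
  (forall z, D z -> D (g z) -> F (g z) = F (g 0)) -> forall z, D z -> g z = g 0.
Proof.
move=> Hg Dg0 Fg z Dz.
have [d d0 isolated] := universal_isolated_fiber Dg0; have [r r0 rD] := oD Dg0.
have m0 : 0 < Num.min d r by rewrite lt_min d0.
have [e e0 near] := holomorphic_continuous Hg D0 m0.
apply/eqP; rewrite -subr_eq0; apply/eqP.
apply: (@identity_theorem _ D (fun z => g z - g 0) 0 (Num.min e 1)) => //.
- exact: holomorphicBc.
- by rewrite lt_min e0 ltr01.
move=> w; rewrite /disc /= lt_min => /andP[we w1].
have := near w we; rewrite lt_min => /andP[gd gr].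
by rewrite (isolated (g w)) ?subrr //; apply: Fg => //; exact: rD.
Qed.

(* The limit g of the maps gs along the ultrafilter has F o g constant, hence is constant. *)
Lemma uconverges_oscillation (gs : nat -> C -> C) (zs : nat -> C) (r s : R) :
  r < 1 -> s < 1 -> (forall n, selfmap (gs n)) -> (forall n, nc (gs n 0) <= r) ->
  (forall n, nc (zs n) <= s) ->
  (forall z, D z -> uconverges (fun n => F (gs n z) - F (gs n 0)) 0) ->
  uconverges (fun n => gs n (zs n) - gs n 0) 0.
Proof.
move=> r1 s1 sgs gs0r zss Fgs.
have bounded : locally_bounded gs D.
  move=> z Dz; have [t t0 tD] := oD Dz; exists t, 1; split=> //.
  apply: filterE => n; split; first exact: holomorphic_sub (sgs n).1.
  by move=> w /tD /(sgs n).2; rewrite unit_discE => /ltW.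
pose g := ulim_fun gs; have Hg : holomorphic D g by exact: holomorphic_ulim_fun.
have lim z : D z -> uconverges (fun n => gs n z) (g z) := uconverges_ulim_fun bounded.
have Dg0 : D (g 0).
  by rewrite unit_discE; apply: le_lt_trans r1; apply: uconverges_le (lim 0 D0) _; exact: filterE.
have constant : forall z, D z -> g z = g 0.
  apply: (constant_on_fiber Hg Dg0) => z Dz Dgz; apply/eqP; rewrite -subr_eq0; apply/eqP.
  apply: uconverges_uniq (Fgs z Dz); apply: uconvergesB.
    exact: uconverges_comp (lim z Dz) (holomorphic_continuous HF Dgz).
  exact: uconverges_comp (lim 0 D0) (holomorphic_continuous HF Dg0).
have zs_bounded : ultra [set n | nc (zs n) <= s] by exact: filterE.
have limz := ulimP zs_bounded; have Dlim : D (ulim zs).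
  by rewrite unit_discE; apply: le_lt_trans s1; exact: uconverges_le limz _.
have := uconvergesB (uconverges_ulim_fun_comp bounded Dlim limz) (lim 0 D0).
by rewrite -/g constant // subrr.
Qed.

Lemma normalised_division (r : R) n f z :
  (forall x, D x -> exists gam t, deck F t gam /\ nc (gam x) <= r) ->
  divides_by n.+1 f -> D z ->
  exists g, [/\ selfmap g, nc (g 0) <= r,
    forall y, D y -> nc (F (g y) - F (g 0)) <= 48 / (1 - nc y) * nc y / n.+1%:R &
    forall y, D y -> nc (blaschke (g 0) (g y)) = nc (recentre z (f z) f y)].
Proof.
move=> cpt [sf fE] Dz; have zN1 : nc (- z) < 1 by rewrite ncN -unit_discE.
have smb := selfmap_blaschke zN1; have Dm y : D y -> D (blaschke (- z) y) by exact: smb.2.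
have Dfm y : D y -> D (f (blaschke (- z) y)) by move=> /Dm /sf.2.
have [gam [t [[ag ht gE] gr]]] := cpt (f z) (sf.2 z Dz).
have m0 : blaschke (- z) 0 = z by rewrite blaschke_0 opprK.
exists (fun y => gam (f (blaschke (- z) y))); split; rewrite ?m0 //.
- by apply: (selfmap_comp ag.1); exact: selfmap_comp.
- move=> y Dy; have y1 : nc y < 1 by rewrite -unit_discE.
  rewrite !gE ?fE //; [|exact: Dm|exact: sf.2|exact: Dfm].
  have -> : F (blaschke (- z) y) / n.+1%:R + t - (F z / n.+1%:R + t) =
     (F (blaschke (- z) y) - F z) / n.+1%:R by ring.
  rewrite nc_div nc_nat ler_pM2r ?invr_gt0 ?ltr0n //; have [evF _ _ _] := univF.
  by have := landau_growth y1 (even_over_selfmap evF smb) (lexx (nc y)); rewrite m0.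
- by move=> y Dy; rewrite disc_aut_dist //; [exact: sf.2|exact: Dfm].
Qed.

Lemma division_contracts (eta s : R) : 0 < eta -> s < 1 ->
  exists2 n, (1 < n)%N & forall f z y, divides_by n f -> D z -> nc y <= s ->
    nc (recentre z (f z) f y) <= eta.
Proof.
move=> eta0 s1; apply: contrapT => none.
have [r [r0 r1] cpt] := cocompact univF (ltn0Sn 0).
have counterexample (n : nat) : exists d : (C -> C) * C,
    [/\ selfmap d.1, nc (d.1 0) <= r, nc d.2 <= s,
        eta < nc (blaschke (d.1 0) (d.1 d.2)) &
        forall y, D y -> nc (F (d.1 y) - F (d.1 0)) <= 48 / (1 - nc y) * nc y / n.+2%:R].
  apply: contrapT => noex; apply: none; exists n.+2 => // f z y df Dz ys.
  rewrite leNgt; apply/negP => bad; have Dy : D y by rewrite unit_discE; lra.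
  have [|g [sg gr Fg dist]] := @normalised_division r n.+1 f z _ df Dz.
    by move=> x /cpt[gam [t [dg _ gr]]]; exists gam, t.
  by apply: noex; exists (g, y); split=> //=; rewrite dist.
have [d dP] := choice counterexample.
have osc : uconverges (fun n => (d n).1 (d n).2 - (d n).1 0) 0.
  apply: (@uconverges_oscillation (fun n => (d n).1) (fun n => (d n).2) r s) => //.
  - by move=> n; have [] := dP n.
  - by move=> n; have [] := dP n.
  - by move=> n; have [] := dP n.
  move=> y; rewrite unit_discE => y1 e e0; set K := 48 / (1 - nc y) * nc y.
  have K0 : 0 <= K by rewrite mulr_ge0 ?nc_ge0 // divr_ge0 //; lra.
  have eK : 0 < e / (K + 1) by rewrite divr_gt0 //; lra.
  apply: filterS (ultra_harmonic_lt eK) => n /= small; rewrite subr0.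
  have [_ _ _ _ Fg] := dP n; apply: le_lt_trans (Fg y _) _; first by rewrite unit_discE.
  rewrite -/K ltr_pdivrMr ?ltr0n //; move: small.
  rewrite ltr_pdivlMr ?ltr_pdivrMl ?ltr0n //; last lra.
  by rewrite -[n.+2]addn1 natrD; lra.
have er : 0 < eta * (1 - r) by rewrite mulr_gt0 //; lra.
have [n /= small] := filter_ex (osc _ er); rewrite subr0 in small.
have [sg gr ys bad _] := dP n.
have Dg : nc ((d n).1 (d n).2) < 1 by rewrite -unit_discE; apply: sg.2; rewrite unit_discE; lra.
have := blaschke_le_dist gr r1 Dg; rewrite ler_pdivlMr; first by nra.
by lra.
Qed.

End Division.

(** * A torsion-free subgroup *)

Section Parity.
Variable T : zmodType.
Implicit Types (s : T -> bool) (r : seq T).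

Definition finite_support s := exists r, forall i, s i -> i \in r.

(* Meaningful for s of finite support only. *)
Definition parity s : bool := \big[addb/false]_(i \in [set: T]) s i.

Lemma parityE s r : uniq r -> (forall i, s i -> i \in r) ->
  parity s = \big[addb/false]_(i <- r) s i.
Proof.
move=> ur sr; rewrite /parity (@fsbigE _ false addb _ _ r) // => [|i _].
  by apply: eq_bigl => i; rewrite in_setT.
by apply: contraNF => /sr.
Qed.

Lemma parity_addb s1 s2 : finite_support s1 -> finite_support s2 ->
  parity (fun i => s1 i (+) s2 i) = parity s1 (+) parity s2.
Proof.
move=> [r1 sr1] [r2 sr2]; pose r := undup (r1 ++ r2); have ur : uniq r by exact: undup_uniq.
have in1 i : s1 i -> i \in r by move=> /sr1 ir; rewrite mem_undup mem_cat ir.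
have in2 i : s2 i -> i \in r by move=> /sr2 ir; rewrite mem_undup mem_cat ir orbT.
rewrite !(@parityE _ r) // => [|i]; first by rewrite big_split.
by case E: (s1 i) => /= s2i; [exact: in1|apply: in2; move: s2i; case: (s2 i)].
Qed.

Lemma finite_support_shift s p : finite_support s -> finite_support (fun i => s (i - p)).
Proof.
move=> [r sr]; exists [seq i + p | i <- r] => i /sr ir.
by apply/mapP; exists (i - p) => //; rewrite subrK.
Qed.

Lemma parity_shift s p : finite_support s -> parity (fun i => s (i - p)) = parity s.
Proof.
move=> [r sr]; have ur : uniq (undup r) by exact: undup_uniq.
have in_r i : s i -> i \in undup r by move=> /sr; rewrite mem_undup.
rewrite (@parityE s (undup r)) // (@parityE _ [seq i + p | i <- undup r]).
- by rewrite big_map; apply: eq_bigr => i _; rewrite addrK.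
- by rewrite map_inj_uniq //; exact: addIr.
- by move=> i /in_r ir; apply/mapP; exists (i - p) => //; rewrite subrK.
Qed.

Lemma parity_false s : (forall i, s i = false) -> parity s = false.
Proof. by move=> s0; rewrite (@parityE _ [::]) ?big_nil // => i; rewrite s0. Qed.

Lemma parity_single s i0 : s i0 -> (forall i, i != i0 -> s i = false) -> parity s = true.
Proof.
move=> si0 s0; rewrite (@parityE _ [:: i0]) ?big_seq1 // => i si.
by rewrite inE; apply: contraTT si => /s0 ->.
Qed.

End Parity.

Lemma finite_support_box (s : int * int -> bool) (K : nat) :
  (forall i, s i -> (`|i.1| <= K)%N /\ (`|i.2| <= K)%N) -> finite_support s.
Proof.
move=> sK; pose range := [seq Posz k - Posz K | k <- iota 0 (2 * K).+1].
have in_range (a : int) : (`|a| <= K)%N -> a \in range.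
  move=> aK; apply/mapP; exists (`|(a + Posz K)%R|%N); last by lia.
  by rewrite mem_iota add0n; lia.
exists [seq (a, b) | a <- range, b <- range] => -[a b] /sK[aK bK].
by apply/allpairsPdep; exists a, b; split=> //; exact: in_range.
Qed.

Section SimpleZeros.
Variable R : realType.
Local Notation C := (R[i]).
Implicit Types (z : C) (f g h k u : C -> C) (U : set C) (r : R).

Lemma fixed_point_critical U g f z : copen U -> holomorphic U g -> is_cderive f z (cderive f z) ->
  U z -> f z = z -> cderive f z != 1 -> (forall w, U w -> g (f w) = g w) -> cderive g z = 0.
Proof.
move=> oU Hg f' Uz fz f'1 gf; have g' := holomorphic_is_cderive Hg Uz.
have [r r0 rU] := oU z Uz.
have composed : is_cderive (fun w => g (f w)) z (cderive g z * cderive f z).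
  by apply: is_cderive_comp => //; rewrite fz.
have := is_cderive_uniq (is_cderive_near r0 (fun w wr => gf w (rU w wr)) composed) g'.
move/eqP; rewrite -subr_eq0 -{2}[cderive g z]mulr1 -mulrBr mulf_eq0 subr_eq0 (negbTE f'1) orbF.
by move/eqP.
Qed.

Lemma sqrt_simple_zero U k h u z : copen U -> holomorphic U k -> holomorphic U h ->
  holomorphic U u -> (forall w, U w -> k w ^+ 2 = h w ^+ 2 * u w) -> U z -> h z = 0 ->
  cderive h z != 0 -> u z != 0 -> cderive k z != 0.
Proof.
move=> oU Hk Hh Hu kE Uz hz h'0 uz.
have [s s0 [v Hv vE]] := square_at_neq0 oU Hu Uz uz; have [t t0 tU] := oU z Uz.
pose V := disc z (Num.min s t); have r0 : 0 < Num.min s t by rewrite lt_min s0.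
have [Vs VU] : V `<=` disc z s /\ V `<=` U.
  by split=> [w|w]; rewrite /V /disc /= lt_min => /andP[] // _ /tU.
have Vz : V z by exact: disc_center.
have vz : v z != 0 by rewrite -sqrf_eq0 vE //; exact: disc_center.
have oV : copen V by exact: disc_open.
have HhV := holomorphic_sub VU Hh; have HvV := holomorphic_sub Vs Hv.
have hv' : is_cderive (fun w => h w * v w) z (cderive h z * v z).
  apply: is_cderive_eq (is_cderiveM (holomorphic_is_cderive HhV Vz)
    (holomorphic_is_cderive HvV Vz)) _.
  by rewrite hz mul0r addr0.
have [|e|e] := sqrt_unique (@disc_convex R z (Num.min s t)) oV (holomorphic_sub VU Hk)
  (holomorphicM oV HhV HvV).
- by move=> w Vw; rewrite exprMn kE ?vE //; [exact: Vs|exact: VU].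
- by rewrite (cderiveE (is_cderive_near r0 (fun w wr => esym (e w wr)) hv')) mulf_neq0.
- have hvN' := is_cderiveZ (-1) hv'.
  have eN w : V w -> -1 * (h w * v w) = k w by move=> /e ->; rewrite mulN1r.
  by rewrite (cderiveE (is_cderive_near r0 eN hvN')) !mulf_neq0 // oppr_eq0 oner_eq0.
Qed.

End SimpleZeros.

Section FarRoot.
Variable R : realType.
Local Notation C := (R[i]).
Implicit Types (v z : C) (V : C -> C) (U : set C).

(* The square root of v^2 - 1/4 that is close to v for large v. *)
Definition far_root v : C := v * principal_sqrt (1 - (4 * v ^+ 2)^-1).

Lemma far_root_sqr v : v != 0 -> far_root v ^+ 2 = v ^+ 2 - 1 / 4.
Proof. by move=> v0; rewrite exprMn sqr_principal_sqrt; field. Qed.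

Lemma holomorphic_far_root U V : copen U -> holomorphic U V ->
  (forall z, U z -> 1 / 2 < nc (V z)) -> holomorphic U (fun z => far_root (V z)).
Proof.
move=> oU HV far; apply: holomorphicM => //.
have V2 z : U z -> 1 < 4 * nc (V z) ^+ 2.
  by move=> /far farz; have := nc_ge0 (V z); nra.
have V4 z : U z -> 4 * V z ^+ 2 != 0.
  by move=> /V2 V2z; rewrite -nc_gt0 ncM nc_nat ncX; lra.
apply: (holomorphic_comp oU (@right_half_plane_open R) _ _ (@holomorphic_principal_sqrt R)).
  move=> z Uz; apply: disc1_right_half_plane.
  rewrite addrAC subrr add0r ncN ncV invf_lt1 ?ncM ?nc_nat ?ncX; first exact: V2.
  by have := V2 z Uz; lra.
apply: holomorphicB => //; first exact: holomorphic_cst.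
by apply: holomorphicV => //; apply: holomorphicZ => //; exact: holomorphicX.
Qed.

End FarRoot.

Section TorsionFree.
Variable R : realType.
Local Notation C := (R[i]).
Implicit Types (t x z w : C) (f g gam : C -> C) (i p q : int * int) (n m : nat).
Local Notation D := (@unit_disc R).
Variable F : C -> C.
Hypothesis univF : universal_at F (cell_center R).
Let oD := @unit_disc_open R.
Let cD := @unit_disc_convex R.
Let D0 := @unit_disc0 R.
Let HF := universal_holomorphic univF.

Let F0 : F 0 = cell_center R. Proof. by case: univF. Qed.

(* The lattice is cut into the pairs {pair_base i, pair_base i + 1}.  For all but finitely many i
   the square root of the polynomial of the pair is the far root of F - pair_base i - 1/2 both at
   0 and at gam 0, so a deck transformation gam changes the sign of finitely many of these square
   roots only; [flip_parity] is the parity of their number. *)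
Definition pair_base i : C := Complex (2 * i.1)%:~R (i.2)%:~R.

Lemma pair_baseD i p : pair_base (i + p) = pair_base i + pair_base p.
Proof. by rewrite /pair_base /= mulrDr !rmorphD. Qed.

Lemma pair_baseN p : pair_base (- p) = - pair_base p.
Proof. by rewrite /pair_base /= mulrN !rmorphN. Qed.

Lemma pair_baseB i p : pair_base (i - p) = pair_base i - pair_base p.
Proof. by rewrite pair_baseD pair_baseN. Qed.

Lemma pair_base0 : pair_base 0 = 0.
Proof. by []. Qed.

Lemma pair_base_inj : injective pair_base.
Proof. by move=> [a b] [a' b'] [] /intr_inj /= e /intr_inj ->; congr pair; lia. Qed.

Lemma pair_base_gaussian i : gaussian (pair_base i).
Proof. by exists (2 * i.1), i.2. Qed.

Definition pair_mid i z := F z - pair_base i - 1 / 2.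

Definition pair_poly i z := (F z - pair_base i) * (F z - pair_base i - 1).

Lemma pair_polyE i z : pair_poly i z = pair_mid i z ^+ 2 - 1 / 4.
Proof. by rewrite /pair_poly /pair_mid; field. Qed.

Lemma holomorphic_pair_mid i : holomorphic D (pair_mid i).
Proof. by do 2!apply: holomorphicBc => //. Qed.

Lemma pair_mid0_neq0 i : pair_mid i 0 != 0.
Proof.
rewrite /pair_mid F0; apply/eqP => /(congr1 (@complex.Im R)).
have -> : (1 / 2 : C) = (1 / 2 : R)%:C%C by rewrite rmorphM fmorphV rmorph_nat rmorph1.
rewrite /= oppr0 addr0 => /eqP; rewrite subr_eq0 => /eqP E.
have : (1 : R) = (2 * i.2)%:~R by rewrite intrM -E; field.
by move=> /esym/eqP; rewrite -[1]/(1%:~R) eqr_int => /eqP; lia.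
Qed.

Lemma pair_sqrt_exists i : exists2 k, holomorphic D k &
  (forall z, D z -> k z ^+ 2 = pair_poly i z) /\ k 0 = far_root (pair_mid i 0).
Proof.
have [[_ ev] _ _ _] := univF.
apply: square_on_through; [exact: oD|exact: D0| |].
  by rewrite pair_polyE far_root_sqr // pair_mid0_neq0.
apply: square_on_disc => [|z Dz].
  by apply: holomorphicM => //; do ?apply: holomorphicBc => //.
apply: square_atM; first exact: ev _ z (pair_base_gaussian i) Dz.
apply: square_at_eq (ev _ z (gaussianD (pair_base_gaussian i) (@gaussian1 R)) Dz) => w; ring.
Qed.

Definition pair_sqrt i := s2val (cid2 (pair_sqrt_exists i)).

Lemma holomorphic_pair_sqrt i : holomorphic D (pair_sqrt i).
Proof. exact: s2valP (cid2 (pair_sqrt_exists i)). Qed.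

Lemma pair_sqrt_sqr i z : D z -> pair_sqrt i z ^+ 2 = pair_poly i z.
Proof. by have [sqr _] := s2valP' (cid2 (pair_sqrt_exists i)); exact: sqr. Qed.

Lemma pair_sqrt_0 i : pair_sqrt i 0 = far_root (pair_mid i 0).
Proof. by have [] := s2valP' (cid2 (pair_sqrt_exists i)). Qed.

Lemma pair_sqrt0_neq0 i : pair_sqrt i 0 != 0.
Proof.
have nonlattice := universal_base_not_gaussian univF.
rewrite -sqrf_eq0 pair_sqrt_sqr // mulf_neq0 //.
  rewrite subr_eq0; apply: contra_notN nonlattice => /eqP ->; exact: pair_base_gaussian.
rewrite -addrA -opprD subr_eq0; apply: contra_notN nonlattice => /eqP ->.
by apply: gaussianD; [exact: pair_base_gaussian|exact: gaussian1].
Qed.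

Lemma neq_opp x : x != 0 -> - x != x.
Proof. by move=> x0; rewrite -subr_eq0 -opprD oppr_eq0 -mulr2n mulrn_eq0. Qed.

Lemma pair_sqrt_far i (s : R) z : 0 < s -> s <= 1 ->
  (forall w, disc 0 s w -> 1 / 2 < nc (pair_mid i w)) -> disc 0 s z ->
  pair_sqrt i z = far_root (pair_mid i z).
Proof.
move=> s0 s1 far zs; have sD : disc 0 s `<=` D by exact: disc_mono.
have oU := @disc_open R 0 s; have U0 := disc_center 0 s0.
have Hmid := holomorphic_sub sD (holomorphic_pair_mid i).
have [|e|e] := sqrt_unique (@disc_convex R 0 s) oU (holomorphic_sub sD (holomorphic_pair_sqrt i))
  (holomorphic_far_root oU Hmid far).
- move=> w ws; rewrite pair_sqrt_sqr ?pair_polyE ?far_root_sqr //; last exact: sD.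
  by rewrite -nc_gt0; have := far w ws; lra.
- exact: e.
- have := neq_opp (pair_sqrt0_neq0 i).
  by rewrite {1}(e 0 U0) opprK -pair_sqrt_0 eqxx.
Qed.

Definition sign_flip gam p i : bool := pair_sqrt i (gam 0) != pair_sqrt (i - p) 0.

Lemma sign_flipP gam p i z : deck F (pair_base p) gam -> D z ->
  pair_sqrt i (gam z) =
  if sign_flip gam p i then - pair_sqrt (i - p) z else pair_sqrt (i - p) z.
Proof.
move=> [ag _ gE] Dz; have Hk := holomorphic_pair_sqrt.
have Hkg := holomorphic_comp oD oD ag.1.2 ag.1.1 (Hk i).
have [y Dy|e|e] := sqrt_unique cD oD Hkg (Hk (i - p)).
- rewrite !pair_sqrt_sqr //; last exact: ag.1.2.
  by rewrite /pair_poly gE // pair_baseB; ring.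
- by rewrite /sign_flip (e 0 D0) eqxx /= e.
- by rewrite /sign_flip (e 0 D0) neq_opp ?pair_sqrt0_neq0 // e.
Qed.

Lemma sign_flip_bounded gam p : deck F (pair_base p) gam ->
  exists M : R, forall i, sign_flip gam p i -> nc (pair_base i) <= M.
Proof.
move=> [ag _ gE]; have g1 : nc (gam 0) < 1 by rewrite -unit_discE; exact: ag.1.2.
pose s := (1 + nc (gam 0)) / 2; have [s0 s1] : 0 < s /\ s < 1.
  by rewrite /s; have := nc_ge0 (gam 0); lra.
have [M _ bM] := holomorphic_bounded s1 HF.
exists (M + 1) => i; apply: contraTT; rewrite -ltNge => big.
have far w : disc 0 s w -> 1 / 2 < nc (pair_mid i w).
  rewrite /disc /= => /ltW/bM FM; have := ncB_ge (pair_base i) (F w - 1 / 2).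
  have -> : pair_base i - (F w - 1 / 2) = - pair_mid i w by rewrite /pair_mid; ring.
  have := ncB (F w) (1 / 2); rewrite ncN nc_div nc1 nc_nat; lra.
rewrite negbK (pair_sqrt_far s0 (ltW s1) far); last by rewrite disc0E /s; lra.
suff -> : pair_mid i (gam 0) = pair_mid (i - p) 0 by rewrite pair_sqrt_0.
by rewrite /pair_mid gE // pair_baseB; ring.
Qed.

Lemma finite_support_sign_flip gam p : deck F (pair_base p) gam ->
  finite_support (sign_flip gam p).
Proof.
move=> /sign_flip_bounded[M bM]; pose K := (Num.truncn M).+1.
have MK : M < K%:R by exact: truncnS_gt.
have int_le (a : int) : `|a%:~R| <= M -> (`|a| <= K)%N.
  move=> aM; rewrite -(ler_nat R) -[(`|a|%N)%:R]/((`|a|%N : int)%:~R) abszE intr_norm; lra.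
apply: (@finite_support_box _ K) => i /bM bi; split; apply: int_le; last first.
  exact: le_trans (Im_le_nc (pair_base i)) bi.
have := le_trans (Re_le_nc (pair_base i)) bi; rewrite /= intrM normrM ger0_norm ?ler0z //.
by have := normr_ge0 (i.1%:~R : R); lra.
Qed.

Definition flip_parity gam p := parity (sign_flip gam p).

Lemma flip_parity_comp f g p q : deck F (pair_base p) f -> deck F (pair_base q) g ->
  flip_parity (fun z => f (g z)) (p + q) = flip_parity f p (+) flip_parity g q.
Proof.
move=> df dg; have [ag _ _] := dg; have Dg0 := ag.1.2 0 D0.
have flip_comp : sign_flip (fun z => f (g z)) (p + q) =
    (fun i => sign_flip f p i (+) sign_flip g q (i - p)).
  apply/funext => i; rewrite {1}/sign_flip (sign_flipP i df Dg0) (sign_flipP (i - p) dg D0).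
  rewrite opprD addrA; have ne := neq_opp (pair_sqrt0_neq0 (i - p - q)).
  by case: (sign_flip f p i); case: (sign_flip g q (i - p)) => /=; rewrite ?opprK ?eqxx ?ne.
have [sf sg] := (finite_support_sign_flip df, finite_support_sign_flip dg).
rewrite /flip_parity flip_comp parity_addb //; last exact: finite_support_shift.
by rewrite (parity_shift _ sg).
Qed.

Lemma flip_parity_fix0 gam : gam 0 = 0 -> flip_parity gam 0 = false.
Proof. by move=> g0; apply: parity_false => i; rewrite /sign_flip g0 subr0 eqxx. Qed.

Definition even_deck n gam := exists p,
  [/\ deck F (pair_base p) gam, gaussian_multiple n (pair_base p) & flip_parity gam p = false].

Lemma even_deck_id n : even_deck n id.
Proof.
exists 0; rewrite pair_base0; split; [exact: deck_id|exact: gaussian_multiple0|].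
exact: flip_parity_fix0.
Qed.

Lemma even_deck_comp n f g : even_deck n f -> even_deck n g -> even_deck n (fun z => f (g z)).
Proof.
move=> [p [dp mp ep]] [q [dq mq eq]]; exists (p + q); split.
- by rewrite pair_baseD; exact: deck_comp.
- by rewrite pair_baseD; exact: gaussian_multipleD.
- by rewrite flip_parity_comp // ep eq.
Qed.

Lemma even_deck_inv n f : even_deck n f -> exists g, [/\ even_deck n g,
  forall z, D z -> g (f z) = z & forall z, D z -> f (g z) = z].
Proof.
move=> [p [dp mp ep]]; have [g [dg gK fK]] := deck_inv dp.
exists g; split=> //; exists (- p); rewrite -pair_baseN in dg; split=> //.
  by rewrite pair_baseN; exact: gaussian_multipleN.
have := flip_parity_comp dg dp; rewrite ep addbF addNr => <-.
by apply: flip_parity_fix0; rewrite gK.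
Qed.

Lemma pair_poly_zero z : gaussian (F z) -> exists i0, pair_poly i0 z = 0 /\
  forall i, i != i0 -> pair_poly i z != 0.
Proof.
move=> [a [b E]]; pose i0 : int * int := ((a %/ 2)%Z, b).
have poly0 i : (pair_poly i z == 0) = (i.2 == b) && ((a == 2 * i.1) || (a == 2 * i.1 + 1)).
  rewrite mulf_eq0 subr_eq0 -addrA -opprD subr_eq0 E.
  have -> : pair_base i + 1 = Complex (2 * i.1 + 1)%:~R (i.2)%:~R.
    by rewrite /pair_base intrD /GRing.add /= addr0.
  rewrite /pair_base !eq_complex /= !eqr_int; rewrite [b == _]eq_sym.
  by case: (i.2 == b); rewrite ?andbT ?andbF.
exists i0; split; first by apply/eqP; rewrite poly0 /= eqxx /=; lia.
move=> [i1 i2]; rewrite poly0 /=; apply: contra => /andP[/eqP -> ai].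
by apply/eqP; congr pair; lia.
Qed.

Lemma pair_sqrt_simple_zero i z : D z -> gaussian (F z) -> pair_poly i z = 0 ->
  cderive (pair_sqrt i) z != 0.
Proof.
move=> Dz hz poly0; have [r [h [r0 rD Hh [hz0 h'0] FE]]] := universal_square_chart univF Dz hz.
have oU := @disc_open R z r; have zr := disc_center z r0.
pose e := 2 * (F z - pair_base i) - 1.
apply: (@sqrt_simple_zero _ (disc z r) _ h (fun w => h w ^+ 2 + e)) => //.
- exact: holomorphic_sub rD (holomorphic_pair_sqrt i).
- by apply: holomorphicD => //; [exact: holomorphicX|exact: holomorphic_cst].
- move=> w wr; rewrite pair_sqrt_sqr; last exact: rD.
  rewrite -[LHS]subr0 -poly0 /pair_poly FE // /e; ring.
- rewrite hz0 expr0n add0r /e; move/eqP: poly0; rewrite mulf_eq0 => /orP[/eqP -> |].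
    by rewrite mulr0 sub0r oppr_eq0 oner_eq0.
  by rewrite subr_eq0 => /eqP ->; rewrite mulr1 -[2]/(1 + 1) addrK oner_eq0.
Qed.

(* If gam is not the identity near its fixed point z, then F z lies in the lattice; the square
   root attached to the pair of F z has a simple zero at z and changes sign, the other ones do not
   vanish at z and do not: the parity is odd. *)
Lemma even_deck_fixed gam z : deck F 0 gam -> flip_parity gam 0 = false -> D z -> gam z = z ->
  forall w, D w -> gam w = w.
Proof.
move=> dg even Dz gz; have [ag _ gE] := dg.
have [g'1|g'1] := eqVneq (cderive gam z) 1; first exact: disc_aut_fix_cderive1 ag Dz gz g'1.
have g' := holomorphic_is_cderive ag.1.1 Dz.
have critical g : holomorphic D g -> (forall w, D w -> g (gam w) = g w) -> cderive g z = 0.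
  by move=> Hg; exact: fixed_point_critical oD Hg g' Dz gz g'1.
have hz : gaussian (F z).
  apply: contrapT => /(universal_cderive_neq0 univF Dz); rewrite critical ?eqxx // => w Dw.
  by rewrite gE // addr0.
have dg0 : deck F (pair_base 0) gam by rewrite pair_base0.
have [i0 [poly0 poly_neq0]] := pair_poly_zero hz.
suff : flip_parity gam 0 = true by rewrite even.
apply: (@parity_single _ _ i0) => [|i /poly_neq0 ne].
  apply: contraT => noflip; have := pair_sqrt_simple_zero Dz hz poly0.
  rewrite critical ?eqxx //; first exact: holomorphic_pair_sqrt.
  by move=> w Dw; rewrite (sign_flipP i0 dg0 Dw) (negbTE noflip) subr0.
apply/negbTE/negP => flip; have := sign_flipP i dg0 Dz; rewrite flip gz subr0 => /esym/eqP.
by apply/negP; apply: neq_opp; rewrite -sqrf_eq0 pair_sqrt_sqr.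
Qed.

Lemma deck_iter t gam m z : deck F t gam -> D z -> D (iter m gam z) /\
  F (iter m gam z) = F z + t *+ m.
Proof.
move=> [ag _ gE] Dz; elim: m => [|m [Dm IH]]; first by rewrite addr0.
by split=> /=; [exact: ag.1.2|rewrite gE // IH mulrSr addrA].
Qed.

Lemma even_deck_torsion_free n gam m : even_deck n gam -> (0 < m)%N ->
  (forall z, D z -> iter m gam z = z) -> forall z, D z -> gam z = z.
Proof.
move=> [p [dg _ even]] m0 fin; have [ag _ _] := dg.
have p0 : p = 0.
  apply: pair_base_inj; rewrite pair_base0; apply/eqP.
  have [_] := deck_iter m dg D0; rewrite fin // -{1}(addr0 (F 0)) => /addrI /esym/eqP.
  by rewrite mulrn_eq0 gtn_eqF.
have [z Dz gz] := finite_order_fixed ag m0 fin.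
by rewrite p0 in dg even; exact: even_deck_fixed dg even Dz gz.
Qed.

Lemma gaussian_multiple_pair_base n t : gaussian_multiple (2 * n) t ->
  exists2 p, t = pair_base p & gaussian_multiple n (pair_base p).
Proof.
move=> [_ [a [b ->]] ->]; exists (n%:Z * a, (2 * n)%:Z * b).
  rewrite natr_complex; apply/eqP; rewrite eq_complex /= !mul0r subr0 addr0.
  by rewrite !intrM -!pmulrn natrM -mulrA !eqxx.
exists (Complex (2 * a)%:~R (2 * b)%:~R); first by exists (2 * a), (2 * b).
rewrite natr_complex; apply/eqP; rewrite eq_complex /= !mul0r subr0 addr0.
by rewrite !intrM -!pmulrn natrM !mulrA ![n%:R * 2]mulrC !eqxx.
Qed.

Lemma even_deck_cocompact n : (0 < n)%N -> exists2 r : R, 0 <= r /\ r < 1 &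
  forall z, D z -> exists2 gam, even_deck n gam & nc (gam z) <= r.
Proof.
move=> n0; have [|r [r0 r1] cpt] := @cocompact _ F univF (2 * n); first by rewrite muln_gt0.
have {}cpt z : D z -> exists gam p, [/\ deck F (pair_base p) gam,
    gaussian_multiple n (pair_base p) & nc (gam z) <= r].
  move=> /cpt[gam [t [dg /gaussian_multiple_pair_base[p tE mp] gr]]].
  by exists gam, p; split=> //; rewrite -tE.
have [[f [q [df mq odd]]]|no_odd] := pselect (exists f q,
   [/\ deck F (pair_base q) f, gaussian_multiple n (pair_base q) & flip_parity f q = true]).
- have [af _ _] := df; have [s [s0 s1] fs] := selfmap_compact r1 af.1.
  exists (Num.max r s); first by split; [rewrite le_max r0|rewrite gt_max r1].
  move=> z /cpt[gam [p [dg mp gr]]]; case even : (flip_parity gam p); last first.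
    by exists gam; [exists p|rewrite le_max gr].
  exists (fun z => f (gam z)); last by rewrite le_max fs ?orbT.
  exists (q + p); rewrite pair_baseD; split; [exact: deck_comp|exact: gaussian_multipleD|].
  by rewrite flip_parity_comp // odd even.
- exists r => // z /cpt[gam [p [dg mp gr]]]; exists gam => //; exists p; split=> //.
  by apply/negbTE/negP => odd; apply: no_odd; exists gam, p.
Qed.

Lemma deck_isolated : exists2 d : R, 0 < d & forall t gam, deck F t gam ->
  (forall z, nc z <= 1 / 2 -> nc (gam z - z) < d) -> forall z, D z -> gam z = z.
Proof.
have [_ _ F'0 _] := univF; have [e e0 inj] := local_injective ltr01 HF F'0.
have [s s0 near1] := holomorphic_continuous HF D0 ltr01.
exists (Num.min (e / 2) s) => [|t gam [ag ht gE] small].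
  by rewrite lt_min s0 andbT; lra.
have close z : nc z <= 1 / 2 -> [/\ nc (gam z - z) < e / 2, nc (gam z - z) < s & D z].
  by move=> z2; have := small z z2; rewrite lt_min unit_discE => /andP[];  split=> //; lra.
have [_ g0s _] : [/\ nc (gam 0 - 0) < e / 2, nc (gam 0 - 0) < s & D 0].
  by apply: close; rewrite nc0; lra.
have t0 : t = 0.
  apply: gaussian_close_eq ht (@gaussian0 R) _; rewrite subr0.
  by have := near1 (gam 0) g0s; rewrite gE // [F 0 + t]addrC addrK.
have fix_near z : disc 0 (Num.min (e / 2) (1 / 2)) z -> gam z = z.
  rewrite disc0E lt_min => /andP[ze /ltW/close[ge _ Dz]]; apply: inj.
  - by rewrite disc0E; have := ncB_ge (gam z) z; lra.
  - by rewrite disc0E; lra.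
  - by rewrite gE // t0 addr0.
have p0 : 0 < Num.min (e / 2) (1 / 2) by rewrite lt_min; apply/andP; split; lra.
apply: (disc_aut_fix_cderive1 ag D0); first by apply: fix_near; exact: disc_center.
exact: cderiveE (is_cderive_near p0 (fun w wd => esym (fix_near w wd)) (is_cderive_id 0)).
Qed.

End TorsionFree.

(** * The second fundamental form of a graph *)

Section SecondDerivatives.
Variable R : realType.
Local Notation C := (R[i]).
Implicit Types (a b c z w : C) (f g : C -> C) (U V : set C) (r : R).
Local Notation D := (@unit_disc R).
Local Notation cderive2 f := (cderive (cderive f)).

Lemma holo_onE c r f : holo_on c r f <-> cderivable_n 2 (disc c r) f.
Proof.
have d1E : (fun v : C => 'D_1 (f : C^o -> C^o) v) = cderive f by exact: d1_cderive.
split=> [hf|[f' [f'' _]] w wr]; last first.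
  by rewrite d1E; split; apply/derivable_cderive; [exact: f'|exact: f''].
split=> [w wr|]; first by have [/derivable_cderive] := hf w wr.
by split=> // w wr; have [_] := hf w wr; rewrite d1E => /derivable_cderive.
Qed.

Lemma cderive_comp U V f g z : (forall w, U w -> V (f w)) -> cderivable_n 1 U f ->
  cderivable_n 1 V g -> U z -> cderive (fun w => g (f w)) z = cderive g (f z) * cderive f z.
Proof.
by move=> UV [f' _] [g' _] Uz; apply/cderiveE/is_cderive_comp; [exact: f'|exact/g'/UV].
Qed.

Lemma cderive2_comp U V f g z : copen U -> (forall w, U w -> V (f w)) -> cderivable_n 2 U f ->
  cderivable_n 2 V g -> U z -> cderive2 (fun w => g (f w)) z =
    cderive2 g (f z) * cderive f z ^+ 2 + cderive g (f z) * cderive2 f z.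
Proof.
move=> oU UV Df Dg Uz; have [f' [f'' _]] := Df; have [_ [g'' _]] := Dg.
have [r r0 rU] := oU z Uz.
have chain w : disc z r w -> cderive g (f w) * cderive f w = cderive (fun w => g (f w)) w.
  by move=> /rU Uw; rewrite (cderive_comp UV (cderivable_nS Df) (cderivable_nS Dg)).
rewrite (cderiveE (is_cderive_near r0 chain
  (is_cderiveM (is_cderive_comp (f' z Uz) (g'' _ (UV z Uz))) (f'' z Uz)))).
ring.
Qed.

Lemma cderive_eq_on U f g z : copen U -> (forall w, U w -> f w = g w) -> cderivable_n 1 U f ->
  U z -> cderive g z = cderive f z.
Proof.
move=> oU fg [f' _] Uz; have [r r0 rU] := oU z Uz.
exact: cderiveE (is_cderive_near r0 (fun w wr => fg w (rU w wr)) (f' z Uz)).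
Qed.

Lemma d2_cderive f : d2 f = cderive2 f.
Proof. by rewrite -!d1_cderive. Qed.

Lemma cauchy_estimate2 f c r (M : R) : 0 < r -> holomorphic (disc c r) f ->
  (forall z, disc c r z -> nc (f z) <= M) -> nc (cderive2 f c) <= 16 * M / r ^+ 2.
Proof.
move=> r0 Hf fM; have r20 : 0 < r / 2 by lra.
have half : disc c (r / 2) `<=` disc c r by apply: disc_mono; lra.
have -> : 16 * M / r ^+ 2 = 2 * (2 * M / (r / 2)) / (r / 2) by field; rewrite gt_eqF.
apply: cauchy_estimate r20 (holomorphic_sub half (holomorphic_cderive Hf)) _ => w wr.
exact: cauchy_estimate_half r0 Hf fM wr.
Qed.

Lemma cderive_blaschke a z : nc a < 1 -> D z ->
  cderive (blaschke a) z = (1 - a * cconj a) / (1 - cconj a * z) ^+ 2.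
Proof. by rewrite unit_discE => a1 z1; apply: cderiveE; exact: is_cderive_blaschke. Qed.

Lemma cderive2_blaschke a z : nc a < 1 -> D z ->
  cderive2 (blaschke a) z = 2 * cconj a * (1 - a * cconj a) / (1 - cconj a * z) ^+ 3.
Proof.
move=> a1 Dz; have [r r0 rD] := @unit_disc_open R z Dz.
have den : 1 - cconj a * z != 0 by apply: blaschke_den_neq0 => //; rewrite -unit_discE.
have slope w : disc z r w ->
    (1 - a * cconj a) * ((1 - cconj a * w) ^+ 2)^-1 = cderive (blaschke a) w.
  by move=> /rD Dw; rewrite cderive_blaschke.
have den' := is_cderiveX 2 (is_cderiveB (is_cderive_cst 1 z) (is_cderive_mulc (cconj a) z)).
have denV' := is_cderiveV (f := fun w => (1 - cconj a * w) ^+ 2) (expf_neq0 2 den) den'.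
rewrite (cderiveE (is_cderive_near r0 slope (is_cderiveZ (1 - a * cconj a) denV'))).
by move: (cconj a) den => k den /=; field.
Qed.

End SecondDerivatives.

Section NormalPart.
Variable R : realType.
Local Notation C := (R[i]).
Implicit Types (a p q z : C) (X Z : C * C).

Definition poincare_density z : R := (1 - nc z ^+ 2) ^- 2.

Lemma poincare_density_gt0 z : nc z < 1 -> 0 < poincare_density z.
Proof. by move=> /nc_sqr_lt1 z1; rewrite invr_gt0 exprn_gt0 //; lra. Qed.

Lemma hinner_self Z X :
  hinner Z X X = (poincare_density Z.1 * nc X.1 ^+ 2 + poincare_density Z.2 * nc X.2 ^+ 2)%:C%C.
Proof. by rewrite /hinner -!mulrA !mul_cconj /hmet -!rmorphM -rmorphD. Qed.

Variables (Z : C * C) (a p q B : C).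
Hypotheses (Z1 : nc Z.1 < 1) (Z2 : nc Z.2 < 1) (a0 : a != 0).

Let kx := poincare_density Z.1.
Let ky := poincare_density Z.2.
Let T : C * C := (a, p * a).
Let A : C * C := (q, p * q + a ^+ 2 * B).
Let induced : R := kx + ky * nc p ^+ 2.

Let induced_gt0 : 0 < induced.
Proof.
have [kx0 ky0] := (poincare_density_gt0 Z1, poincare_density_gt0 Z2).
by rewrite ltr_pwDl // mulr_ge0 ?sqr_ge0 // ltW.
Qed.

Let inducedC_neq0 : kx%:C%C + ky%:C%C * (p * cconj p) != 0 :> C.
Proof.
rewrite mul_cconj -rmorphM -rmorphD -/induced eq_complex /= eqxx andbT.
by rewrite gt_eqF.
Qed.

Let conj_a0 : cconj a != 0.
Proof. by rewrite -nc_gt0 nc_conj nc_gt0. Qed.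

Let inducedCE : induced%:C%C = kx%:C%C + ky%:C%C * (p * cconj p) :> C.
Proof. by rewrite mul_cconj -rmorphM -rmorphD. Qed.

Lemma tangential_coefficient :
  hinner Z A T / hinner Z T T = q / a + ky%:C%C * a * B * cconj p / induced%:C%C.
Proof.
have TT : hinner Z T T = a * cconj a * induced%:C%C.
  rewrite hinner_self -/kx -/ky mul_cconj -rmorphM /= ncM; congr (_%:C%C).
  by rewrite /induced; ring.
rewrite TT inducedCE /hinner /= -[hmet Z.1]/(kx%:C%C) -[hmet Z.2]/(ky%:C%C) cconjM.
move: inducedC_neq0 conj_a0; move: (cconj a) (cconj p) => ca cp den ca_neq0.
by field; rewrite a0 ca_neq0 den.
Qed.

(* A = (q/a) T + (0, a^2 B), so only (0, a^2 B) contributes to the normal part of A. *)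
Lemma normal_norm : let c := hinner Z A T / hinner Z T T in
  let N := (A.1 - c * T.1, A.2 - c * T.2) in
  complex.Re (hinner Z N N) / complex.Re (hinner Z T T) ^+ 2 = nc B ^+ 2 * (kx * ky) / induced ^+ 3.
Proof.
move=> c N; have N1 : N.1 = - (ky%:C%C * a ^+ 2 * B * cconj p / induced%:C%C).
  rewrite /N /= /c tangential_coefficient inducedCE; move: inducedC_neq0; move: (cconj p) => cp den.
  by field; rewrite a0 den.
have N2 : N.2 = kx%:C%C * a ^+ 2 * B / induced%:C%C.
  rewrite /N /= /c tangential_coefficient inducedCE; move: inducedC_neq0; move: (cconj p) => cp den.
  by field; rewrite a0 den.
have [kx0 ky0] := (poincare_density_gt0 Z1, poincare_density_gt0 Z2).
rewrite !hinner_self N1 N2 /= ncN !nc_div !ncM ?ncX !nc_real nc_conj -/kx -/ky.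
rewrite (gtr0_norm kx0) (gtr0_norm ky0) (gtr0_norm induced_gt0) -/kx -/ky.
have na : nc a != 0 by rewrite nc_eq0.
move: induced_gt0; rewrite /induced; move: (nc a) (nc p) (nc B) na => na np nB na0 Igt0.
have TT : kx * na ^+ 2 + ky * (np * na) ^+ 2 = na ^+ 2 * (kx + ky * np ^+ 2) by ring.
by rewrite TT; field; rewrite na0 gt_eqF.
Qed.

End NormalPart.

Section GraphCurvature.
Variable R : realType.
Local Notation C := (R[i]).
Implicit Types (z w y : C) (f : C -> C) (eta : R).
Local Notation D := (@unit_disc R).
Local Notation cderive2 f := (cderive (cderive f)).
Let oD := @unit_disc_open R.
Let D0 := @unit_disc0 R.

Lemma chrE z : chr z = 2 * cconj z / (1 - z * cconj z).
Proof.
rewrite /chr mul_cconj -[1 - _%:C%C]/((1 : R)%:C%C - _) -rmorphB.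
by rewrite rmorphM fmorphV rmorph_nat mulrAC.
Qed.

Definition graph_curvature f z : C :=
  cderive2 f z + chr (f z) * cderive f z ^+ 2 - cderive f z * chr z.

Lemma sff_sq_graph f f1 f2 (r : R) w : selfmap f -> holo_on 0 r f1 -> nc w < r ->
  (forall y, nc y < r -> D (f1 y) /\ f2 y = f (f1 y)) -> (d1 f1 w, d1 f2 w) != (0, 0) ->
  sff_sq f1 f2 w = nc (graph_curvature f (f1 w)) ^+ 2 *
    (poincare_density (f1 w) * poincare_density (f (f1 w))) /
    (poincare_density (f1 w) + poincare_density (f (f1 w)) * nc (cderive f (f1 w)) ^+ 2) ^+ 3.
Proof.
move=> [Hf fD] /holo_onE Hf1 wr graph12; have U0 : disc 0 r w by rewrite disc0E.
have f1D y : disc 0 r y -> D (f1 y) by rewrite disc0E => /graph12[].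
have oU := @disc_open R 0 r; have Df1 := f1D w U0.
have f2E y : disc 0 r y -> f (f1 y) = f2 y by rewrite disc0E => /graph12[_ ->].
have Hff1 : cderivable_n 2 (disc 0 r) (fun y => f (f1 y)).
  exact: cderivable_n_comp oU oD f1D Hf1 (Hf 2).
have d1f2 y : disc 0 r y -> cderive (fun y => f (f1 y)) y = cderive f2 y.
  by move=> yr; rewrite (cderive_eq_on oU f2E (cderivable_nS Hff1) yr).
have d2f2 : cderive2 f2 w =
    cderive2 f (f1 w) * cderive f1 w ^+ 2 + cderive f (f1 w) * cderive2 f1 w.
  by rewrite -(cderive2_comp oU f1D Hf1 (Hf 2) U0) (cderive_eq_on oU d1f2 Hff1.2 U0).
rewrite /sff_sq d1_cderive d2_cderive d1_cderive d2_cderive d2f2 -(f2E w U0) -d1f2 //.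
rewrite (cderive_comp f1D (cderivable_nS Hf1) (Hf 1) U0) /=.
set p := cderive f (f1 w); set a := cderive f1 w => T0.
have a0 : a != 0 by apply: contraNneq T0 => ->; rewrite mulr0.
pose q := cderive2 f1 w + chr (f1 w) * a ^+ 2; pose B := graph_curvature f (f1 w).
have -> : cderive2 f (f1 w) * a ^+ 2 + p * cderive2 f1 w + chr (f (f1 w)) * (p * a) ^+ 2 =
    p * q + a ^+ 2 * B by rewrite /q /B /graph_curvature -/p; ring.
have Zlt1 y : D y -> nc y < 1 by rewrite unit_discE.
exact: (@normal_norm _ (f1 w, f (f1 w)) a p q B (Zlt1 _ Df1) (Zlt1 _ (fD _ Df1)) a0).
Qed.

Lemma cderive2_recentre f z : selfmap f -> D z -> cderive2 (recentre z (f z) f) 0 =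
  (1 - z * cconj z) ^+ 2 / (1 - f z * cconj (f z)) * graph_curvature f z.
Proof.
move=> [Hf fD] Dz; have Dfz := fD z Dz.
have [z1 fz1] : nc z < 1 /\ nc (f z) < 1 by rewrite -!unit_discE.
have zN1 : nc (- z) < 1 by rewrite ncN.
have [Hm mD] := selfmap_blaschke zN1; have [Hb _] := selfmap_blaschke fz1.
have fmD y : D y -> D (f (blaschke (- z) y)) by move=> /mD /fD.
have m0 : blaschke (- z) 0 = z by rewrite blaschke_0 opprK.
have Hfm := holomorphic_comp oD oD mD Hm Hf.
rewrite (cderive2_comp oD fmD (Hfm 2) (Hb 2) D0) (cderive2_comp oD mD (Hm 2) (Hf 2) D0).
rewrite (cderive_comp mD (Hm 1) (Hf 1) D0) m0 !cderive_blaschke // !cderive2_blaschke //.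
rewrite /graph_curvature !chrE cconjN !mulr0 !subr0 !expr1n !divr1 mulrNN.
have := blaschke_den_self_neq0 fz1; have := blaschke_den_self_neq0 z1.
rewrite [cconj (f z) * f z]mulrC; move: (cconj z) (cconj (f z)) => cz cf den denf.
by field; rewrite den denf.
Qed.

Lemma graph_curvature_le f z eta : selfmap f -> D z ->
  (forall y, nc y <= 1 / 2 -> nc (recentre z (f z) f y) <= eta) ->
  (1 - nc z ^+ 2) ^+ 2 / (1 - nc (f z) ^+ 2) * nc (graph_curvature f z) <= 64 * eta.
Proof.
move=> sf Dz small.
have [z1 fz1] : nc z < 1 /\ nc (f z) < 1 by rewrite -!unit_discE; split=> //; exact: sf.2.
rewrite -!nc_blaschke_den_self // -ncX -nc_div -ncM -cderive2_recentre //.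
have [Hr _] := selfmap_recentre z1 fz1 sf.
have halfD : disc 0 (1 / 2) `<=` D by apply: disc_mono; lra.
have half0 : 0 < 1 / 2 :> R by lra.
have -> : 64 * eta = 16 * eta / (1 / 2) ^+ 2 by field.
apply: cauchy_estimate2 half0 (holomorphic_sub halfD Hr) _ => y.
by rewrite disc0E => /ltW /small.
Qed.

Lemma sff_graph_le f z eta : selfmap f -> D z ->
  (forall y, nc y <= 1 / 2 -> nc (recentre z (f z) f y) <= eta) ->
  nc (graph_curvature f z) ^+ 2 * (poincare_density z * poincare_density (f z)) /
    (poincare_density z + poincare_density (f z) * nc (cderive f z) ^+ 2) ^+ 3 <= (64 * eta) ^+ 2.
Proof.
move=> sf Dz /(graph_curvature_le sf Dz).
have [z1 fz1] : nc z < 1 /\ nc (f z) < 1 by rewrite -!unit_discE; split=> //; exact: sf.2.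
have := nc_sqr_lt1 z1; have := nc_sqr_lt1 fz1; have := nc_ge0 (graph_curvature f z).
rewrite /poincare_density.
move: (nc (graph_curvature f z)) (nc (cderive f z)) (nc z ^+ 2) (nc (f z) ^+ 2).
move=> B p s t B0 t1 s1; set u := 1 - t; set v := 1 - s => bound.
have [u0 v0] : 0 < u /\ 0 < v by rewrite /u /v; split; lra.
apply: (@le_trans _ _ ((v ^+ 2 / u * B) ^+ 2)); last first.
  have bound0 : 0 <= v ^+ 2 / u * B by rewrite mulr_ge0 // divr_ge0 ?sqr_ge0 // ltW.
  by rewrite ler_pXn2r ?nnegrE //; exact: le_trans bound.
have [k1 k2] : 0 < v ^- 2 /\ 0 < u ^- 2 by rewrite !invr_gt0 !exprn_gt0.
have -> : (v ^+ 2 / u * B) ^+ 2 = B ^+ 2 * (v ^- 2 * u ^- 2) / (v ^- 2) ^+ 3.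
  by field; rewrite !gt_eqF.
have fiber0 : 0 <= u ^- 2 * p ^+ 2 by rewrite mulr_ge0 ?sqr_ge0 // ltW.
apply: ler_wpM2l; first by rewrite mulr_ge0 ?sqr_ge0 // mulr_ge0 // ltW.
rewrite lef_pV2 ?posrE ?exprn_gt0 //; last by lra.
by rewrite ler_pXn2r ?nnegrE //; lra.
Qed.

End GraphCurvature.

(** * The curve *)

Section Graph.
Variable R : realType.
Local Notation C := (R[i]).
Implicit Types (x y z w : C) (p q : C * C).
Local Notation D := (@unit_disc R).
Let oD := @unit_disc_open R.
Let D0 := @unit_disc0 R.

Lemma bidiskE p : bidisk p <-> D p.1 /\ D p.2.
Proof. by rewrite !unit_discE. Qed.

Lemma geo_ball_radius : exists2 r : R, r < 1 & forall p, geo_ball p -> nc p.1 <= r.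
Proof.
pose E := expR 2 : R; have E0 : 0 < E by exact: expR_gt0.
exists ((E - 1) / (E + 1)); first by rewrite ltr_pdivrMr; lra.
move=> p [[p1 _] ball]; have t0 := nc_ge0 p.1; move: (nc p.1) t0 p1 ball => t t0 t1 ball.
have dist1 : pdist0 t < 1.
  have := sqr_ge0 (pdist0 (nc p.2)) => s0; rewrite ltNge; apply/negP => ge1.
  have : 1 <= pdist0 t ^+ 2 by nra.
  by lra.
rewrite /pdist0 in dist1; have den : 0 < 1 - t by lra.
have q0 : 0 < (1 + t) / (1 - t) by rewrite divr_gt0 //; lra.
have : (1 + t) / (1 - t) < E by rewrite -ltr_ln ?posrE // expRK; lra.
by rewrite ltr_pdivrMr // ler_pdivlMr; nra.
Qed.

Variable f : C -> C.
Hypothesis sf : selfmap f.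

Definition graph : set (C * C) := [set q | D q.1 /\ q.2 = f q.1].

Lemma graph_bidisk p : graph p -> bidisk p.
Proof. by move=> [p1 p2]; apply/bidiskE; rewrite p2; split=> //; exact: sf.2. Qed.

Lemma graph_cplx_curve : cplx_curve graph.
Proof.
split; first exact: graph_bidisk.
- move=> p /bidiskE[p1 p2] closure; split=> //; apply: eq_of_nc_small => e e0.
  have e20 : 0 < e / 2 by lra.
  have [d d0 near] := holomorphic_continuous sf.1 p1 e20.
  have [|q [[q1 q2] []]] := closure (Num.min d (e / 2)); first by rewrite lt_min d0.
  rewrite !lt_min q2 => /andP[/near fq _] /andP[_ pq].
  by have := nc_triangle p.2 (f q.1) (f p.1); rewrite (nc_distC p.2 (f q.1)); lra.
- move=> p [p1 p2]; exists (1 - nc p.1), f, true.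
  have sub : disc p.1 (1 - nc p.1) `<=` D.
    by move=> y; rewrite /disc /= unit_discE => yp; have := ncB_ge y p.1; lra.
  split; first by rewrite subr_gt0 -unit_discE.
  split; first by apply/holo_onE; exact: holomorphic_sub sub sf.1 2.
  by move=> q qp _; split=> [[]//|q2]; split=> //; exact: sub.
Qed.

Lemma graph_eps_geodesic (eps eta : R) : 64 * eta <= eps ->
  (forall z y, D z -> nc y <= 1 / 2 -> nc (recentre z (f z) f y) <= eta) ->
  eps_geodesic eps graph.
Proof.
move=> le small r f1 f2 w [r0 h1 h2 graph12] wr.
have Dw : D (f1 w) by have [[]] := graph12 w wr.
rewrite (sff_sq_graph sf h1 wr (fun y yr => (graph12 y yr).1) (graph12 w wr).2).
apply: le_trans (sff_graph_le sf Dw (fun y => small _ y Dw)) _.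
have eta0 : 0 <= eta by apply: le_trans (nc_ge0 _) (small 0 0 D0 _); rewrite nc0; lra.
by rewrite ler_pXn2r ?nnegrE //; lra.
Qed.

Lemma graph_modeled (d eta r : R) : eta < d -> r < 1 -> 0 < d ->
  (forall p, geo_ball p -> nc p.1 <= r) ->
  (forall z y, D z -> nc y <= r -> nc (recentre z (f z) f y) <= eta) ->
  modeled_horizontal d graph.
Proof.
move=> ed r1 d0 ball small [z y] [/= Dz ->].
have [z1 fz1] : nc z < 1 /\ nc (f z) < 1 by rewrite -!unit_discE; split=> //; exact: sf.2.
have mob1E a x : mob a 1 x = blaschke a x by rewrite /mob mul1r.
exists (fun p => (mob z 1 p.1, mob (f z) 1 p.2)); split.
- by exists false, z, 1, (f z), 1; split=> //; rewrite nc1.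
- by rewrite /= !mob1E !blaschke_self.
- move=> [x y'] [/= Dx ->] /ball; rewrite /= !mob1E => xr.
  have x1 : nc x < 1 by rewrite -unit_discE.
  by have := small z _ Dz xr; rewrite /recentre blaschkeK // => /le_lt_trans; apply.
- move=> x /ball /= xr; have x1 : nc x < 1 by lra.
  have zN1 : nc (- z) < 1 by rewrite ncN.
  exists (blaschke (- z) x, f (blaschke (- z) x)); split=> /=.
  + by split=> //=; rewrite unit_discE blaschke_lt1.
  + by rewrite mob1E blaschkeNK // subrr nc0.
  + by rewrite mob1E; apply: le_lt_trans ed; exact: small.
Qed.

Lemma totally_geodesic_graph_curvature z :
  totally_geodesic graph -> D z -> graph_curvature f z = 0.
Proof.
move=> geodesic Dz; have z1 : nc z < 1 by rewrite -unit_discE.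
pose r := 1 - nc z; have r0 : 0 < r by rewrite /r; lra.
have oU := @disc_open R 0 r; have U0 : nc (0 : C) < r by rewrite nc0.
have shiftD w : disc 0 r w -> D (w + z).
  by rewrite disc0E unit_discE /r; have := ncD w z; lra.
have Hshift : holomorphic (disc 0 r) (fun w => w + z).
  by apply: holomorphicD => //; [exact: holomorphic_id|exact: holomorphic_cst].
have Hf2 := holomorphic_comp oU oD shiftD Hshift sf.1.
have shift' w : cderive (fun w => w + z) w = 1.
  by rewrite (cderiveE (is_cderiveD (is_cderive_id w) (is_cderive_cst z w))) addr0.
have param : curve_param graph r (fun w => w + z) (fun w => f (w + z)).
  split=> //; [exact/holo_onE/Hshift|exact/holo_onE/Hf2|].
  move=> w wr; split; first by split=> //; apply: shiftD; rewrite disc0E.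
  by rewrite d1_cderive shift'; apply/eqP => -[] /eqP; rewrite oner_eq0.
have [_ h1 _ graph12] := param; have := geodesic _ _ _ _ param U0.
rewrite (sff_sq_graph sf h1 U0 (fun y yr => (graph12 y yr).1) (graph12 0 U0).2) add0r.
have k1 := poincare_density_gt0 z1.
have k2 : 0 < poincare_density (f z).
  by apply: poincare_density_gt0; rewrite -unit_discE; exact: sf.2.
have den : 0 < poincare_density z + poincare_density (f z) * nc (cderive f z) ^+ 2.
  by have := mulr_ge0 (ltW k2) (sqr_ge0 (nc (cderive f z))); lra.
apply: contra_eq => ne0.
by rewrite gt_eqF // divr_gt0 ?exprn_gt0 // !mulr_gt0 ?exprn_gt0 ?nc_gt0.
Qed.

End Graph.

Section GraphGroup.
Variable R : realType.
Local Notation C := (R[i]).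
Implicit Types (s t x z : C) (gam del : C -> C) (p : C * C).
Local Notation D := (@unit_disc R).
Local Notation cderive2 f := (cderive (cderive f)).
Variable F : C -> C.
Hypothesis univF : universal_at F (cell_center R).
Variables (n : nat) (f : C -> C).
Hypothesis n1 : (1 < n)%N.
Hypothesis divf : divides_by F n f.
Let n0 : (0 < n)%N := ltnW n1.
Let sf : selfmap f := divf.1.
Let oD := @unit_disc_open R.
Let D0 := @unit_disc0 R.
Let HF := universal_holomorphic univF.

Definition graph_group : set (C * C -> C * C) := [set g |
  exists gam gam', [/\ even_deck univF n gam, exists s, deck F s gam',
    forall z, D z -> f (gam z) = gam' (f z) &
    forall p, bidisk p -> g p = (gam p.1, gam' p.2)]].

Lemma even_deck_deck gam : even_deck univF n gam -> exists t, deck F t gam.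
Proof. by move=> [p [dg _ _]]; exists (pair_base R p). Qed.

Lemma even_deck_aut gam : even_deck univF n gam -> disc_aut gam.
Proof. by move=> /even_deck_deck[t []]. Qed.

Lemma even_deck_lift gam : even_deck univF n gam ->
  exists gam', (exists s, deck F s gam') /\ forall z, D z -> f (gam z) = gam' (f z).
Proof.
move=> [p [dg [s hs E] _]]; rewrite E in dg.
have [gam' dg' fE] := division_equivariant univF n0 divf hs dg.
by exists gam'; split=> //; exists s.
Qed.

Lemma graph_group_inv g : graph_group g ->
  exists h, [/\ graph_group h, eqD (h \o g) id & eqD (g \o h) id].
Proof.
move=> [gam [gam' [hg [s dg'] fg gE]]].
have [del [hd dK gK]] := even_deck_inv hg; have [del' [dd' dK' gK']] := deck_inv dg'.
have dD := (even_deck_aut hd).1.2; have [ad' _ _] := dd'.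
exists (fun p => (del p.1, del' p.2)); split.
- exists del, del'; split=> //; first by exists (- s).
  move=> z Dz; rewrite -{2}(gK z Dz) fg; last exact: dD.
  by rewrite dK' //; apply: sf.2; exact: dD.
- move=> p bp; have /bidiskE[p1 p2] := bp.
  by rewrite /= gE // dK // dK' //; case: p {bp p1 p2}.
- move=> p /bidiskE[p1 p2]; rewrite /= gE; first by rewrite /= gK // gK' //; case: p {p1 p2}.
  by apply/bidiskE; split; [exact: dD|exact: ad'.1.2].
Qed.

Lemma graph_group_aut : aut_group graph_group.
Proof.
split; last exact: graph_group_inv.
- move=> g [gam [gam' [hg [s [ag' _ _]] _ gE]]].
  have [a1 [u1 [na1 nu1 E1]]] := disc_aut_mob (even_deck_aut hg).
  have [a2 [u2 [na2 nu2 E2]]] := disc_aut_mob ag'.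
  exists false, a1, u1, a2, u2; split=> // p bp.
  by have /bidiskE[p1 p2] := bp; rewrite gE // /aut_formula /= E1 // E2.
- exists id, id; split=> //; first exact: even_deck_id.
    by exists 0; exact: deck_id.
  by case.
- move=> g h [gam [gam' [hg [s dg] fg gE]]] [del [del' [hd [t dd] fd hE]]].
  have dD := (even_deck_aut hd).1.2; have [ad' _ _] := dd.
  exists (fun z => gam (del z)), (fun z => gam' (del' z)); split.
  + exact: even_deck_comp.
  + by exists (s + t); exact: deck_comp.
  + by move=> z Dz; rewrite fg ?fd //; exact: dD.
  + move=> p bp; rewrite /= hE //; have /bidiskE[p1 p2] := bp.
    by rewrite gE //; apply/bidiskE; split; [exact: dD|exact: ad'.1.2].
Qed.

Lemma division_not_gaussian z : F z = cell_center R \/ F z = 1 -> D z -> ~ gaussian (F (f z)).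
Proof.
move=> Fz Dz; rewrite divf.2 //; case: Fz => ->; first exact: cell_center_div_not_gaussian.
have nC0 : (n%:R : C) != 0 by rewrite pnatr_eq0 -lt0n.
apply: small_not_gaussian; first by rewrite mulf_neq0 ?oner_neq0 // invr_neq0.
by rewrite nc_div nc1 nc_nat ltr_pdivrMr ?ltr0n // mul1r ltr1n.
Qed.

Lemma graph_group_torsion_free : torsion_free graph_group.
Proof.
move=> g m [gam [gam' [hg [s dg'] fg gE]]] m0 fin.
have gD := (even_deck_aut hg).1.2; have [ag' _ g'E] := dg'.
have iterE k p : bidisk p -> bidisk (iter k g p) /\ (iter k g p).1 = iter k gam p.1.
  move=> bp; elim: k => [|k [bk IH]] //=; rewrite gE //=; have /bidiskE[p1 p2] := bk.
  by split; [apply/bidiskE; split; [exact: gD|exact: ag'.1.2]|rewrite IH].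
have gam_id z : D z -> gam z = z.
  apply: (even_deck_torsion_free hg m0) => y Dy.
  have by0 : bidisk (y, 0 : C) by apply/bidiskE.
  by have [_ <-] := iterE m _ by0; rewrite fin.
have g'f : gam' (f 0) = f 0 by rewrite -fg // gam_id.
have Df0 : D (f 0) by exact: sf.2.
have s0 : s = 0 by have := g'E _ Df0; rewrite g'f -{1}[F (f 0)]addr0 => /addrI.
rewrite s0 in dg'; have [_ F0 _ _] := univF.
have non0 := division_not_gaussian (or_introl F0) D0.
have gam'_id z (Dz : D z) := deck_unique univF dg' (deck_id F) Df0 non0 g'f Dz.
move=> p bp; have /bidiskE[p1 p2] := bp.
by rewrite gE // gam_id // gam'_id //; case: p {bp p1 p2}.
Qed.

Lemma graph_group_discrete : discrete_group graph_group.
Proof.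
have [d d0 isolated] := deck_isolated univF.
exists (1 / 2), d; split; [lra|lra|exact: d0|].
move=> g [gam [gam' [/even_deck_deck[t dg] [s dg'] _ gE]]] small.
have half0 : nc (0 : C) <= 1 / 2 by rewrite nc0; lra.
have halfD x : nc x <= 1 / 2 -> D x by move=> x2; rewrite unit_discE; lra.
have gam_id : forall z, D z -> gam z = z.
  apply: (isolated _ _ dg) => z z2; have := (small (z, 0) z2 half0).1.
  by rewrite gE //; apply/bidiskE; split=> //; exact: halfD.
have gam'_id : forall z, D z -> gam' z = z.
  apply: (isolated _ _ dg') => z z2; have := (small (0, z) half0 z2).2.
  by rewrite gE //; apply/bidiskE; split=> //; exact: halfD.
move=> p bp; have /bidiskE[p1 p2] := bp.
by rewrite gE // gam_id // gam'_id //; case: p {bp p1 p2}.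
Qed.

Lemma graph_compact : compact_curve_lift graph_group (graph f).
Proof.
split; first exact: graph_cplx_curve.
- by exists (0, f 0).
- move=> g p [gam [gam' [hg _ fg gE]]] gp; rewrite gE; last exact: graph_bidisk gp.
  have [p1 p2] := gp; split=> /=; first exact: (even_deck_aut hg).1.2.
  by rewrite p2 fg.
have [r [r0 r1] cpt] := even_deck_cocompact univF n0.
have [r' [r'0 r'1] fr'] := selfmap_compact r1 sf.
exists (Num.max r r'); split; first by rewrite gt_max r1.
move=> [z y] [/= Dz ->]; have [gam hg gr] := cpt z Dz.
have [del [hd dK gK]] := even_deck_inv hg; have [del' [dd' fd]] := even_deck_lift hd.
have Dg : D (gam z) by exact: (even_deck_aut hg).1.2.
exists (fun p => (del p.1, del' p.2)), (gam z, f (gam z)); split=> //=.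
- by exists del, del'; split.
- by rewrite le_max gr.
- by rewrite le_max fr' ?orbT.
- by rewrite -fd // dK.
Qed.

(* F o f = F / n, and F has a double point at z but is regular at f z. *)
Lemma division_critical z : D z -> F z = 1 -> cderive f z = 0 /\ cderive2 f z != 0.
Proof.
move=> Dz Fz; have nV0 : (n%:R : C)^-1 != 0 by rewrite invr_eq0 pnatr_eq0 -lt0n.
have hz : gaussian (F z) by rewrite Fz; exact: gaussian1.
have [F'0 F''0] := universal_cderive2_neq0 univF Dz hz; have [Hf fD] := sf.
have regular := universal_cderive_neq0 univF (fD z Dz) (division_not_gaussian (or_intror Fz) Dz).
have FfE w : D w -> F (f w) = n%:R^-1 * F w by move=> Dw; rewrite divf.2 // mulrC.
have HFf := holomorphic_comp oD oD fD Hf HF.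
have d1E w : D w -> cderive (fun w => F (f w)) w = n%:R^-1 * cderive F w.
  move=> Dw; rewrite -(cderive_eq_on oD FfE (HFf 1) Dw).
  exact: cderiveE (is_cderiveZ _ (holomorphic_is_cderive HF Dw)).
have f'0 : cderive f z = 0.
  have /eqP := cderive_comp fD (Hf 1) (HF 1) Dz.
  by rewrite d1E // F'0 mulr0 eq_sym mulf_eq0 (negbTE regular) => /eqP.
split=> //; have := cderive2_comp oD fD (Hf 2) (HF 2) Dz.
rewrite -(cderive_eq_on oD d1E (holomorphic_cderive HFf 1) Dz).
rewrite (cderiveE (is_cderiveZ _ (holomorphic_is_cderive (holomorphic_cderive HF) Dz))).
rewrite f'0 expr0n mulr0 add0r => E; have := mulf_neq0 nV0 F''0.
by rewrite E mulf_eq0 negb_or => /andP[].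
Qed.

Lemma graph_not_totally_geodesic : ~ totally_geodesic (graph f).
Proof.
have [r [r0 r1] values] := universal_small_values univF (nc_cell_center R).
have [|x xr Fx] := values 0; first by rewrite nc0; lra.
have [gam [ag _ gE]] := deck_gaussian univF (@gaussian1 R).
have Dx : D x by rewrite unit_discE; lra.
have Dz := ag.1.2 x Dx; have [|f'0 f''0] := division_critical Dz; first by rewrite gE // Fx add0r.
move=> /(totally_geodesic_graph_curvature sf)/(_ Dz)/eqP.
by rewrite /graph_curvature f'0 expr0n mulr0 mul0r subr0 addr0 (negbTE f''0).
Qed.

End GraphGroup.

Theorem theorem1 (R : realType) (eps d : R) :
  0 < eps -> 0 < d ->
  exists (G : set (R[i] * R[i] -> R[i] * R[i])) (S : set (R[i] * R[i])),
    [/\ aut_group G, torsion_free G & discrete_group G] /\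
    [/\ compact_curve_lift G S, eps_geodesic eps S,
        modeled_horizontal d S & ~ totally_geodesic S].
Proof.
move=> eps0 d0; have [r r1 ball] := geo_ball_radius R.
pose s := Num.max r (1 / 2); have s1 : s < 1 by rewrite gt_max r1 /=; lra.
pose eta := Num.min (eps / 64) (d / 2).
have eta0 : 0 < eta by rewrite lt_min; apply/andP; split; lra.
have [eta_eps eta_d] : eta <= eps / 64 /\ eta <= d / 2 by rewrite !ge_min !lexx orbT.
have [F univF] : exists F, universal_at F (cell_center R).
  by apply: universal_exists; have := @cell_center_div_not_gaussian R 1 isT; rewrite divr1.
have [n n1 contracts] := division_contracts univF eta0 s1.
have [f divf] := division_exists univF (ltnW n1).
exists (graph_group univF n f), (graph f); split.
  split; [exact: graph_group_aut|exact: graph_group_torsion_free|exact: graph_group_discrete].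
split.
- exact: graph_compact.
- apply: (graph_eps_geodesic divf.1 (eta := eta)); first lra.
  by move=> z y Dz y2; apply: contracts => //; rewrite le_max y2 orbT.
- apply: (graph_modeled divf.1 (eta := eta) (r := s)) => //; first lra.
    by move=> p /ball pr; rewrite le_max pr.
  by move=> z y Dz ys; exact: contracts.
- exact: (graph_not_totally_geodesic univF n1 divf).
Qed.
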